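(* Let $\mathcal{M}_t\subset\mathbb{R}^3$, $t\in[0,T]$, be a moving two-dimensional compact surface whose movement is described by a family of parametrizations $f(t,\cdot)\colon M\to\mathbb{R}^3$, let $\bar M=[0,T]\times M$ carry the metric $\bar g=\alpha^2\,dt^2+g$ with $\alpha>0$, where $g=f(t,\cdot)^*\langle\cdot,\cdot\rangle_{\mathbb{R}^3}$. For all parameters $\beta,\gamma>0$ and any image sequence $I\in W^{1,\infty}(\bar M)$, the optical flow functional $$\mathcal{E}(\bar u)=\int_{\bar M}\bigl(\partial_t I+g(\nabla^g I,u)\bigr)^2\operatorname{vol}(\bar g)+\int_{\bar M}\Bigl(\beta\,\bar g(\bar u,\bar u)+\gamma\,\bar g^1_1(\bar\nabla\bar u,\bar\nabla\bar u)\Bigr)\operatorname{vol}(\bar g)$$ has a unique minimizer in $$\operatorname{dom}(\mathcal{E})=\{\bar u\in H^1(\bar M,T\bar M):\ \bar u=(0\,\partial_t,u)\ \text{with}\ u\in H^1(\bar M,TM)\}.$$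
   Context: Setting: $T>0$; $M$ is a compact two-dimensional $C^2$-manifold, possibly with boundary; $f\colon[0,T]\times M\to\mathbb{R}^3$ is a $C^2$-map such that for every $t\in[0,T]$ the map $f(t,\cdot)$ is an embedding with image $\mathcal{M}_t$. The time-dependent Riemannian metric $g=g(t)$ on $M$ is the pullback $g(t)(X,Y)=\langle T_xf(t,\cdot).X,\,T_xf(t,\cdot).Y\rangle_{\mathbb{R}^3}$ for $X,Y\in T_xM$. For fixed $t$, $\nabla^gI(t,\cdot)$ is the gradient of $I(t,\cdot)$ on $M$ with respect to $g(t)$. On the product manifold $\bar M=[0,T]\times M$ the Riemannian metric $\bar g$ is given by the block matrix $\begin{pmatrix}\alpha^2&0\\0&g\end{pmatrix}$ with respect to the splitting $T\bar M=\mathbb{R}\partial_t\oplus TM$, where $\alpha>0$ is a constant; $g$ depends on $t$. $\bar\nabla$ is the Levi-Civita connection of $\bar g$, $\operatorname{vol}(\bar g)=\alpha\operatorname{vol}(g)\,dt$ its volume density, and $\bar g^1_1=\bar g\otimes\bar g^{-1}$ is the induced metric on $1$-$1$ tensor fields, i.e. $\bar g^1_1(A,A)=\operatorname{Tr}(A^*A)$ with the adjoint taken with respect to $\bar g$. $H^1(\bar M,T\bar M)$ is the Sobolev space of vector fields on $\bar M$ that are square integrable with square integrable weak covariant derivative. A time-dependent vector field $u$ on $M$ is identified with the vector field $\bar u=(0\,\partial_t,u)$ on $\bar M$; $u\in H^1(\bar M,TM)$ means that this $\bar u$ lies in $H^1(\bar M,T\bar M)$. $W^{1,\infty}(\bar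 M)$ is the space of real-valued bounded functions on $\bar M$ with essentially bounded weak derivative. *)

(* Defs.v *)
From HB Require Import structures.
From mathcomp Require Import all_boot all_order all_algebra.
From mathcomp Require Import all_classical all_reals all_analysis.

Set Implicit Arguments.
Unset Strict Implicit.
Unset Printing Implicit Defensive.

Import Order.TTheory GRing.Theory Num.Theory.
Import numFieldNormedType.Exports.

Local Open Scope classical_set_scope.
Local Open Scope ring_scope.

(* Coordinates are row vectors, and matrices act on them from the right:
   the Jacobian [L] has entries [L a b] = d_a h_b, as in [jacobian]. *)

Section within_differential.
Context {R : realType} {n m : nat}.

Definition is_diff_within (A : set 'rV[R]_n) (h : 'rV[R]_n -> 'rV[R]_m)
    (x : 'rV[R]_n) (L : 'M[R]_(n, m)) : Prop :=
  forall e : R, 0 < e ->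
    \forall y \near within A (nbhs x),
      `|h y - h x - (y - x) *m L| <= e * `|y - x|.

(* The differential relative to [A] is unique, hence [jac] meaningful, on the
   sets used below: relatively open subsets of a half-plane, of a slab
   [0, T] x R^2 or of their intersection.  At boundary points it is the
   one-sided differential. *)
Definition jac (A : set 'rV[R]_n) (h : 'rV[R]_n -> 'rV[R]_m)
    (x : 'rV[R]_n) : 'M[R]_(n, m) :=
  xget 0 [set L | is_diff_within A h x L].

Definition C1_on (A : set 'rV[R]_n) (h : 'rV[R]_n -> 'rV[R]_m) : Prop :=
  (forall x, A x -> is_diff_within A h x (jac A h x)) /\
  {within A, continuous (jac A h)}.

End within_differential.

Definition C2_on {R : realType} {n m : nat} (A : set 'rV[R]_n)
    (h : 'rV[R]_n -> 'rV[R]_m) : Prop :=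
  C1_on A h /\ C1_on A (fun x => mxvec (jac A h x)).

Definition pd {R : realType} {n : nat} (A : set 'rV[R]_n) (h : 'rV[R]_n -> R)
    (a : 'I_n) (x : 'rV[R]_n) : R :=
  jac A (fun y => (h y)%:M : 'rV[R]_1) x a ord0.

Definition half_plane {R : realType} : set 'rV[R]_2 := [set x | 0 <= x 0 0].

(* A C^2 atlas of a two-dimensional manifold with (possibly empty) boundary.
   The atlas need not be maximal; [chart_at] selects a chart around each
   point. *)
Record surface (R : realType) (M : topologicalType) := Surface {
  chart : Type ;
  cdom : chart -> set M ;
  cimg : chart -> set 'rV[R]_2 ;
  cmap : chart -> M -> 'rV[R]_2 ;
  cinv : chart -> 'rV[R]_2 -> M ;
  chart_at : M -> chart ;
  cdom_at : forall x, cdom (chart_at x) x ;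
  cdom_open : forall i, open (cdom i) ;
  cimg_open : forall i, exists2 O, open O & cimg i = O `&` half_plane ;
  cmap_cimg : forall i x, cdom i x -> cimg i (cmap i x) ;
  cinv_cdom : forall i y, cimg i y -> cdom i (cinv i y) ;
  cmapK : forall i x, cdom i x -> cinv i (cmap i x) = x ;
  cinvK : forall i y, cimg i y -> cmap i (cinv i y) = y ;
  cmap_continuous : forall i, {within cdom i, continuous (cmap i)} ;
  cinv_continuous : forall i, {within cimg i, continuous (cinv i)} ;
  transition_C2 : forall i j,
    C2_on (cmap i @` (cdom i `&` cdom j)) (cmap j \o cinv i) }.

(* R^3 as a measure space is R * R * R with the product Lebesgue measure;
   as a normed space it is ['rV_(1 + 2)], coordinate 0 being time. *)
Definition vec3 {R : realType} (q : R * R * R) : 'rV[R]_(1 + 2) :=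
  row_mx q.1.1%:M (row_mx q.1.2%:M q.2%:M).

Definition leb3 (R : realType) :
    {measure set (measurableTypeR R * measurableTypeR R * measurableTypeR R)
       -> \bar R} :=
  (@lebesgue_measure R \x @lebesgue_measure R \x @lebesgue_measure R)%E.

Section weak_derivative.
Context {R : realType}.

Definition test_function (O : set 'rV[R]_(1 + 2)) (phi : 'rV[R]_(1 + 2) -> R) :
    Prop :=
  [/\ forall z, differentiable phi z,
      forall v, continuous (fun z => 'D_v phi z)
    & exists K, [/\ compact K, K `<=` O & forall z, ~ K z -> phi z = 0]].

Definition loc_integrable (O : set 'rV[R]_(1 + 2)) (h : 'rV[R]_(1 + 2) -> R) :
    Prop :=
  forall K, compact K -> K `<=` O ->
    (leb3 R).-integrable (vec3 @^-1` K) (fun q => (h (vec3 q))%:E).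

(* [w] is the weak partial derivative of [h] in direction [a] on the open
   set [O], tested with C^1 functions of compact support (all that is
   invariant under C^2 changes of coordinates up to order one). *)
Definition weak_pd (O : set 'rV[R]_(1 + 2)) (h : 'rV[R]_(1 + 2) -> R)
    (a : 'I_(1 + 2)) (w : 'rV[R]_(1 + 2) -> R) : Prop :=
  [/\ loc_integrable O h, loc_integrable O w &
      forall phi, test_function O phi ->
        \int[leb3 R]_q (h (vec3 q) * 'D_(delta_mx 0 a) phi (vec3 q)) =
        - \int[leb3 R]_q (w (vec3 q) * phi (vec3 q))].

End weak_derivative.

Section moving_surface.
Context {R : realType} {M : ptopologicalType}.
Variables (S : surface R M) (T : R) (f : R -> M -> 'rV[R]_3) (alpha : R).

Definition spacetime : set (R * M) := [set p | 0 <= p.1 <= T].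

Definition bdom (i : chart S) : set (R * M) :=
  [set p | 0 <= p.1 <= T /\ cdom i p.2].

Definition bimg (i : chart S) : set 'rV[R]_(1 + 2) :=
  [set z | 0 <= lsubmx z 0 0 <= T /\ cimg i (rsubmx z)].

Definition bmap (i : chart S) (p : R * M) : 'rV[R]_(1 + 2) :=
  row_mx p.1%:M (cmap i p.2).

Definition binv (i : chart S) (z : 'rV[R]_(1 + 2)) : R * M :=
  (lsubmx z 0 0, cinv i (rsubmx z)).

(* Tangent map of [f t] in the chart [i] at the point with coordinates [x]. *)
Definition tangent_map (i : chart S) (t : R) (x : 'rV[R]_2) : 'M[R]_(2, 3) :=
  jac (cimg i) (f t \o cinv i) x.

Definition is_embedding (t : R) : Prop :=
  [/\ continuous (f t), injective (f t),
      forall U, open U -> exists2 V, open V & f t @` U = V `&` range (f t)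
    & forall i x, cimg i x -> row_free (tangent_map i t x)].

Definition is_moving_surface : Prop :=
  (forall i, C2_on (bimg i) (fun z => f (binv i z).1 (binv i z).2)) /\
  (forall t, 0 <= t <= T -> is_embedding t).

Definition g_in (i : chart S) (t : R) (x : 'rV[R]_2) : 'M[R]_2 :=
  tangent_map i t x *m (tangent_map i t x)^T.

Definition gbar_in (i : chart S) (z : 'rV[R]_(1 + 2)) : 'M[R]_(1 + 2) :=
  block_mx (alpha ^+ 2)%:M 0 0 (g_in i (lsubmx z 0 0) (rsubmx z)).

(* [christoffel i z k a b] = Gamma^k_{ab}, the symbols of the Levi-Civita
   connection of gbar in the chart [i]. *)
Definition christoffel (i : chart S) (z : 'rV[R]_(1 + 2))
    (k a b : 'I_(1 + 2)) : R :=
  let dG c d e := pd (bimg i) (fun y => gbar_in i y d e) c z in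
  2^-1 * \sum_l invmx (gbar_in i z) k l * (dG a b l + dG b a l - dG l a b).

(* A tangent vector (covector, 1-1 tensor) at a point (t, x) of the spacetime
   is the row of its components (resp. the row, the matrix) in the coordinates
   (t, chart_at x).  Hence tensor fields are functions on [R * M], whose
   components in any other chart are obtained by the transformation laws
   below.  In a 1-1 tensor [A], seen as the endomorphism X |-> X *m A,
   the row index is the covariant one. *)
Definition transition (i j : chart S) (p : R * M) : 'M[R]_(1 + 2) :=
  block_mx 1%:M 0 0
    (jac (cmap i @` (cdom i `&` cdom j)) (cmap j \o cinv i) (cmap i p.2)).

Definition vector_in (i : chart S) (u : R * M -> 'rV[R]_(1 + 2)) (p : R * M) :
    'rV[R]_(1 + 2) :=
  u p *m transition (chart_at S p.2) i p.

Definition covector_in (i : chart S) (w : R * M -> 'rV[R]_(1 + 2))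
    (p : R * M) : 'rV[R]_(1 + 2) :=
  w p *m (transition i (chart_at S p.2) p)^T.

Definition tensor_in (i : chart S) (A : R * M -> 'M[R]_(1 + 2)) (p : R * M) :
    'M[R]_(1 + 2) :=
  transition i (chart_at S p.2) p *m A p *m transition (chart_at S p.2) i p.

Definition g_at (p : R * M) : 'M[R]_2 :=
  g_in (chart_at S p.2) p.1 (cmap (chart_at S p.2) p.2).

Definition gbar_at (p : R * M) : 'M[R]_(1 + 2) :=
  gbar_in (chart_at S p.2) (bmap (chart_at S p.2) p).

Definition g (p : R * M) (X Y : 'rV[R]_2) : R := (X *m g_at p *m Y^T) 0 0.

Definition gbar (p : R * M) (X Y : 'rV[R]_(1 + 2)) : R :=
  (X *m gbar_at p *m Y^T) 0 0.

Definition grad (p : R * M) (w : 'rV[R]_2) : 'rV[R]_2 := w *m invmx (g_at p).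

(* gbar (X *m A) Y = gbar X (Y *m adjoint p A). *)
Definition adjoint (p : R * M) (A : 'M[R]_(1 + 2)) : 'M[R]_(1 + 2) :=
  gbar_at p *m A^T *m invmx (gbar_at p).

Definition gbar11 (p : R * M) (A B : 'M[R]_(1 + 2)) : R :=
  \tr (adjoint p A *m B).

Definition gbar_dual (p : R * M) (w v : 'rV[R]_(1 + 2)) : R :=
  (w *m invmx (gbar_at p) *m v^T) 0 0.

Definition spacetime_type := g_sigma_algebraType (@open (R * M)%type).

(* The Riemannian volume vol(gbar), as a Borel measure: in each chart its
   density is sqrt (det gbar) = alpha * sqrt (det g). *)
Definition is_volume (vol : {measure set spacetime_type -> \bar R}) : Prop :=
  forall (i : chart S) (B : set spacetime_type), measurable B -> B `<=` bdom i ->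
    (vol B = \int[leb3 R]_(q in vec3 @^-1` (bmap i @` B))
              (Num.sqrt (\det (gbar_in i (vec3 q))))%:E)%E.

Definition measurable_in (i : chart S) (h : R * M -> R) : Prop :=
  measurable_fun
    (vec3 @^-1` bimg i
       : set (measurableTypeR R * measurableTypeR R * measurableTypeR R))
    (fun q => h (binv i (vec3 q))).

Definition is_weak_differential (h : R * M -> R) (w : R * M -> 'rV[R]_(1 + 2)) :
    Prop :=
  forall i a,
    measurable_in i (fun p => covector_in i w p 0 a) /\
    weak_pd (bimg i)° (h \o binv i) a
      (fun z => covector_in i w (binv i z) 0 a).

Definition weak_differential (h : R * M -> R) : R * M -> 'rV[R]_(1 + 2) :=
  xget (fun=> 0) [set w | is_weak_differential h w].

(* In each chart, nabla_a u^b = d_a u^b + Gamma^b_{ac} u^c. *)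
Definition is_weak_covariant_derivative (u : R * M -> 'rV[R]_(1 + 2))
    (A : R * M -> 'M[R]_(1 + 2)) : Prop :=
  forall i a b,
    measurable_in i (fun p => tensor_in i A p a b) /\
    weak_pd (bimg i)° (fun z => vector_in i u (binv i z) 0 b) a
      (fun z => tensor_in i A (binv i z) a b -
         \sum_c christoffel i z b a c * vector_in i u (binv i z) 0 c).

Definition nablabar (u : R * M -> 'rV[R]_(1 + 2)) : R * M -> 'M[R]_(1 + 2) :=
  xget (fun=> 0) [set A | is_weak_covariant_derivative u A].

Variable vol : {measure set spacetime_type -> \bar R}.

Definition in_W1oo (I : R * M -> R) : Prop :=
  [/\ forall i, measurable_in i I,
      exists C : R, {ae vol, forall p, spacetime p -> `|I p| <= C}
    & exists w, is_weak_differential I w /\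
        exists C : R,
          {ae vol, forall p, spacetime p -> gbar_dual p (w p) (w p) <= C}].

Definition in_H1 (u : R * M -> 'rV[R]_(1 + 2)) : Prop :=
  [/\ forall i b, measurable_in i (fun p => vector_in i u p 0 b),
      (\int[vol]_(p in spacetime) (gbar p (u p) (u p))%:E < +oo)%E
    & exists A, is_weak_covariant_derivative u A /\
        (\int[vol]_(p in spacetime) (gbar11 p (A p) (A p))%:E < +oo)%E].

Definition energy_dom (ubar : R * M -> 'rV[R]_(1 + 2)) : Prop :=
  in_H1 ubar /\
  exists u : R * M -> 'rV[R]_2, forall p, ubar p = row_mx 0 (u p).

Variables (beta gamma : R) (I : R * M -> R).

Definition energy (ubar : R * M -> 'rV[R]_(1 + 2)) : \bar R :=
  let dI := weak_differential I in
  (\int[vol]_(p in spacetime)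
      ((lsubmx (dI p) 0 0 +
        g p (grad p (rsubmx (dI p))) (rsubmx (ubar p))) ^+ 2)%:E +
   \int[vol]_(p in spacetime)
      (beta * gbar p (ubar p) (ubar p) +
       gamma * gbar11 p (nablabar ubar p) (nablabar ubar p))%:E)%E.

End moving_surface.

(* Main.v *)
(* Embedding spacetime isometrically in R x R^3 by (t, x) |-> (alpha t, f(t, x))
   turns gbar and gbar11 into Euclidean norms of the ambient components of a
   vector or of a tensor, whatever the chart.  The energy of u is therefore the
   sum of the squared L^2 norms of finitely many functions, which are affine in
   (u, nablabar u): the residual of the optical flow equation, and the ambient
   components of u and nablabar u scaled by sqrt beta and sqrt gamma.  The
   admissible u form a vector space which is closed under L^2 convergence of
   these functions, because weak derivatives are closed in each chart; and the
   energy of u = 0 is finite because I has a bounded weak differential.  By the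
   parallelogram identity a minimising sequence is Cauchy, which gives both
   existence and uniqueness. *)
Require Import Defs.
From HB Require Import structures.
From mathcomp Require Import all_boot all_order all_algebra.
From mathcomp Require Import all_classical all_reals all_analysis.
From mathcomp Require Import measurable_realfun ring lra.

Set Implicit Arguments.
Unset Strict Implicit.
Unset Printing Implicit Defensive.

Import Order.TTheory GRing.Theory Num.Theory.
Import numFieldNormedType.Exports.

Local Open Scope classical_set_scope.
Local Open Scope ring_scope.

(** * Entrywise limits of matrices *)

Section matrix_limits.
Context {R : realType} {T : Type} {F : set_system T} {FF : Filter F}.

(** The L^2 limit is constructed as an almost everywhere limit of functions, so it arrives as a
    family of components and has to be turned back into fields: dividing by [Num.sqrt beta] and
    [Num.sqrt gamma] recovers ambient components, and coframes recover [u] and its derivative. The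
    weak differential and [nablabar] are choices among weak derivatives; uniqueness almost
    everywhere, hence the fundamental lemma of the calculus of variations, makes the energy
    independent of them. Test functions see only the interior of a chart image, so its boundary must
    be null. The volume is known solely through charts: positivity of the density carries null sets
    both ways, a lower bound on compact sets carries L^2 convergence into a chart, and an upper
    bound on compact sets, with compactness of [M], makes the total volume finite. A C^2 motion
    gives a C^1 metric, hence merely continuous Christoffel symbols; they are bounded on compact
    subsets of the interior, which is all that compactly supported test functions require. *)

Lemma cvg_bigsum (I : Type) (r : seq I) (P : pred I) (f : I -> T -> R)
    (l : I -> R) : (forall i, P i -> f i x @[x --> F] --> l i) ->
  \sum_(i <- r | P i) f i x @[x --> F] --> \sum_(i <- r | P i) l i.
Proof.
move=> fl; elim: r => [|i r IH].
  by rewrite big_nil; under eq_fun do rewrite big_nil; exact: cvg_cst.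
rewrite big_cons; under eq_fun do rewrite big_cons.
by case: ifPn => // Pi; apply: cvgD => //; exact: fl.
Qed.

Lemma cvg_bigprod (I : Type) (r : seq I) (P : pred I) (f : I -> T -> R)
    (l : I -> R) : (forall i, P i -> f i x @[x --> F] --> l i) ->
  \prod_(i <- r | P i) f i x @[x --> F] --> \prod_(i <- r | P i) l i.
Proof.
move=> fl; elim: r => [|i r IH].
  by rewrite big_nil; under eq_fun do rewrite big_nil; exact: cvg_cst.
rewrite big_cons; under eq_fun do rewrite big_cons.
by case: ifPn => // Pi; apply: cvgM => //; exact: fl.
Qed.

(** Entrywise, so that products, determinants and inverses reduce to sums and products of real
    limits, along relative neighbourhood filters and along sequences alike. *)
Definition cvgmx (m n : nat) (f : T -> 'M[R]_(m, n)) (A : 'M[R]_(m, n)) : Prop :=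
  forall i j, f x i j @[x --> F] --> A i j.

Lemma cvgmx_cst (m n : nat) (A : 'M[R]_(m, n)) : cvgmx (fun=> A) A.
Proof. by move=> i j; exact: cvg_cst. Qed.

Lemma cvgmx_mul (m n p : nat) (f : T -> 'M[R]_(m, n)) (h : T -> 'M[R]_(n, p)) A B :
  cvgmx f A -> cvgmx h B -> cvgmx (fun x => f x *m h x) (A *m B).
Proof.
move=> fA hB i j; rewrite mxE; under eq_fun do rewrite mxE.
by apply: cvg_bigsum => k _; apply: cvgM; [exact: fA|exact: hB].
Qed.

Lemma cvgmx_tr (m n : nat) (f : T -> 'M[R]_(m, n)) A :
  cvgmx f A -> cvgmx (fun x => (f x)^T) A^T.
Proof.
by move=> fA i j; rewrite mxE; under eq_fun do rewrite mxE; exact: fA.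
Qed.

Lemma cvgmx_block (m1 m2 n1 n2 : nat) (f : T -> 'M[R]_(m1, n1))
    (g : T -> 'M[R]_(m1, n2)) (h : T -> 'M[R]_(m2, n1))
    (k : T -> 'M[R]_(m2, n2)) A B C D :
  cvgmx f A -> cvgmx g B -> cvgmx h C -> cvgmx k D ->
  cvgmx (fun x => block_mx (f x) (g x) (h x) (k x)) (block_mx A B C D).
Proof.
move=> fA gB hC kD i j; rewrite -(splitK i) -(splitK j).
case: (fintype.split i) => i'; case: (fintype.split j) => j' /=.
- by rewrite block_mxEul; under eq_fun do rewrite block_mxEul; exact: fA.
- by rewrite block_mxEur; under eq_fun do rewrite block_mxEur; exact: gB.
- by rewrite block_mxEdl; under eq_fun do rewrite block_mxEdl; exact: hC.
- by rewrite block_mxEdr; under eq_fun do rewrite block_mxEdr; exact: kD.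
Qed.

Lemma cvg_det (n : nat) (f : T -> 'M[R]_n) A :
  cvgmx f A -> \det (f x) @[x --> F] --> \det A.
Proof.
move=> fA; rewrite /determinant; apply: cvg_bigsum => s _.
apply: cvgM; first exact: cvg_cst.
by apply: cvg_bigprod => i _; exact: fA.
Qed.

(** Cramer's rule: adjugate over determinant. [invmx] fixes singular matrices, so the formula is
    available only once the determinants are nonzero, which holds eventually. *)
Lemma cvgmx_inv (n : nat) (f : T -> 'M[R]_n) A :
  A \in unitmx -> cvgmx f A -> cvgmx (fun x => invmx (f x)) (invmx A).
Proof.
move=> uA fA i j.
have dA : \det A != 0 by rewrite -unitfE -unitmxE.
have dfA := cvg_det fA.
have cvadj : (\det (f x))^-1 * \adj (f x) i j @[x --> F] --> invmx A i j.
  rewrite /invmx uA [X in _ --> X]mxE; apply: cvgM; first exact: cvgV.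
  under eq_fun do rewrite mxE; rewrite mxE /cofactor.
  apply: cvgM; first exact: cvg_cst.
  apply: cvg_det => a b; rewrite !mxE; under eq_fun do rewrite !mxE.
  exact: fA.
apply: cvg_trans cvadj; apply: near_eq_cvg.
have : \forall x \near F, \det (f x) != 0.
  exact: cvgr_neq0 dA.
apply: filterS => x dx; have ux : f x \in unitmx by rewrite unitmxE unitfE.
by rewrite /invmx ux [RHS]mxE.
Qed.

End matrix_limits.
Arguments cvgmx {R T} F {m n} f A.

(** * Least energy in convex classes closed under L^2 convergence *)

Section least_energy.
Context {d : measure_display} {X : measurableType d} {R : realType}.
Variables (mu : {measure set X -> \bar R}) (D : set X) (K : finType).
Hypothesis mD : measurable D.
Implicit Types v w : K -> X -> R.

Definition sqsum v (x : X) : R := \sum_k v k x ^+ 2.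

Definition sqnorm2 v : \bar R := (\int[mu]_(x in D) (sqsum v x)%:E)%E.

Lemma sqsum_ge0 v x : 0 <= sqsum v x.
Proof. by apply: sumr_ge0 => k _; exact: sqr_ge0. Qed.

Lemma sqr_le_sqsum v x k : v k x ^+ 2 <= sqsum v x.
Proof.
by rewrite /sqsum (bigD1 k)//= lerDl; apply: sumr_ge0 => j _; exact: sqr_ge0.
Qed.

Lemma measurable_sqsum v :
  (forall k, measurable_fun D (v k)) -> measurable_fun D (sqsum v).
Proof.
by move=> mv; apply: measurable_sum => k; exact: measurable_funX.
Qed.

Lemma sqnorm2_ge0 v : (0 <= sqnorm2 v)%E.
Proof. by apply: integral_ge0 => x _; rewrite lee_fin sqsum_ge0. Qed.

Definition subf v w : K -> X -> R := fun k x => v k x - w k x.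

Definition midpoint v w : K -> X -> R := fun k x => (v k x + w k x) / 2.

(** Free of subtractions between energies, hence valid in [0, +oo] without integrability. *)
Lemma parallelogram v w :
  (forall k, measurable_fun D (v k)) -> (forall k, measurable_fun D (w k)) ->
  (sqnorm2 (midpoint v w) + 4^-1%:E * sqnorm2 (subf v w) =
   2^-1%:E * (sqnorm2 v + sqnorm2 w))%E.
Proof.
move=> mv mw.
have mvw : measurable_fun D (sqsum (subf v w)).
  by apply: measurable_sqsum => k; exact: measurable_funB.
have mmid : measurable_fun D (sqsum (midpoint v w)).
  apply: measurable_sqsum => k; apply: measurable_funM => //.
  exact: measurable_funD.
have ms := measurable_sqsum.
have ge0 u x : D x -> (0 <= (sqsum u x)%:E)%E by rewrite lee_fin sqsum_ge0.
have mE (h : X -> R) : measurable_fun D h -> measurable_fun D (EFin \o h).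
  by move=> mh; exact/measurable_EFinP.
rewrite -ge0_integralZl//; [|exact/mE|exact: ge0].
rewrite -ge0_integralD//; [|exact: ge0|exact/mE| |]; last 2 first.
- by move=> x Dx; apply: mule_ge0 => //; exact: ge0.
- by apply: measurable_funeM; exact/mE.
rewrite -ge0_integralD//; [|exact: ge0|exact/mE/ms|exact: ge0|exact/mE/ms].
rewrite -ge0_integralZl//; last 2 first.
- by apply: emeasurable_funD; exact/mE/ms.
- by move=> x Dx; apply: adde_ge0; exact: ge0.
apply: eq_integral => x _ /=; rewrite -[LHS]/((_ + _ * _)%:E) -[RHS]/((_ * (_ + _))%:E).
congr EFin; rewrite /sqsum.
rewrite -big_split/= !big_distrr/= -big_split/=; apply: eq_bigr => k _.
by rewrite /midpoint /subf; field.
Qed.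

Variable C : set (K -> X -> R).
Hypothesis mC : forall w, C w -> forall k, measurable_fun D (w k).
Hypothesis C_midpoint : forall v w, C v -> C w -> C (midpoint v w).
(** Membership is asked of some [w'] equal to [w] off [N], since a pointwise limit is arbitrary on
    the exceptional set. *)
Hypothesis C_closed : forall (w_ : nat -> K -> X -> R) w N,
  (forall n, C (w_ n)) -> (forall k, measurable_fun D (w k)) ->
  measurable N -> mu N = 0 ->
  (forall x k, D x -> ~ N x -> w_ n k x @[n --> \oo] --> w k x) ->
  sqnorm2 (subf (w_ n) w) @[n --> \oo] --> 0%E ->
  exists2 w', C w' & forall x k, D x -> ~ N x -> w' k x = w k x.

(** The midpoint has energy at least [m], so the parallelogram identity leaves at most [e] for a
    quarter of the squared distance. With [e = 0] this is uniqueness. *)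
Lemma near_least_close (m e : R) v w : C v -> C w ->
  (forall u, C u -> m%:E <= sqnorm2 u)%E ->
  (sqnorm2 v <= (m + e)%:E)%E -> (sqnorm2 w <= (m + e)%:E)%E ->
  (sqnorm2 (subf v w) <= (4 * e)%:E)%E.
Proof.
move=> Cv Cw min vm wm.
have := parallelogram (mC Cv) (mC Cw).
have := min _ (C_midpoint Cv Cw).
move: (sqnorm2_ge0 v) vm (sqnorm2_ge0 w) wm (sqnorm2_ge0 (midpoint v w)).
move: (sqnorm2_ge0 (subf v w)).
case: (sqnorm2 v) => [a| |]//; case: (sqnorm2 w) => [b| |]//.
case: (sqnorm2 (subf v w)) => [c| |]//; case: (sqnorm2 (midpoint v w)) => [p| |]//.
- rewrite 7?lee_fin => ? ? ? ? ? ? ? h.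
  by rewrite lee_fin; have /= := congr1 fine h; lra.
- by rewrite gt0_muley ?lte_fin ?invr_gt0//.
- by rewrite gt0_muley ?lte_fin ?invr_gt0//.
Qed.

Lemma summable_increments (w_ : nat -> K -> X -> R) :
  (forall n k, measurable_fun D (w_ n k)) ->
  (forall n, sqnorm2 (subf (w_ n.+1) (w_ n)) <= (2^-1 / 8 ^+ n)%:E)%E ->
  {ae mu, forall x, D x -> forall k, cvgn (fun n => w_ n k x)}.
Proof.
move=> mw dw.
(* The weight [4 ^+ n] still leaves a summable series, [4 ^+ n * (2^-1 / 8 ^+ n)] being
   [1 / 2 ^+ n.+1], and it makes finiteness of [S x] bound the n-th increment by a multiple of
   [1 / 2 ^+ n]. *)
pose S x : \bar R := (\sum_(n <oo) (4 ^+ n * sqsum (subf (w_ n.+1) (w_ n)) x)%:E)%E.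
have S_ge0 n x : (0 <= (4 ^+ n * sqsum (subf (w_ n.+1) (w_ n)) x)%:E)%E.
  by rewrite lee_fin mulr_ge0// sqsum_ge0.
have mS n : measurable_fun D (sqsum (subf (w_ n.+1) (w_ n))).
  by apply: measurable_sqsum => k; exact: measurable_funB.
have mS4 n :
    measurable_fun D (fun x => (4 ^+ n * sqsum (subf (w_ n.+1) (w_ n)) x)%:E).
  by apply/measurable_EFinP; apply: measurable_funM.
have iS : mu.-integrable D S.
  apply/integrableP; split.
    by apply: ge0_emeasurable_sum => // n x _ _.
  rewrite (@eq_integral _ _ _ mu D S); last first.
    by move=> x _; rewrite gee0_abs//; exact: nneseries_ge0.
  rewrite /S integral_nneseries//.
  apply: (@le_lt_trans _ _ (\sum_(n <oo) (1 / (2 ^ (n + 1))%:R)%:E)%E); last first.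
    have := @cvg_geometric_eseries_half R 1 0.
    by move=> /(cvg_lim (@ereal_hausdorff _)) => ->; rewrite ltry.
  apply: lee_nneseries => [n _ _|n _]; first exact: integral_ge0.
  under eq_integral do rewrite EFinM.
  rewrite ge0_integralZl//; last 2 first.
  - exact/measurable_EFinP.
  - by move=> x _; rewrite lee_fin sqsum_ge0.
  apply: (le_trans (lee_wpmul2l _ (dw n))); first by rewrite lee_fin.
  rewrite -EFinM lee_fin natrX addn1 exprS.
  rewrite (_ : 8 = 4 * 2 :> R); last by rewrite -natrM.
  rewrite exprMn le_eqVlt; apply/orP; left; apply/eqP; field.
  by rewrite !expf_neq0.
apply: filterS (integrable_ae mD iS) => x Sfin Dx k.
have {Sfin} [s Ss] : exists s, S x = s%:E.
  by exists (fine (S x)); rewrite fineK// Sfin.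
have s_ge0 : 0 <= s by rewrite -lee_fin -Ss; exact: nneseries_ge0.
(* The square of the increment is at most [s / 4 ^+ n]; [s + 1] dominates the square root of [s], as
   [s <= (s + 1) ^+ 2]. *)
have dle n : `|w_ n.+1 k x - w_ n k x| <= (s + 1) / 2 ^+ n.
  rewrite -ler_sqr ?nnegrE// ?divr_ge0 ?addr_ge0//.
  rewrite real_normK ?num_real//.
  apply: (le_trans (sqr_le_sqsum (subf (w_ n.+1) (w_ n)) x k)).
  have : ((4 ^+ n * sqsum (subf (w_ n.+1) (w_ n)) x)%:E <= s%:E)%E.
    rewrite -Ss; apply: le_trans (nneseries_lim_ge n.+1 _) => //.
    rewrite big_nat_recr//= leeDr//; apply: sume_ge0 => i _; exact: S_ge0.
  rewrite lee_fin exprMn exprVn -exprM mulnC exprM.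
  rewrite (_ : 2 ^+ 2 = 4 :> R); last by rewrite expr2 -natrM.
  rewrite -ler_pdivlMl ?exprn_gt0// mulrC => /le_trans; apply.
  by rewrite ler_pM2r ?invr_gt0 ?exprn_gt0//; nra.
have -> : (fun n => w_ n k x) =
    (fun n => w_ 0%N k x + series (telescope (fun n => w_ n k x)) n).
  by apply/funext => n; exact: eq_sum_telescope.
apply: is_cvgD; first exact: is_cvg_cst.
apply: normed_cvg; apply: (@series_le_cvg _ _ (geometric (s + 1) 2^-1)).
- by move=> n /=.
- by move=> n /=; rewrite mulr_ge0 ?addr_ge0// exprn_ge0.
- by move=> n /=; rewrite exprVn; exact: dle.
- by apply: is_cvg_geometric_series; rewrite ger0_norm//; lra.
Qed.

(** Lower semicontinuity of the energy. It bounds the distance to the limit as well as the energy of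
    the limit, and in both cases the bound is known only from some rank [n0] on. *)
Lemma fatou_sqnorm2 (w_ : nat -> K -> X -> R) w (c : R) n0 :
  (forall n k, measurable_fun D (w_ n k)) ->
  (forall k, measurable_fun D (w k)) ->
  {ae mu, forall x, D x -> forall k, w_ n k x @[n --> \oo] --> w k x} ->
  (forall n, (n0 <= n)%N -> sqnorm2 (w_ n) <= c%:E)%E ->
  (sqnorm2 w <= c%:E)%E.
Proof.
move=> mw_ mw cvw le_c.
have mE v : (forall k, measurable_fun D (v k)) ->
    measurable_fun D (EFin \o sqsum v).
  by move=> mv; exact/measurable_EFinP/measurable_sqsum.
pose h n x : \bar R := (sqsum (w_ (n + n0)%N) x)%:E.
have mh n : measurable_fun D (h n) by exact: mE.
have h0 n x : D x -> (0 <= h n x)%E by rewrite lee_fin sqsum_ge0.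
have := fatou mu mD mh h0.
have -> : (\int[mu]_(x in D) limn_einf (h^~ x))%E = sqnorm2 w.
  apply: ae_eq_integral => //.
  - rewrite (_ : (fun x => _) =
        -%E \o (fun x => limn_esup ((fun n x => - h n x)%E^~ x)))//.
    apply: measurableT_comp => //; apply: measurable_fun_limn_esup => n.
    exact: measurableT_comp.
  - exact: mE.
  apply: filterS cvw => x cvx Dx.
  have : h n x @[n --> \oo] --> (sqsum w x)%:E.
    apply/fine_cvgP; split; first by apply: nearW => n; rewrite /h.
    apply: (@cvg_comp _ _ _ (fun n => (n + n0)%N) (fun n => sqsum (w_ n) x)).
      exact: cvg_addnr.
    by apply: cvg_bigsum => k _; apply: cvgM; exact: cvx.
  by move=> hc; rewrite is_cvg_limn_einfE ?(cvg_lim _ hc)//; apply/cvg_ex; eexists; exact: hc.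
move=> /le_trans; apply.
rewrite limn_einf_lim; apply: lime_le; first exact: is_cvg_einfs.
apply: nearW => n; apply: (@le_trans _ _ (\int[mu]_(x in D) h n x)%E).
  by apply: ereal_inf_lbound; exists n => /=.
by apply: le_c; rewrite leq_addl.
Qed.

(* A minimising sequence whose energies converge geometrically has summable
   increments, hence converges pointwise almost everywhere; Fatou's lemma makes
   this a convergence in L^2. *)
Lemma least_energy_exists : (exists2 w, C w & sqnorm2 w < +oo)%E ->
  exists w, [/\ C w, (sqnorm2 w < +oo)%E,
    (forall v, C v -> sqnorm2 w <= sqnorm2 v)%E &
    forall v, C v -> (sqnorm2 v <= sqnorm2 w)%E ->
      {ae mu, forall x, D x -> forall k, v k x = w k x}].
Proof.
move=> [u0 Cu0 u0_fin].
pose I := ereal_inf [set sqnorm2 w | w in C].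
have [m Im] : exists m, I = m%:E.
  have I_ge0 : (0 <= I)%E.
    by apply: le_ereal_inf_tmp => _ [w _ <-]; exact: sqnorm2_ge0.
  have I_fin : (I < +oo)%E.
    by apply: le_lt_trans u0_fin; apply: ereal_inf_lbound; exists u0.
  by exists (fine I); rewrite fineK// ge0_fin_numE.
have m_le u : C u -> (m%:E <= sqnorm2 u)%E.
  by move=> Cu; rewrite -Im; apply: ereal_inf_lbound; exists u.
(* The tolerance [8^-1 / 8 ^+ n] becomes, after the factor 4 of [near_least_close], the bound
   required by [summable_increments]. *)
have e_gt0 n : 0 < 8^-1 / 8 ^+ n :> R by rewrite divr_gt0 ?exprn_gt0.
have /choice[w_ w_P] : forall n, exists w,
    C w /\ (sqnorm2 w <= (m + 8^-1 / 8 ^+ n)%:E)%E.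
  move=> n; have [|_ [w Cw <-] wlt] :=
      lb_ereal_inf_adherent (e_gt0 n) (S := [set sqnorm2 w | w in C]).
    by rewrite -/I Im.
  by exists w; split => //; rewrite EFinD -Im ltW.
have Cw_ n : C (w_ n) by case: (w_P n).
have mw_ n k : measurable_fun D (w_ n k) by apply: mC.
have e_anti n p : (n <= p)%N -> 8^-1 / 8 ^+ p <= 8^-1 / 8 ^+ n :> R.
  move=> np; rewrite ler_pM2l ?invr_gt0// lef_pV2 ?posrE ?exprn_gt0//.
  by rewrite ler_weXn2l// ler1n.
have w_le n p : (n <= p)%N -> (sqnorm2 (w_ p) <= (m + 8^-1 / 8 ^+ n)%:E)%E.
  move=> np; have [_ /le_trans] := w_P p; apply.
  by rewrite lee_fin lerD2l e_anti.
have d_le n p : (n <= p)%N ->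
    (sqnorm2 (subf (w_ p) (w_ n)) <= (2^-1 / 8 ^+ n)%:E)%E.
  move=> np; rewrite (_ : 2^-1 / 8 ^+ n = 4 * (8^-1 / 8 ^+ n)); last first.
    by field; rewrite expf_neq0.
  exact: (near_least_close (Cw_ p) (Cw_ n) m_le (w_le _ _ np) (w_le _ _ (leqnn n))).
have [N [mN N0 subN]] : {ae mu, forall x, D x -> forall k, cvgn (fun n => w_ n k x)}.
  by apply: summable_increments => // n; exact: d_le.
have w_cvg x k : D x -> ~ N x -> cvgn (fun n => w_ n k x).
  move=> Dx Nx; have : (forall k, D x -> cvgn (fun n => w_ n k x)).
    apply: contra_notP Nx => /existsNP[j nc]; apply: subN => /= c.
    by apply: nc => Dx'; exact: c.
  by apply.
(* Multiplying by the indicator makes the sequence converge at every point of [D], so the limit is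
   measurable on all of [D]. *)
pose w k x := limn (fun n => w_ n k x * \1_(~` N) x).
have w_lim_all x k : D x -> (w_ n k x * \1_(~` N) x) @[n --> \oo] --> w k x.
  move=> Dx; apply: (_ : cvgn (fun n => w_ n k x * \1_(~` N) x)).
  have [Nx|Nx] := pselect (N x).
    rewrite (_ : (fun n => _) = cst 0); first exact: is_cvg_cst.
    by apply/funext => n /=; rewrite indicE memNset ?mulr0//=; apply.
  rewrite (_ : (fun n => _) = (fun n => w_ n k x)); first exact: w_cvg.
  by apply/funext => n /=; rewrite indicE mem_set ?mulr1.
have w_lim x k : D x -> ~ N x -> w_ n k x @[n --> \oo] --> w k x.
  move=> Dx Nx; move: (w_lim_all x k Dx).
  by under eq_fun do rewrite indicE mem_set// mulr1.
have mw k : measurable_fun D (w k).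
  apply: (measurable_fun_cvg (h := fun n x => w_ n k x * \1_(~` N) x)) => //.
    move=> n; apply: measurable_funM => //.
    by apply: measurable_indic; exact: measurableC.
  by move=> x Dx; exact: w_lim_all.
have ae_w_lim : {ae mu, forall x, D x -> forall k, w_ n k x @[n --> \oo] --> w k x}.
  exists N; split => // x /= nc; apply: contrapT => Nx; apply: nc => Dx k.
  exact: w_lim.
have w_close n : (sqnorm2 (subf (w_ n) w) <= (2^-1 / 8 ^+ n)%:E)%E.
  have -> : sqnorm2 (subf (w_ n) w) = sqnorm2 (subf w (w_ n)).
    apply: eq_integral => x _; congr EFin; apply: eq_bigr => k _ /=.
    by rewrite -sqrrN opprB.
  (* Here [n] stays fixed while [p] tends to infinity. *)
  apply: (@fatou_sqnorm2 (fun p => subf (w_ p) (w_ n)) _ _ n).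
  - by move=> p k; exact: measurable_funB.
  - by move=> k; exact: measurable_funB.
  - apply: filterS ae_w_lim => x cx Dx k.
    by apply: cvgB; [exact: cx|exact: cvg_cst].
  - by move=> p; exact: d_le.
have w_cvg0 : sqnorm2 (subf (w_ n) w) @[n --> \oo] --> 0%E.
  apply: (@squeeze_cvge _ _ _ _ (cst 0%E) _ (fun n => (2^-1 / 8 ^+ n)%:E)).
  - by apply: nearW => n; rewrite sqnorm2_ge0 w_close.
  - exact: cvg_cst.
  - apply/fine_cvgP; split; first exact: nearW.
    rewrite [X in X @ _ --> _](_ : _ = geometric (2^-1 : R) 8^-1).
      by apply: cvg_geometric; rewrite ger0_norm// invf_lt1// ltr1n.
    by apply/funext => n /=; rewrite exprVn.
have [w' Cw' w'w] := C_closed Cw_ mw mN N0 w_lim w_cvg0.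
have w'_norm : sqnorm2 w' = sqnorm2 w.
  apply: ae_eq_integral => //.
  - by apply/measurable_EFinP/measurable_sqsum; exact: mC.
  - by apply/measurable_EFinP/measurable_sqsum.
  exists N; split => // x /= nc; apply: contrapT => Nx; apply: nc => Dx.
  by congr EFin; apply: eq_bigr => k _; rewrite w'w.
have w_m : (sqnorm2 w <= m%:E)%E.
  apply/lee_addgt0Pr => e e0.
  have : \forall n \near \oo, 8^-1 / 8 ^+ n < e.
    have : geometric (8^-1 : R) 8^-1 n @[n --> \oo] --> 0.
      by apply: cvg_geometric; rewrite ger0_norm// invf_lt1// ltr1n.
    move=> /cvgr0Pnorm_lt /(_ e e0); apply: filterS => n /=.
    by rewrite exprVn gtr0_norm.
  move=> [n _ /(_ n (leqnn n)) en].
  apply: (@fatou_sqnorm2 w_ _ _ n) => // p np.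
  by apply: le_trans (w_le _ _ np) _; rewrite lee_fin lerD2l ltW.
exists w'; rewrite w'_norm; split => //.
- by apply: le_lt_trans w_m _; rewrite ltry.
- by move=> v Cv; apply: le_trans w_m _; exact: m_le.
move=> v Cv vw.
(* A second least element is within tolerance zero, so its distance to [w'] vanishes. *)
have : (sqnorm2 (subf v w') <= (4 * 0)%:E)%E.
  apply: (near_least_close Cv Cw' m_le); rewrite addr0 ?w'_norm//.
  exact: le_trans vw w_m.
rewrite mulr0 => vw0.
have {}vw0 : (\int[mu]_(x in D) `|(sqsum (subf v w') x)%:E| = 0)%E.
  apply/eqP; rewrite eq_le integral_ge0// andbT; apply: le_trans vw0.
  by under eq_integral do rewrite gee0_abs ?lee_fin ?sqsum_ge0//.
have : ae_eq mu D (EFin \o sqsum (subf v w')) (cst 0%E).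
  apply/ae_eq_integral_abs => //.
  apply/measurable_EFinP/measurable_sqsum => k.
  by apply: measurable_funB; exact: mC.
apply: filterS => x /= h Dx k; have {h} [h] := h Dx.
have := sqr_le_sqsum (subf v w') x k; rewrite h /= => le0.
by apply/eqP; rewrite -subr_eq0 -sqrf_eq0 eq_le le0 sqr_ge0.
Qed.

End least_energy.

(** * Coordinates on R^3 *)

Section matrix_norm.
Context {R : realType} {m n : nat}.
Implicit Types A : 'M[R]_(m, n).

Lemma ler_mx_norm_coord A i j : `|A i j| <= `|A|.
Proof.
rewrite /Num.Def.normr/= mx_normrE.
exact: (le_bigmax _ (fun p : 'I_m * 'I_n => `|A p.1 p.2|) (i, j)).
Qed.

Lemma mx_norm_leP A (e : R) : 0 <= e ->
  (`|A| <= e) <-> (forall i j, `|A i j| <= e).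
Proof.
move=> e0; split=> [Ae i j|Ae].
  exact: le_trans (ler_mx_norm_coord A i j) Ae.
rewrite /Num.Def.normr/= mx_normrE; by apply/bigmax_leP; split => // -[i j] _ /=; exact: Ae.
Qed.

Lemma mx_norm_ltP A (e : R) : 0 < e ->
  (`|A| < e) <-> (forall i j, `|A i j| < e).
Proof.
move=> e0; split=> [Ae i j|Ae].
  exact: le_lt_trans (ler_mx_norm_coord A i j) Ae.
rewrite /Num.Def.normr/= mx_normrE; by apply/bigmax_ltP; split => // -[i j] _ /=; exact: Ae.
Qed.

End matrix_norm.

(** The rational data make the balls countable. The doubled radius leaves room for a bump function
    that is positive on the small ball and supported in the closed double ball, still inside [O]. *)
Lemma open_rat_ball {R : realType} (n : nat) (O : set 'rV[R]_n) z :
  open O -> O z -> exists (c : 'rV[rat]_n) (r : rat),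
    [/\ 0 < ratr r :> R, `|z - map_mx ratr c| < ratr r &
        forall y, `|y - map_mx ratr c| <= 2 * ratr r -> O y].
Proof.
rewrite openE => /[apply] /nbhs_normP[e /= e0 eO].
have [r] := @rat_in_itvoo R 0 (e / 4) (divr_gt0 e0 (ltr0n _ 4)).
rewrite in_itv/= => /andP[r0 re].
have /choice[c cP] : forall i, exists q : rat, `|z ord0 i - ratr q| < ratr r.
  move=> i; have [|q] := @rat_in_itvoo R (z ord0 i - ratr r) (z ord0 i + ratr r).
    by rewrite ltrBlDr -addrA ltrDl addr_gt0.
  rewrite in_itv/= => /andP[q1 q2]; exists q.
  by rewrite ltr_norml; apply/andP; split; lra.
have zc : `|z - map_mx ratr (\row_i c i)| < ratr r.
  by apply/mx_norm_ltP => // i j; rewrite !mxE (ord1 i).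
exists (\row_i c i), r; split => // y yc; apply: eO => /=.
rewrite (_ : z - y = (z - map_mx ratr (\row_i c i)) - (y - map_mx ratr (\row_i c i))).
  by apply: le_lt_trans (ler_normB _ _) _; lra.
by rewrite opprB addrA subrK.
Qed.

Section coordinates.
Context {R : realType}.
Local Notation R3 :=
  (measurableTypeR R * measurableTypeR R * measurableTypeR R)%type.

(* ['rV_(1 + 2)] and ['rV_(1 + (1 + 1))] are only convertible, whence the casts. *)
Lemma vec3E (q : R3) : (vec3 q : 'rV[R]_(1 + (1 + 1))) =
  row_mx q.1.1%:M (row_mx q.1.2%:M q.2%:M).
Proof. by []. Qed.

Definition unvec3 (z : 'rV[R]_(1 + 2)) : R3 :=
  let z' : 'rV[R]_(1 + (1 + 1)) := z in
  (z' 0 (lshift (1 + 1) ord0), z' 0 (@rshift 1 (1 + 1) (lshift 1 ord0)),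
   z' 0 (@rshift 1 (1 + 1) (rshift 1 ord0))).

Lemma vec3K : cancel (@vec3 R) unvec3.
Proof.
case=> [[x y] z]; rewrite /unvec3 vec3E.
by rewrite row_mxEl !(@row_mxEr _ 1 1 (1 + 1)) row_mxEl row_mxEr !mxE.
Qed.

Lemma unvec3K : cancel unvec3 (@vec3 R).
Proof.
move=> z; pose z' : 'rV[R]_(1 + (1 + 1)) := z.
suff : (vec3 (unvec3 z) : 'rV[R]_(1 + (1 + 1))) = z' by [].
apply/rowP => i; rewrite vec3E; case: (split_ordP i) => j ->.
  by rewrite row_mxEl mxE (ord1 j).
rewrite row_mxEr; case: (split_ordP j) => k ->.
  by rewrite row_mxEl mxE (ord1 k).
by rewrite row_mxEr mxE (ord1 k).
Qed.

Lemma measurable_vec3_coord i :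
  measurable_fun setT (fun q : R3 => vec3 q 0 i).
Proof.
pose j : 'I_(1 + (1 + 1)) := i.
suff : measurable_fun setT (fun q : R3 => (vec3 q : 'rV[R]_(1 + (1 + 1))) 0 j) by [].
case: (split_ordP j) => k ->.
  rewrite (_ : (fun q : R3 => _) = (fun q => q.1.1)).
    exact: (measurableT_comp measurable_fst measurable_fst).
  by apply/funext => q; rewrite vec3E row_mxEl mxE (ord1 k).
case: (split_ordP k) => l ->.
  rewrite (_ : (fun q : R3 => _) = (fun q => q.1.2)).
    exact: (measurableT_comp measurable_snd measurable_fst).
  by apply/funext => q; rewrite vec3E row_mxEr row_mxEl mxE (ord1 l).
rewrite (_ : (fun q : R3 => _) = (fun q => q.2)); first exact: measurable_snd.
by apply/funext => q; rewrite vec3E row_mxEr row_mxEr mxE (ord1 l).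
Qed.

(** The sigma-algebra is that of the product, while [O] is open for the norm of rows. This is the
    maximum norm, so rational balls are boxes, and countably many of them exhaust [O]. *)
Lemma measurable_vec3_open (O : set 'rV[R]_(1 + 2)) :
  open O -> measurable (vec3 @^-1` O : set R3).
Proof.
move=> oO.
pose B (k : 'rV[rat]_(1 + 2) * rat) : set R3 :=
  \bigcap_(i : 'I_(1 + 2)) [set q | `|vec3 q 0 i - ratr (k.1 0 i)| < ratr k.2].
pose P : set ('rV[rat]_(1 + 2) * rat) :=
  [set k | 0 < ratr k.2 :> R /\
     forall y : 'rV[R]_(1 + 2), `|y - map_mx ratr k.1| <= 2 * ratr k.2 -> O y].
have mB k : measurable (B k).
  apply: fin_bigcap_measurable => // i _.
  rewrite (_ : [set q | _] =
      (fun q : R3 => `|vec3 q 0 i - ratr (k.1 0 i)|) @^-1` `]-oo, ratr k.2[).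
    rewrite -[X in measurable X]setTI.
    apply: (_ : measurable_fun setT _) => //; apply: measurableT_comp => //.
    by apply: measurable_funB => //; exact: measurable_vec3_coord.
  by apply/seteqP; split => q /=; rewrite in_itv.
rewrite (_ : _ @^-1` _ = \bigcup_(k in P) B k).
  rewrite bigcup_mkcond; apply: countable_bigcupT_measurable => // k.
  by case: ifP.
apply/seteqP; split => [q Oq|q [k [r0 kO] Bq]].
  have [c [r [r0 qr rO]]] := open_rat_ball oO Oq.
  exists (c, r) => // i _ /=.
  by move: qr => /(mx_norm_ltP _ r0)/(_ 0 i); rewrite !mxE.
apply: kO; apply/mx_norm_leP => [|i j]; first by rewrite mulr_ge0// ltW.
have /= := Bq j Logic.I; rewrite !mxE (ord1 i) => /ltW/le_trans; apply.
by rewrite ler_pMl// ler1n.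
Qed.

End coordinates.

(** * The fundamental lemma of the calculus of variations *)

Section positive_square.
Context {R : realType}.

(** A C^1 function that is positive exactly on the positive reals; it turns strict inequalities into
    positivity sets of C^1 functions. *)
Definition pos_sq (s : R) : R := (Num.max s 0) ^+ 2.

Lemma pos_sq_ge0 s : 0 <= pos_sq s. Proof. exact: sqr_ge0. Qed.

Lemma pos_sq_gt0 s : (0 < pos_sq s) = (0 < s).
Proof.
rewrite lt0r pos_sq_ge0 andbT sqrf_eq0; have [s0|s0] := ltP 0 s.
  by rewrite gt_eqF.
by rewrite eqxx.
Qed.

Lemma pos_sq_le0 s : s <= 0 -> pos_sq s = 0.
Proof. by move=> s0; rewrite /pos_sq max_r// expr0n. Qed.

(** The error of the linearisation is at most [h ^+ 2] for every sign of [s] and [h + s], so the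
    kink of the maximum at 0 does no harm. *)
Lemma is_derive_pos_sq (s : R) : is_derive s 1 pos_sq (2 * Num.max s 0).
Proof.
have dcvg : h^-1 *: ((pos_sq \o shift s) (h *: 1) - pos_sq s) @[h --> 0^'] -->
    2 * Num.max s 0.
  apply/cvgrPdist_le => e e0; near=> h.
  have h0 : h != 0 by near: h; exact: nbhs_dnbhs_neq.
  have he : `|h| <= e.
    near: h; apply: dnbhs0_le; exact: e0.
  apply: le_trans he; rewrite /= /pos_sq /GRing.scale /= mulr1.
  have hp : 0 < `|h| by rewrite normr_gt0.
  rewrite -(ler_pM2l hp) -normrM mulrBr (mulVKf h0).
  rewrite -[leRHS]expr2 real_normK ?num_real//.
  rewrite ler_norml; case: (leP 0 s) => s0; case: (leP 0 (h + s)) => hs0.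
  - by apply/andP; split; nra.
  - by apply/andP; split; nra.
  - by apply/andP; split; nra.
  - by apply/andP; split; nra.
apply: DeriveDef; first by apply/cvg_ex; exists (2 * Num.max s 0).
exact: cvg_lim dcvg.
Unshelve. all: by end_near. Qed.

Lemma continuous_max0 : continuous (fun s : R => Num.max s 0).
Proof. by move=> s; apply: continuous_max; [exact: cvg_id|exact: cvg_cst]. Qed.

End positive_square.

(** * Closure properties of C^1 functions *)

Section C1_functions.
Context {R : realType} {n : nat}.
Implicit Types phi psi : 'rV[R]_n -> R.

Definition C1fun phi : Prop :=
  (forall z, differentiable phi z) /\ forall v, continuous (fun z => 'D_v phi z).

Lemma C1_continuous phi : C1fun phi -> continuous phi.
Proof. by case=> dphi _ z; exact: differentiable_continuous. Qed.

Lemma C1_cst (c : R) : C1fun (fun=> c).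
Proof.
split=> [z|v z]; first exact: differentiable_cst.
by under eq_fun do rewrite derive_cst; exact: cst_continuous.
Qed.

Lemma C1_coord i : C1fun (fun z => z 0 i).
Proof.
have dz z : differentiable (fun z : 'rV[R]_n => z 0 i) z.
  exact: differentiable_coord.
split=> // v z; rewrite (_ : 'D_v _ = cst (v 0 i)).
  exact: cst_continuous.
apply/funext => y; rewrite deriveE//.
have lin : linear (fun z : 'rV[R]_n => z 0 i : R) by move=> a u w; rewrite !mxE.
pose L := GRing.isLinear.Build R 'rV[R]_n R _ _ lin.
pose f : {linear 'rV[R]_n -> R} := HB.pack (fun z : 'rV[R]_n => z 0 i : R) L.
rewrite -[fun z => _]/(f : _ -> _) diff_lin//.
exact: coord_continuous.
Qed.

Lemma C1D phi psi : C1fun phi -> C1fun psi -> C1fun (fun z => phi z + psi z).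
Proof.
move=> [d1 c1] [d2 c2]; split=> [z|v z]; first exact: differentiableD.
rewrite (_ : 'D_v _ = (fun z => 'D_v phi z + 'D_v psi z)).
  exact: (cvgD (c1 v z) (c2 v z)).
by apply/funext => y; rewrite deriveD//; exact: diff_derivable.
Qed.

Lemma C1M phi psi : C1fun phi -> C1fun psi -> C1fun (fun z => phi z * psi z).
Proof.
move=> h1 h2; have [d1 c1] := h1; have [d2 c2] := h2.
split=> [z|v z]; first exact: differentiableM.
rewrite (_ : 'D_v _ = (fun z => phi z * 'D_v psi z + psi z * 'D_v phi z)).
  have l1 := cvgM (C1_continuous h1 (x := z)) (c2 v z).
  have l2 := cvgM (C1_continuous h2 (x := z)) (c1 v z).
  exact: (cvgD (l1 _) (l2 _)).
by apply/funext => y; rewrite deriveM//; exact: diff_derivable.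
Qed.

Lemma C1V phi : (forall z, phi z != 0) -> C1fun phi ->
  C1fun (fun z => (phi z)^-1).
Proof.
move=> phi0 h; have [d c] := h.
split=> [z|v z]; first exact: differentiableV.
rewrite (_ : 'D_v _ = (fun z => - (phi z) ^- 2 * 'D_v phi z)).
  have p2 := cvgM (C1_continuous h (x := z)) (C1_continuous h (x := z)).
  have p3 := cvgN (cvgV (mulf_neq0 (phi0 z) (phi0 z)) (p2 _)).
  exact: (cvgM (p3 _ _ _) (c v z)).
by apply/funext => y; rewrite deriveV//; exact: diff_derivable.
Qed.

Lemma C1_pos_sq phi : C1fun phi -> C1fun (fun z => pos_sq (phi z)).
Proof.
move=> h; have [d c] := h.
have dp s : differentiable (@pos_sq R) s.
  by apply/derivable1_diffP; case: (is_derive_pos_sq s).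
split=> [z|v z]; first exact: differentiable_comp.
rewrite (_ : 'D_v _ = (fun z => 'D_v phi z * (2 * Num.max (phi z) 0))).
  have cmax : {for z, continuous (fun z => Num.max (phi z) 0)}.
    apply: (@continuous_comp _ _ _ phi (fun s => Num.max s 0)).
      exact: C1_continuous.
    exact: continuous_max0.
  by apply: (cvgM (c v z)); apply: cvgM cmax; exact: cvg_cst.
apply/funext => y; rewrite deriveE; last exact: differentiable_comp.
rewrite diff_comp// /= deriveE// diff1E//=.
by congr (_ * _); rewrite derive1E; case: (is_derive_pos_sq (phi y)).
Qed.

Lemma C1_sum (I : Type) (r : seq I) (f : I -> 'rV[R]_n -> R) :
  (forall i, C1fun (f i)) -> C1fun (fun z => \sum_(i <- r) f i z).
Proof.
move=> cf; elim: r => [|i r IH].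
  by under eq_fun do rewrite big_nil; exact: C1_cst.
by under eq_fun do rewrite big_cons; exact: C1D.
Qed.

End C1_functions.

Section fundamental_lemma.
Context {R : realType}.
Local Notation R3 :=
  (measurableTypeR R * measurableTypeR R * measurableTypeR R)%type.
Local Notation leb := (leb3 R).

Lemma measurable_vec3_comp (phi : 'rV[R]_(1 + 2) -> R) :
  continuous phi -> measurable_fun setT (fun q : R3 => phi (vec3 q)).
Proof.
move=> cphi; apply: (measurability _ (RGenOInfty.measurableE R)).
move=> _ [_ [a ->] <-]; rewrite setTI.
apply: (@measurable_vec3_open _ (phi @^-1` `]a, +oo[)).
by move/continuousP: cphi; apply; exact: interval_open.
Qed.

Lemma compact_measurable_vec3 (K : set 'rV[R]_(1 + 2)) :
  compact K -> measurable (vec3 @^-1` K : set R3).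
Proof.
move=> cK; rewrite -[X in measurable X]setCK preimage_setC.
apply: measurableC; apply: measurable_vec3_open.
by apply: closed_openC; apply: compact_closed => //; exact: norm_hausdorff.
Qed.

Lemma compact_norm_ball (n : nat) (c : 'rV[R]_n) (r : R) :
  compact [set y | `|y - c| <= r].
Proof.
apply: bounded_closed_compact.
  exists (r + `|c|); split; first exact: num_real.
  move=> M ltM y /= By; rewrite -(subrK c y); apply: le_trans (ler_normD _ _) _.
  by apply: ltW; apply: le_lt_trans ltM; rewrite lerD2r.
rewrite (_ : [set y | _] = closed_ball_ (fun x => `|x|) c r).
  exact: closed_closed_ball_.
by apply/seteqP; split => y; rewrite /closed_ball_ /= distrC.
Qed.

(* Positivity sets of C^1 functions: a pi-system generating the Borel sets. *)
Definition C1_positivity_sets : set (set R3) :=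
  [set A | exists phi : 'rV[R]_(1 + 2) -> R,
     [/\ C1fun phi, forall z, 0 <= phi z & A = [set q | 0 < phi (vec3 q)]]].

Lemma setI_closed_C1_positivity_sets : setI_closed C1_positivity_sets.
Proof.
move=> _ _ [phi [phi1 phi0 ->]] [psi [psi1 psi0 ->]].
exists (fun z => phi z * psi z); split; first exact: C1M.
  by move=> z; rewrite mulr_ge0.
apply/seteqP; split => q /=; first by move=> [? ?]; rewrite mulr_gt0.
rewrite !lt0r mulf_eq0 negb_or => /andP[/andP[-> ->] _].
by rewrite phi0 psi0.
Qed.

(** For the inclusion from left to right, the coordinates are measurable for the generated
    sigma-algebra, as [z 0 i > a] is where [pos_sq (z 0 i - a)] is positive; hence so is the
    identity, written as [unvec3 \o vec3]. *)
Lemma measurable_C1_positivity_sets : @measurable _ R3 = <<s C1_positivity_sets >>.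
Proof.
apply/seteqP; split; last first.
  apply: smallest_sub; first exact: sigma_algebra_measurable.
  move=> _ [phi [phi1 phi0 ->]].
  rewrite (_ : [set q | _] = (fun q : R3 => phi (vec3 q)) @^-1` `]0, +oo[).
    rewrite -[X in measurable X]setTI.
    by apply: (measurable_vec3_comp (C1_continuous phi1)).
  by apply/seteqP; split => q /=; rewrite in_itv/= andbT.
pose T := g_sigma_algebraType C1_positivity_sets.
have coord i : measurable_fun setT (fun q : T => vec3 q 0 i : measurableTypeR R).
  apply: (measurability _ (RGenOInfty.measurableE R)).
  move=> _ [_ [a ->] <-]; rewrite setTI; apply: sub_sigma_algebra.
  exists (fun z => pos_sq (z 0 i - a)); split.
  - apply: C1_pos_sq; apply: C1D; first exact: C1_coord.
    exact: C1_cst.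
  - by move=> z; exact: pos_sq_ge0.
  - by apply/seteqP; split => q /=; rewrite in_itv/= andbT pos_sq_gt0 subr_gt0.
have mid : measurable_fun setT (fun q : T => unvec3 (vec3 q)).
  by apply: measurable_fun_pair; [apply: measurable_fun_pair|]; exact: coord.
move=> A mA; have := mid measurableT _ mA; rewrite setTI.
rewrite (_ : _ @^-1` A = A)//.
by apply/seteqP; split => q /=; rewrite vec3K.
Qed.

Variables (O : set 'rV[R]_(1 + 2)) (h : 'rV[R]_(1 + 2) -> R).
Hypothesis oO : open O.
Hypothesis ih : loc_integrable O h.
Hypothesis h_orth : forall phi, test_function O phi ->
  \int[leb]_q (h (vec3 q) * phi (vec3 q)) = 0.

(* [psi / (psi + 1 / n)] is a test function which tends to the indicator of
   [0 < psi]. *)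
Lemma orth_positivity_set (psi : 'rV[R]_(1 + 2) -> R) K :
  C1fun psi -> (forall z, 0 <= psi z) ->
  compact K -> K `<=` O -> (forall z, ~ K z -> psi z = 0) ->
  (\int[leb]_(q in [set q | (0 < psi (vec3 q))%R]) (h (vec3 q))%:E = 0)%E.
Proof.
move=> psi1 psi0 cK KO psiK.
have mK := compact_measurable_vec3 cK.
pose D : set R3 := vec3 @^-1` K.
pose hK : R3 -> \bar R := (fun q => (h (vec3 q))%:E) \_ D.
have ihK : leb.-integrable setT hK by apply/(integrable_mkcond _ mK); exact: ih.
have mhK : measurable_fun setT hK by case/integrableP : ihK.
pose e n : R := n.+1%:R^-1.
have e0 n : 0 < e n by rewrite invr_gt0.
have den n z : 0 < psi z + e n by rewrite ltr_wpDl.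
pose phi n z := psi z * (psi z + e n)^-1.
have phi1 n : C1fun (phi n).
  apply: C1M => //; apply: C1V => [z|]; first by rewrite gt_eqF.
  by apply: C1D => //; exact: C1_cst.
have phi_le1 n z : 0 <= phi n z <= 1.
  rewrite divr_ge0 ?(ltW (den _ _))//= ler_pdivrMr ?den// mul1r.
  by rewrite lerDl ltW.
have phi_test n : test_function O (phi n).
  split; [by case: (phi1 n)|by case: (phi1 n)|exists K; split => // z Kz].
  by rewrite /phi psiK// mul0r.
pose f n q : \bar R := (hK q * (phi n (vec3 q))%:E)%E.
pose l : R3 -> \bar R :=
  (fun q => (h (vec3 q))%:E) \_ [set q | 0 < psi (vec3 q)].
have psiD q : 0 < psi (vec3 q) -> D q.
  by move=> psq; apply: contrapT => Kq; move: psq; rewrite psiK// ltxx.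
have hKE q : D q -> hK q = (h (vec3 q))%:E.
  by move=> Dq; rewrite /hK patchE mem_set.
have fE n q : f n q = (h (vec3 q) * phi n (vec3 q))%:E.
  rewrite /f /hK patchE; case: ifPn => [_|/negP nD]; first by rewrite EFinM.
  by rewrite mul0e /phi psiK ?mul0r ?mulr0// => Kq; apply: nD; rewrite inE.
have mpsi : measurable_fun setT (fun q : R3 => psi (vec3 q)).
  exact: (measurable_vec3_comp (C1_continuous psi1)).
have mP : measurable [set q : R3 | 0 < psi (vec3 q)].
  rewrite measurable_C1_positivity_sets; apply: sub_sigma_algebra.
  by exists psi; split.
have mf n : measurable_fun setT (f n).
  apply: emeasurable_funM => //; apply/measurable_EFinP.
  exact: (measurable_vec3_comp (C1_continuous (phi1 n))).
have lE : l = hK \_ [set q | 0 < psi (vec3 q)].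
  apply/funext => q; rewrite /l !patchE; case: ifPn => //; rewrite inE /= => pq.
  by rewrite hKE//; exact: psiD.
have ml : measurable_fun setT l.
  rewrite lE; apply/(measurable_restrictT _ _).1 => //.
  exact: measurable_funS mhK.
have cvf : {ae leb, forall q, setT q -> f ^~ q @ \oo --> l q}.
  apply: aeW => q _; rewrite /l patchE; under eq_fun do rewrite fE.
  have [|] := boolP (q \in _); rewrite ?inE ?notin_setE /= => pq.
    apply/fine_cvgP; split; first exact: nearW.
    rewrite -[X in _ --> X]mulr1; apply: cvgM; first exact: cvg_cst.
    rewrite -(divff (lt0r_neq0 pq)); apply: cvgM; first exact: cvg_cst.
    apply: cvgV; first exact: lt0r_neq0.
    rewrite -[X in _ --> X]addr0; apply: cvgD; first exact: cvg_cst.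
    exact: cvg_harmonic.
  have pq0 : psi (vec3 q) = 0 by apply/eqP; rewrite eq_le psi0 andbT leNgt; exact/negP.
  by under eq_fun do rewrite /phi pq0 mul0r mulr0; exact: cvg_cst.
have f_le n q : (`|f n q| <= `|hK q|)%E.
  rewrite abseM -[leRHS]mule1; apply: lee_wpmul2l => //.
  have /andP[p0 p1] := phi_le1 n (vec3 q).
  by rewrite gee0_abs ?lee_fin.
have iabs : leb.-integrable setT (abse \o hK) by exact: integrable_abse.
have [_ _ fcvg] := dominated_convergence measurableT mf ml cvf iabs
  (aeW _ (fun q n _ => f_le n q)).
have f_int0 n : (\int[leb]_q f n q = 0)%E.
  have fin : leb.-integrable setT (f n).
    by apply: le_integrable ihK => // q _; exact: f_le.
  rewrite -[LHS]fineK; last exact: integrable_fin_num.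
  congr EFin; have := h_orth (phi_test n); rewrite /Rintegral => <-.
  by congr fine; apply: eq_integral => q _; rewrite fE.
rewrite integral_mkcond -/l; have := cvg_lim (@ereal_hausdorff R) fcvg.
move=> <-; rewrite (_ : (fun n => _) = cst 0%E) ?lim_cst//.
by apply/funext => n; exact: f_int0.
Qed.

(** Multiplying [psi] by another nonnegative C^1 function keeps the support in [K], so the integral
    of [h] vanishes on [Q] intersected with every positivity set, and by Dynkin's theorem with every
    measurable set. *)
Lemma vanish_ae_positivity_set (psi : 'rV[R]_(1 + 2) -> R) K :
  C1fun psi -> (forall z, 0 <= psi z) ->
  compact K -> K `<=` O -> (forall z, ~ K z -> psi z = 0) ->
  {ae leb, forall q, 0 < psi (vec3 q) -> h (vec3 q) = 0}.
Proof.
move=> psi1 psi0 cK KO psiK.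
pose Q : set R3 := [set q | 0 < psi (vec3 q)].
have mQ : measurable Q.
  by rewrite measurable_C1_positivity_sets; apply: sub_sigma_algebra; exists psi.
have QK : Q `<=` vec3 @^-1` K.
  by move=> q Qq; apply: contrapT => Kq; move: Qq; rewrite /Q/= psiK// ltxx.
have iQ : leb.-integrable Q (fun q => (h (vec3 q))%:E).
  by apply: integrableS (ih cK KO) => //; exact: compact_measurable_vec3.
have P S : measurable S -> (\int[leb]_(q in Q `&` S) (h (vec3 q))%:E = 0)%E.
  move=> mS; have : <<s C1_positivity_sets >> S by rewrite -measurable_C1_positivity_sets.
  have iQS A : measurable A -> leb.-integrable (Q `&` A) (fun q => (h (vec3 q))%:E).
    by move=> mA; apply: integrableS iQ => //; exact: measurableI.
  apply: (dynkin_induction (P := fun S =>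
    (\int[leb]_(q in Q `&` S) (h (vec3 q))%:E = 0)%E) measurable_C1_positivity_sets
    setI_closed_C1_positivity_sets).
  - by rewrite setIT; exact: (orth_positivity_set psi1 psi0 cK).
  - move=> _ [phi [phi1 phi0 ->]].
    rewrite (_ : _ `&` _ = [set q | 0 < psi (vec3 q) * phi (vec3 q)]).
      apply: (@orth_positivity_set (fun z => psi z * phi z) K) => //.
      + exact: C1M.
      + by move=> z; rewrite mulr_ge0.
      + by move=> z Kz; rewrite psiK// mul0r.
    apply/seteqP; split => q /=; first by move=> [? ?]; rewrite mulr_gt0.
    rewrite /Q /= !lt0r mulf_eq0 negb_or => /andP[/andP[-> ->] _].
    by rewrite phi0 psi0.
  - move=> A mA hA.
    have := orth_positivity_set psi1 psi0 cK KO psiK; rewrite -/Q.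
    have QA : Q = (Q `&` A) `|` (Q `&` ~` A) by rewrite -setIUr setUv setIT.
    rewrite {1}QA integral_setU//.
    + by rewrite hA add0e.
    + exact: measurableI.
    + by apply: measurableI => //; exact: measurableC.
    + by rewrite -QA; exact: (measurable_int _ iQ).
    + by rewrite disj_set2E setIACA setICr setI0.
  - move=> F mF tF hF; rewrite setI_bigcupr integral_bigcup.
    + by rewrite eseries0// => n _ _; rewrite hF.
    + exact: trivIset_setIl.
    + by move=> n; exact: measurableI.
    + by rewrite -setI_bigcupr; apply: iQS; exact: bigcupT_measurable.
have := @integral_ae_eq _ _ _ leb Q mQ (cst 0%E) _ iQ (measurable_cst _).
move=> /(_ _)[|N [mN N0 subN]].
  by move=> E EQ mE; rewrite -(setIidr EQ) P// integral_cst// ?mul0e//; exact: measurableI.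
exists N; split => // q /= nq; apply: subN => /= hq; apply: nq => pq.
by have [] := hq pq.
Qed.

Lemma fundamental_lemma : {ae leb, forall q, O (vec3 q) -> h (vec3 q) = 0}.
Proof.
pose B (k : 'rV[rat]_(1 + 2) * rat) : set 'rV[R]_(1 + 2) :=
  [set y | `|y - map_mx ratr k.1| <= 2 * ratr k.2].
pose N k : set R3 := [set q | [/\ 0 < ratr k.2 :> R, B k `<=` O,
   `|vec3 q - map_mx ratr k.1| < ratr k.2 & h (vec3 q) <> 0]].
have nN k : leb.-negligible (N k).
  have [[r0 BO]|nk] := pselect (0 < ratr k.2 :> R /\ B k `<=` O); last first.
    rewrite (_ : N k = set0); first exact: negligible_set0.
    by rewrite -subset0 => q [? ? _ _]; apply: nk.
  set c : 'rV[R]_(1 + 2) := map_mx ratr k.1; set r : R := ratr k.2.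
  (* Outside the double ball one coordinate of [z - c] already exceeds [2 * r] in absolute value, so
     [psi] vanishes. On the ball of radius [r], three squares below [r ^+ 2] add up to less than
     [(2 * r) ^+ 2], so [psi] is positive: 3 < 4 reconciles the Euclidean and the maximum norm. *)
  pose psi (z : 'rV[R]_(1 + 2)) := pos_sq ((2 * r) ^+ 2 - \sum_i (z 0 i - c 0 i) ^+ 2).
  have psi1 : C1fun psi.
    apply: C1_pos_sq; apply: C1D; first exact: C1_cst.
    rewrite (_ : (fun z => _) =
        (fun z : 'rV[R]_(1 + 2) => -1 * \sum_i (z 0 i - c 0 i) * (z 0 i - c 0 i))).
      apply: C1M; first exact: C1_cst.
      apply: C1_sum => i; apply: C1M; apply: C1D; try exact: C1_coord;
      exact: C1_cst.
    by apply/funext => z; rewrite mulN1r; under eq_bigr do rewrite expr2.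
  have cB : compact (B k) by exact: compact_norm_ball.
  have psiB z : ~ B k z -> psi z = 0.
    move=> Bz; apply: pos_sq_le0; rewrite subr_le0.
    move: Bz => /negP; rewrite -ltNge => Bz.
    have [i ri] : exists i, 2 * r < `|z 0 i - c 0 i|.
      apply: contrapT => /forallNP all_le; move: Bz; apply/negP; rewrite -leNgt.
      apply/mx_norm_leP; first by rewrite mulr_ge0// ltW.
      move=> a b; rewrite (ord1 a) 2!mxE leNgt; apply/negP => ab.
      by apply: (all_le b); move: ab; rewrite mxE.
    rewrite (bigD1 i)//= -[X in _ <= X + _]real_normK ?num_real//.
    rewrite -[leLHS]addr0 lerD//; last by apply: sumr_ge0 => j _; exact: sqr_ge0.
    have r_ge0 : 0 <= 2 * r by rewrite mulr_ge0// ltW.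
    by rewrite ler_sqr ?nnegrE// ltW.
  have := vanish_ae_positivity_set psi1 (fun z => pos_sq_ge0 _) cB BO psiB.
  apply: negligibleS => q [_ _ qr hq] /=; apply: contra_not hq; apply.
  rewrite /psi pos_sq_gt0 subr_gt0.
  have sq_lt i : (vec3 q 0 i - c 0 i) ^+ 2 < r ^+ 2.
    have r_ge0 : 0 <= r by exact: ltW.
    rewrite -[ltLHS]real_normK ?num_real// ltr_sqr ?nnegrE//.
    by move: qr => /(mx_norm_ltP _ r0)/(_ 0 i); rewrite !mxE.
  apply: (@le_lt_trans _ _ (\sum_(i < 1 + 2) r ^+ 2)).
    by apply: ler_sum => i _; exact: ltW.
  have r2 : 0 < r ^+ 2 by rewrite exprn_gt0.
  rewrite sumr_const card_ord (_ : (2 * r) ^+ 2 = r ^+ 2 * 4%:R).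
    by rewrite -(mulr_natr _ (1 + 2)) ltr_pM2l// ltr_nat.
  by ring.
have : leb.-negligible (\bigcup_n (if unpickle n is Some k then N k else set0)).
  apply: negligible_bigcup => n.
  by case: unpickle => [k|]; [exact: nN|exact: negligible_set0].
apply: negligibleS => q /= /not_implyP[Oq hq].
have [c [r [r0 qr rO]]] := open_rat_ball oO Oq.
by exists (pickle (c, r)) => //; rewrite pickleK.
Qed.

End fundamental_lemma.

(** * Differentials relative to a set *)

Section within_differential_theory.
Context {R : realType}.

Lemma ler_norm_mulmx (k n m : nat) (v : 'M[R]_(k, n)) (L : 'M[R]_(n, m)) :
  `|v *m L| <= n%:R * `|L| * `|v|.
Proof.
apply/mx_norm_leP; first by rewrite !mulr_ge0.
move=> i j; rewrite mxE; apply: le_trans (ler_norm_sum _ _ _) _.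
apply: (@le_trans _ _ (\sum_(l < n) `|L| * `|v|)).
  apply: ler_sum => l _; rewrite normrM mulrC.
  by apply: ler_pM => //; exact: ler_mx_norm_coord.
by rewrite sumr_const card_ord -mulrA mulr_natl.
Qed.

Lemma ler_norm_scale_delta (n : nat) (s : R) i :
  0 <= s -> `|s *: delta_mx 0 i : 'rV[R]_n| <= s.
Proof.
move=> s0; apply/mx_norm_leP => // a b; rewrite !mxE normrM (ger0_norm s0).
by rewrite ler_piMr//; case: (_ && _); rewrite ?normr1 ?normr0.
Qed.

(** Short steps in the positive coordinate directions stay in [A]; these directions already
    determine a differential. A half-plane chart image satisfies this up to its edge, but a
    spacetime chart image fails it at the final time, where a step forward leaves [0, T]. *)
Definition fat (n : nat) (A : set 'rV[R]_n) (x : 'rV[R]_n) : Prop :=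
  forall i, \forall s \near 0^'+, A (x + s *: delta_mx 0 i).

Lemma fat_near (n : nat) (A P : set 'rV[R]_n) (x : 'rV[R]_n) i :
  fat A x -> (\forall y \near within A (nbhs x), P y) ->
  \forall s \near 0^'+, P (x + s *: delta_mx 0 i).
Proof.
move=> fA; rewrite near_withinE => /nbhs_normP[d /= d0 nP].
near=> s; apply: nP; last by near: s; exact: fA.
rewrite /= opprD addNKr normrN; apply: (@le_lt_trans _ _ s).
  by apply: ler_norm_scale_delta; near: s; exact: nbhs_right_ge.
by near: s; exact: nbhs_right_lt.
Unshelve. all: by end_near. Qed.

Lemma is_diff_within_unique (n m : nat) (A : set 'rV[R]_n)
    (h : 'rV[R]_n -> 'rV[R]_m) x L1 L2 :
  fat A x -> is_diff_within A h x L1 -> is_diff_within A h x L2 -> L1 = L2.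
Proof.
move=> fA d1 d2; apply/matrixP => i j; apply/eqP; rewrite -subr_eq0 -normr_le0.
apply/ler_addgt0Pr => e e0; rewrite add0r.
pose dl : 'rV[R]_n := delta_mx 0 i.
have e2 : 0 < e / 2 by rewrite divr_gt0.
have n12 L : is_diff_within A h x L -> \forall s \near 0^'+,
    `|h (x + s *: dl) - h x - (s *: dl) *m L| <=
    e / 2 * `|s *: dl|.
  move=> dL; apply: filterS (fat_near i fA (dL _ e2)) => s.
  by rewrite (addrC x) addrK.
near (0 : R)^'+ => s.
have s0 : 0 < s by [].
have h1 : `|h (x + (s *: dl)) - h x - (s *: dl) *m L1| <=
    e / 2 * `|s *: dl|.
  by near: s; exact: n12.
have h2 : `|h (x + (s *: dl)) - h x - (s *: dl) *m L2| <=
    e / 2 * `|s *: dl|.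
  by near: s; exact: n12.
have hv : `|(s *: dl) *m (L1 - L2)| <= e * s.
  rewrite mulmxBr (_ : _ - _ = (h (x + (s *: dl)) - h x - (s *: dl) *m L2) -
      (h (x + (s *: dl)) - h x - (s *: dl) *m L1)); last by rewrite [RHS]addrC opprB addrA subrK.
  apply: le_trans (ler_normB _ _) _; rewrite [e in leRHS]splitr mulrDl.
  have vs : `|s *: dl| <= s by apply: ler_norm_scale_delta; exact: ltW.
  by apply: lerD; [apply: le_trans h2 _|apply: le_trans h1 _];
    rewrite ler_pM2l.
have := ler_mx_norm_coord ((s *: dl) *m (L1 - L2)) 0 j.
move=> /le_trans/(_ hv); rewrite -scalemxAl -/dl -rowE !mxE normrM (gtr0_norm s0).
by rewrite mulrC ler_pM2r.
Unshelve. all: by end_near. Qed.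

Lemma is_diff_withinW (n m : nat) (A B : set 'rV[R]_n)
    (h : 'rV[R]_n -> 'rV[R]_m) x L :
  (\forall y \near within A (nbhs x), B y) ->
  is_diff_within B h x L -> is_diff_within A h x L.
Proof.
rewrite near_withinE => AB dB e e0; have := dB e e0; rewrite !near_withinE => nB.
by near=> y => Ay; apply: (near nB y) => //; apply: (near AB y).
Unshelve. all: by end_near. Qed.

Lemma eq_is_diff_within (n m : nat) (A : set 'rV[R]_n)
    (h k : 'rV[R]_n -> 'rV[R]_m) x L :
  A x -> (forall y, A y -> h y = k y) ->
  is_diff_within A h x L -> is_diff_within A k x L.
Proof.
move=> Ax hk dh e e0; have := dh e e0; rewrite !near_withinE.
by apply: filterS => y hy Ay; rewrite -!hk//; exact: hy.
Qed.

Lemma is_diff_within_comp (n m p : nat) (A : set 'rV[R]_n) (B : set 'rV[R]_m)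
    (h : 'rV[R]_n -> 'rV[R]_m) (k : 'rV[R]_m -> 'rV[R]_p) x L L' :
  (forall y, A y -> B (h y)) ->
  is_diff_within A h x L -> is_diff_within B k (h x) L' ->
  is_diff_within A (k \o h) x (L *m L').
Proof.
move=> AB dh dk e e0.
(* [C] is a Lipschitz constant of [h] at [x]: the linear part gives [n%:R] times the norm of [L],
   and the error, taken with tolerance 1, gives the summand 1. [C'] bounds the action of [L']. Each
   of the two errors then gets half of [e]. *)
pose C := n%:R * `|L| + 1; have C1 : 1 <= C by rewrite lerDr !mulr_ge0.
have C0 : 0 < C by exact: lt_le_trans C1.
pose C' := m%:R * `|L'| + 1; have C'0 : 0 < C' by rewrite ltr_wpDl// !mulr_ge0.
have e1 : 0 < e / 2 / C by rewrite !divr_gt0.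
have e2 : 0 < e / 2 / C' by rewrite !divr_gt0.
have := dk _ e1; rewrite near_withinE => /nbhs_normP[d /= d0 nk].
have := dh _ e2; rewrite near_withinE => nh2.
have := dh _ ltr01; rewrite near_withinE => nh1.
have dC : 0 < d / C by rewrite divr_gt0.
have nyx : \forall y \near nbhs x, `|y - x| < d / C.
  by apply/nbhs_ballP; exists (d / C) => //= y; rewrite -ball_normE /= distrC.
rewrite near_withinE; near=> y => Ay.
have yx : `|y - x| < d / C.
  exact: (near nyx y).
have h1 : `|h y - h x| <= C * `|y - x|.
  rewrite -(subrK ((y - x) *m L) (h y - h x)).
  apply: le_trans (ler_normD _ _) _; rewrite /C mulrDl addrC lerD//.
    exact: ler_norm_mulmx.
  exact: (near nh1 y).
have h2 : `|h y - h x - (y - x) *m L| <= e / 2 / C' * `|y - x|.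
  exact: (near nh2 y).
have h3 : `|k (h y) - k (h x) - (h y - h x) *m L'| <= e / 2 / C * `|h y - h x|.
  apply: nk; last exact: AB.
  rewrite /= distrC; apply: le_lt_trans h1 _.
  by rewrite mulrC -ltr_pdivlMr.
rewrite /= (_ : _ - _ = (k (h y) - k (h x) - (h y - h x) *m L') +
    (h y - h x - (y - x) *m L) *m L'); last first.
  by rewrite (mulmxBl _ ((y - x) *m L)) mulmxA addrA subrK.
apply: le_trans (ler_normD _ _) _.
rewrite [e]splitr mulrDl; apply: lerD.
  apply: le_trans h3 _; apply: (@le_trans _ _ (e / 2 / C * (C * `|y - x|))).
    by rewrite ler_pM2l.
  by rewrite mulrA divfK ?gt_eqF.
apply: le_trans (ler_norm_mulmx _ _) _.
apply: (@le_trans _ _ (C' * (e / 2 / C' * `|y - x|))).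
  by apply: ler_pM => //; rewrite /C' lerDl.
by rewrite mulrCA mulrA divfK ?gt_eqF.
Unshelve. all: by end_near. Qed.

Lemma jac_unique (n m : nat) (A : set 'rV[R]_n) (h : 'rV[R]_n -> 'rV[R]_m) x L :
  fat A x -> is_diff_within A h x L -> jac A h x = L.
Proof.
move=> fA dL; apply: xget_unique => // L' dL'.
exact: is_diff_within_unique fA dL' dL.
Qed.

Lemma fat_open_half_plane (O : set 'rV[R]_2) x :
  open O -> (O `&` half_plane) x -> fat (O `&` half_plane) x.
Proof.
move=> oO [Ox Hx] i.
have fO : fat setT x by move=> j; near=> s.
have := fat_near i fO (P := O); rewrite near_withinE => nO.
have {}nO : \forall s \near 0^'+, O (x + s *: delta_mx 0 i).
  apply: nO; have : nbhs x O by exact: open_nbhs_nbhs.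
  by apply: filterS => y.
near=> s; split; first exact: (near nO s).
rewrite /half_plane /= !mxE addr_ge0//.
by rewrite mulr_ge0.
Unshelve. all: by end_near. Qed.

Lemma fat_interior (n : nat) (A : set 'rV[R]_n) x : A° x -> fat A x.
Proof.
move=> Ax i; have fT : fat setT x by move=> j; near=> s.
have := fat_near i fT (P := A); rewrite near_withinE; apply.
by apply: filterS Ax => y.
Unshelve. all: by end_near. Qed.

End within_differential_theory.

(** * Frames of the moving surface *)

Section gram_matrices.
Context {R : realType}.

Lemma mulmx_tr_eq0 (m n : nat) (B : 'M[R]_(m, n)) : B *m B^T = 0 -> B = 0.
Proof.
move=> BB; apply/matrixP => i j; rewrite mxE.
have := congr1 (fun C : 'M[R]_m => C i i) BB; rewrite !mxE => /eqP.
rewrite psumr_eq0 => [|k _]; last by rewrite mxE -expr2 sqr_ge0.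
by move=> /allP/(_ j (mem_index_enum j)); rewrite mxE -expr2 sqrf_eq0 => /eqP.
Qed.

(** If [K] is the kernel, [K *m D] has zero Gram matrix and so vanishes; then [K] does, by
    freeness. *)
Lemma gram_unit (m n : nat) (D : 'M[R]_(m, n)) :
  row_free D -> D *m D^T \in unitmx.
Proof.
move=> fD; rewrite -row_free_unit -kermx_eq0; set K := kermx _.
have : K *m D = 0.
  apply: mulmx_tr_eq0; rewrite trmx_mul mulmxA -(mulmxA K).
  by rewrite mulmx_ker mul0mx.
by move=> /eqP; rewrite mulmx_free_eq0.
Qed.

Lemma tr_gram (m n : nat) (D : 'M[R]_(m, n)) : (D *m D^T)^T = D *m D^T.
Proof. by rewrite trmx_mul trmxK. Qed.

(** Cauchy-Schwarz for the two rows, from the sign of the squared norm of the first row minus [t]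
    times the second. *)
Lemma det_gram2_ge0 (n : nat) (D : 'M[R]_(2, n)) : 0 <= \det (D *m D^T).
Proof.
rewrite (expand_det_row _ 0) !big_ord_recl big_ord0 addr0 /cofactor !det_mx11 !mxE.
have l0 : lift (lift ord0 ord0) 0 = 0 :> 'I_2 by exact: val_inj.
have l1 : lift 0 0 = 1 :> 'I_2 by exact: val_inj.
have l2 : lift ord0 0 = 1 :> 'I_2 by exact: val_inj.
have l3 : lift ord0 ord0 = 1 :> 'I_2 by exact: val_inj.
rewrite l0 ?l1 ?l2 ?l3 /= expr0 expr1 mul1r mulN1r mulrN.
pose S (a b : 'I_2) := \sum_j D a j * D b j.
have SE a b : \sum_j D a j * D^T j b = S a b.
  by apply: eq_bigr => j _; rewrite mxE.
rewrite !SE.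
have -> : S 1 0 = S 0 1 by apply: eq_bigr => j _; rewrite mulrC.
have quad t : 0 <= S 0 0 - 2 * t * S 0 1 + t ^+ 2 * S 1 1.
  rewrite (_ : _ + _ = \sum_j (D 0 j - t * D 1 j) ^+ 2).
    by apply: sumr_ge0 => j _; exact: sqr_ge0.
  rewrite /S !mulr_sumr -sumrB -big_split/=; apply: eq_bigr => j _; ring.
have S11 : 0 <= S 1 1 by apply: sumr_ge0 => j _; rewrite -expr2 sqr_ge0.
have [S0|S0] := eqVneq (S 1 1) 0.
  rewrite S0 mulr0 sub0r oppr_ge0.
  have S00 : 0 <= S 0 0 by apply: sumr_ge0 => j _; rewrite -expr2 sqr_ge0.
  case: (eqVneq (S 0 1) 0) => [->|n0]; first by rewrite mulr0.
  (* With [S 1 1 = 0] the quadratic is affine in [t], and this [t] brings it to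
     [- S 0 0 - 2 * S 0 1 ^+ 2], which is negative. *)
  have := quad (S 0 0 / S 0 1 + S 0 1); rewrite S0 mulr0 addr0.
  rewrite (_ : _ - _ = - S 0 0 - 2 * S 0 1 ^+ 2); last by field.
  have : 0 < S 0 1 ^+ 2 by rewrite lt_neqAle sqr_ge0 andbT eq_sym sqrf_eq0.
  by move=> *; lra.
have p : 0 < S 1 1 by rewrite lt_neqAle eq_sym S0.
have := quad (S 0 1 / S 1 1).
rewrite (_ : _ + _ = (S 0 0 * S 1 1 - S 0 1 * S 0 1) / S 1 1); last by field.
by rewrite pmulr_lge0// invr_gt0.
Qed.

End gram_matrices.

Section surface_frames.
Context {R : realType} {M : ptopologicalType}.
Variables (S : surface R M) (T alpha : R) (f : R -> M -> 'rV[R]_3).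
Hypothesis alpha0 : 0 < alpha.
Hypothesis mov : is_moving_surface S T f.
Implicit Types (i j : chart S) (p : R * M) (z : 'rV[R]_(1 + 2)).

(* The metric is the Gram matrix of the rows of [frame]: the coordinate
   vector fields, seen in the ambient space R x R^3. *)
Definition frame i z : 'M[R]_(1 + 2, 1 + 3) :=
  block_mx alpha%:M 0 0 (tangent_map f i (lsubmx z 0 0) (rsubmx z)).

(** The Moore-Penrose inverse of the frame: at points of a chart image it is a right inverse, and
    [coframe *m frame] is the orthogonal projection onto the tangent space, whence its symmetry. *)
Definition coframe i z : 'M[R]_(1 + 3, 1 + 2) :=
  (frame i z)^T *m invmx (gbar_in f alpha i z).

Lemma gbar_inE i z : gbar_in f alpha i z = frame i z *m (frame i z)^T.
Proof.
rewrite /gbar_in /frame tr_block_mx !trmx0 tr_scalar_mx mulmx_block.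
by rewrite !mulmx0 !mul0mx !addr0 add0r -scalar_mxM.
Qed.

Lemma tangent_map_free i z : bimg T i z ->
  row_free (tangent_map f i (lsubmx z 0 0) (rsubmx z)).
Proof. by move=> [tT zi]; case: mov => _ /(_ _ tT) [_ _ _]; exact. Qed.

Lemma frame_free i z : bimg T i z -> row_free (frame i z).
Proof.
move=> /tangent_map_free/row_freeP[B TB]; apply/row_freeP.
exists (block_mx (alpha^-1)%:M 0 0 B); rewrite mulmx_block.
rewrite !mulmx0 !mul0mx !addr0 add0r -scalar_mxM divff ?gt_eqF// TB.
by rewrite -scalar_mx_block.
Qed.

Lemma gbar_in_unit i z : bimg T i z -> gbar_in f alpha i z \in unitmx.
Proof. by move=> zi; rewrite gbar_inE; apply: gram_unit; exact: frame_free. Qed.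

Lemma det_gbar_in_gt0 i z : bimg T i z -> 0 < \det (gbar_in f alpha i z).
Proof.
move=> zi; rewrite lt0r; apply/andP; split.
  by rewrite -unitfE -unitmxE gbar_in_unit.
rewrite /gbar_in det_lblock det_scalar expr1 mulr_ge0 ?sqr_ge0//.
exact: det_gram2_ge0.
Qed.

Lemma g_in_unit i z : bimg T i z ->
  g_in f i (lsubmx z 0 0) (rsubmx z) \in unitmx.
Proof. by move=> zi; apply: gram_unit; exact: tangent_map_free. Qed.

Lemma frameK i z : bimg T i z -> frame i z *m coframe i z = 1%:M.
Proof.
by move=> zi; rewrite /coframe mulmxA -gbar_inE mulmxV// gbar_in_unit.
Qed.

Lemma tr_gbar_in i z : (gbar_in f alpha i z)^T = gbar_in f alpha i z.
Proof. by rewrite gbar_inE tr_gram. Qed.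

Lemma tr_coframe_frame i z :
  (coframe i z *m frame i z)^T = coframe i z *m frame i z.
Proof.
by rewrite /coframe !trmx_mul trmxK trmx_inv tr_gbar_in mulmxA.
Qed.

Lemma tr_coframe_coframe i z : bimg T i z ->
  (coframe i z)^T *m coframe i z = invmx (gbar_in f alpha i z).
Proof.
move=> zi; rewrite {1}/coframe trmx_mul trmxK trmx_inv tr_gbar_in -mulmxA.
by rewrite frameK// mulmx1.
Qed.

Lemma bimg_bmap i p : bdom T i p -> bimg T i (bmap i p).
Proof.
by move=> [pT pi]; split; rewrite /bmap ?row_mxKl ?row_mxKr ?mxE//; exact: cmap_cimg.
Qed.

Lemma bmapK i p : bdom T i p -> binv i (bmap i p) = p.
Proof.
by case: p => t x [_ /= pi]; rewrite /binv /bmap row_mxKl row_mxKr mxE/= cmapK.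
Qed.

Lemma binvK i z : bimg T i z -> bmap i (binv i z) = z.
Proof.
move=> [_ zi]; rewrite /bmap /binv /= cinvK//.
rewrite -[RHS]hsubmxK; congr row_mx; apply/rowP => k.
by rewrite (ord1 k) [LHS]mxE.
Qed.

Lemma bdom_binv i z : bimg T i z -> bdom T i (binv i z).
Proof. by move=> [zT zi]; split => //; exact: cinv_cdom. Qed.

Lemma bdom_chart_at p : spacetime T p -> bdom T (chart_at S p.2) p.
Proof. by move=> pT; split => //; exact: cdom_at. Qed.

Definition st_map i z : 'rV[R]_3 := f (binv i z).1 (binv i z).2.

Lemma fat_cimg i x : cimg i x -> fat (cimg i) x.
Proof.
by move=> xi; have [U oU iU] := cimg_open i; rewrite iU in xi *;
  exact: fat_open_half_plane.
Qed.

Definition time_slice (t : R) (x : 'rV[R]_2) : 'rV[R]_(1 + 2) := row_mx t%:M x.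

(** Smoothness is assumed jointly in time and space, whereas the metric uses the differential at
    fixed [t]. The slice map is affine, so the chain rule extracts the spatial rows of the joint
    Jacobian. *)
Lemma is_diff_within_slice i t x : 0 <= t <= T -> cimg i x ->
  is_diff_within (cimg i) (f t \o cinv i) x
    (row_mx 0 1%:M *m jac (bimg T i) (st_map i) (time_slice t x)).
Proof.
move=> tT xi.
have zi y : cimg i y -> bimg T i (time_slice t y).
  by move=> yi; split; rewrite /time_slice ?row_mxKl ?row_mxKr ?mxE.
have sl : is_diff_within (cimg i) (time_slice t) x (row_mx 0 1%:M).
  move=> e e0; near=> y; rewrite /time_slice mul_mx_row mulmx0 mulmx1.
  rewrite opp_row_mx add_row_mx subrr opp_row_mx add_row_mx oppr0 addr0 subrr.
  by rewrite row_mx0 normr0 mulr_ge0// ltW.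
have [[dF _] _] := mov.1 i.
have := is_diff_within_comp zi sl (dF _ (zi _ xi)).
apply: eq_is_diff_within => // y yi; rewrite /st_map /binv /time_slice /=.
by rewrite row_mxKl row_mxKr mxE.
Unshelve. all: by end_near. Qed.

Lemma tangent_mapE i t x : 0 <= t <= T -> cimg i x ->
  tangent_map f i t x =
  row_mx 0 1%:M *m jac (bimg T i) (st_map i) (time_slice t x).
Proof.
move=> tT xi; apply: jac_unique; first exact: fat_cimg.
exact: is_diff_within_slice.
Qed.

Lemma tangent_mapP i t x : 0 <= t <= T -> cimg i x ->
  is_diff_within (cimg i) (f t \o cinv i) x (tangent_map f i t x).
Proof.
by move=> tT xi; rewrite tangent_mapE//; exact: is_diff_within_slice.
Qed.

(** Transition maps are differentiated relative to the overlap, tangent maps relative to the whole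
    chart image; as the overlap is relatively open, a differential relative to the first is one
    relative to the second. *)
Lemma near_overlap i j x : cdom i x -> cdom j x ->
  \forall y \near within (cimg i) (nbhs (cmap i x)),
    (cmap i @` (cdom i `&` cdom j)) y.
Proof.
move=> xi xj.
have ci := (subspace_continuousP _ _).1 (@cinv_continuous _ _ S i) _ (cmap_cimg xi).
have nb : nbhs (cinv i (cmap i x)) (cdom i `&` cdom j).
  rewrite cmapK//; apply: open_nbhs_nbhs; split => //.
  by apply: openI; exact: cdom_open.
have : \forall y \near within (cimg i) (nbhs (cmap i x)),
    (cdom i `&` cdom j) (cinv i y) by exact: ci nb.
rewrite !near_withinE; apply: filterS => y hy yi.
by exists (cinv i y); [exact: hy|rewrite cinvK].
Qed.

Lemma tangent_map_transition i j t x : 0 <= t <= T -> cdom i x -> cdom j x ->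
  jac (cmap i @` (cdom i `&` cdom j)) (cmap j \o cinv i) (cmap i x) *m
    tangent_map f j t (cmap j x) = tangent_map f i t (cmap i x).
Proof.
move=> tT xi xj; set A := cmap i @` _.
have Ax : A (cmap i x) by exists x.
have Aj y : A y -> cimg j ((cmap j \o cinv i) y).
  by move=> [x' [xi' xj'] <-]; rewrite /= cmapK//; exact: cmap_cimg.
have [[dtr _] _] := transition_C2 i j.
have dj : is_diff_within (cimg j) (f t \o cinv j) ((cmap j \o cinv i) (cmap i x))
    (tangent_map f j t (cmap j x)).
  by rewrite /= cmapK//; apply: tangent_mapP => //; exact: cmap_cimg.
apply/esym; apply: jac_unique; first exact/fat_cimg/cmap_cimg.
apply: (is_diff_withinW (near_overlap xi xj)).
apply: eq_is_diff_within (is_diff_within_comp Aj (dtr _ Ax) dj) => //.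
by move=> y [x' [xi' xj'] <-] /=; rewrite !cmapK.
Qed.

Lemma transition_frame i j p : bdom T i p -> bdom T j p ->
  transition i j p *m frame j (bmap j p) = frame i (bmap i p).
Proof.
move=> [pT pi] [_ pj]; rewrite /transition /frame /bmap !row_mxKl !row_mxKr.
rewrite mulmx_block !mulmx0 !mul0mx !addr0 add0r mul1mx !mxE.
by rewrite tangent_map_transition.
Qed.

(** Changes of coordinates pass through the ambient space, so composing them reduces to identities
    between frames and coframes. *)
Lemma transitionE i j p : bdom T i p -> bdom T j p ->
  transition i j p = frame i (bmap i p) *m coframe j (bmap j p).
Proof.
move=> pi pj; rewrite -(transition_frame pi pj) -mulmxA frameK ?mulmx1//.
exact: bimg_bmap.
Qed.

Lemma frame_coframe_frame i j p : bdom T i p -> bdom T j p ->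
  frame i (bmap i p) *m coframe j (bmap j p) *m frame j (bmap j p) =
  frame i (bmap i p).
Proof. by move=> pi pj; rewrite -transitionE// transition_frame. Qed.

(** The transpose of [frame_coframe_frame], by symmetry of the projection [coframe *m frame]: both
    charts share one tangent space. *)
Lemma coframe_frame_coframe i j p : bdom T i p -> bdom T j p ->
  coframe j (bmap j p) *m frame j (bmap j p) *m coframe i (bmap i p) =
  coframe i (bmap i p).
Proof.
move=> pi pj; rewrite {2}/coframe mulmxA -tr_coframe_frame -trmx_mul mulmxA.
by rewrite frame_coframe_frame.
Qed.

Definition frame_at p := frame (chart_at S p.2) (bmap (chart_at S p.2) p).

Definition coframe_at p := coframe (chart_at S p.2) (bmap (chart_at S p.2) p).

(* The chart-independent ambient forms of a vector field and of a 1-1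
   tensor field: [gbar] and [gbar11] become the Euclidean norms. *)
Definition ambient_vector (u : R * M -> 'rV[R]_(1 + 2)) p : 'rV[R]_(1 + 3) :=
  u p *m frame_at p.

Definition ambient_tensor (A : R * M -> 'M[R]_(1 + 2)) p : 'M[R]_(1 + 3) :=
  coframe_at p *m A p *m frame_at p.

Lemma vector_inE i u p : bdom T i p ->
  vector_in i u p = ambient_vector u p *m coframe i (bmap i p).
Proof.
move=> pi; have pa := bdom_chart_at pi.1.
by rewrite /vector_in (transitionE pa pi) mulmxA.
Qed.

Lemma ambient_vectorE i u p : bdom T i p ->
  ambient_vector u p = vector_in i u p *m frame i (bmap i p).
Proof.
move=> pi; have pa := bdom_chart_at pi.1.
by rewrite /vector_in -mulmxA (transition_frame pa pi).
Qed.

Lemma tensor_inE i A p : bdom T i p ->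
  tensor_in i A p =
  frame i (bmap i p) *m ambient_tensor A p *m coframe i (bmap i p).
Proof.
move=> pi; have pa := bdom_chart_at pi.1.
by rewrite /tensor_in (transitionE pa pi) (transitionE pi pa) /ambient_tensor !mulmxA.
Qed.

Lemma ambient_tensorE i A p : bdom T i p ->
  ambient_tensor A p =
  coframe i (bmap i p) *m tensor_in i A p *m frame i (bmap i p).
Proof.
move=> pi; have pa := bdom_chart_at pi.1.
have E1 : coframe i (bmap i p) *m frame i (bmap i p) *m coframe_at p =
    coframe_at p := coframe_frame_coframe pa pi.
have E2 : frame_at p *m coframe i (bmap i p) *m frame i (bmap i p) =
    frame_at p := frame_coframe_frame pa pi.
rewrite (tensor_inE A pi) /ambient_tensor.
move: (frame i _) (coframe i _) (frame_at p) (coframe_at p) E1 E2.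
by move=> Fi Ci Fa Ca E1 E2; rewrite -{1}E1 -{1}E2 !mulmxA.
Qed.

Lemma frame_atK p : spacetime T p -> frame_at p *m coframe_at p = 1%:M.
Proof. by move=> pT; apply: frameK; exact/bimg_bmap/bdom_chart_at. Qed.

Lemma vector_of_ambient u p : spacetime T p ->
  u p = ambient_vector u p *m coframe_at p.
Proof.
by move=> pT; rewrite /ambient_vector -mulmxA frame_atK// mulmx1.
Qed.

Lemma tensor_of_ambient A p : spacetime T p ->
  A p = frame_at p *m ambient_tensor A p *m coframe_at p.
Proof.
move=> /frame_atK K.
rewrite /ambient_tensor; move: (frame_at p) (coframe_at p) K => F C K.
by rewrite !mulmxA K mul1mx -mulmxA K mulmx1.
Qed.

Lemma gbarE u p :
  gbar S f alpha p (u p) (u p) = \sum_k ambient_vector u p 0 k ^+ 2.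
Proof.
rewrite /gbar /gbar_at gbar_inE mulmxA -mulmxA -trmx_mul mxE.
by apply: eq_bigr => k _; rewrite [X in _ * X]mxE -expr2.
Qed.

(** With [F F^T] for the metric and [C^T C] for its inverse, cycling the trace groups the factors
    into the ambient tensor [C A F] and its transpose. *)
Lemma gbar11E A p : spacetime T p ->
  gbar11 S f alpha p (A p) (A p) = \sum_k \sum_l ambient_tensor A p k l ^+ 2.
Proof.
move=> pT; have pb := bimg_bmap (bdom_chart_at pT).
rewrite /gbar11 /adjoint.
rewrite (_ : \tr _ = \tr ((ambient_tensor A p)^T *m ambient_tensor A p)).
  rewrite /mxtrace exchange_big/=; apply: eq_bigr => l _; rewrite mxE.
  by apply: eq_bigr => k _; rewrite [X in X * _]mxE -expr2.
have GE : gbar_at S f alpha p = frame_at p *m (frame_at p)^T by exact: gbar_inE.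
have IE : invmx (gbar_at S f alpha p) = (coframe_at p)^T *m coframe_at p.
  by rewrite [RHS](tr_coframe_coframe pb).
rewrite /ambient_tensor IE GE.
move: (frame_at p) (coframe_at p) (A p) => F C B.
by rewrite -!mulmxA mxtrace_mulC !trmx_mul !mulmxA.
Qed.

(** The ambient form of the covector [w] has the time entry [w 0 (lshift 2 0) / alpha]; the other
    squares are dropped. A bound on the differential of the image sequence thus bounds its time
    derivative. *)
Lemma gbar_dual_ge p (w : 'rV[R]_(1 + 2)) : spacetime T p ->
  w 0 (lshift 2 0) ^+ 2 / alpha ^+ 2 <= gbar_dual S f alpha p w w.
Proof.
move=> pT; have pb := bimg_bmap (bdom_chart_at pT).
have IE : invmx (gbar_at S f alpha p) = (coframe_at p)^T *m coframe_at p.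
  by rewrite [RHS](tr_coframe_coframe pb).
have sq (C : 'M[R]_(1 + 3, 1 + 2)) :
    w *m (C^T *m C) *m w^T = (w *m C^T) *m (w *m C^T)^T.
  by rewrite trmx_mul trmxK !mulmxA.
rewrite /gbar_dual IE sq.
rewrite mxE (bigD1 (lshift 3 0))//= [X in _ <= _ * X + _]mxE -expr2.
apply: ler_wpDr.
  by apply: sumr_ge0 => k _; rewrite [X in _ * X]mxE -expr2 sqr_ge0.
pose e (n : nat) : 'cV[R]_(1 + n) := col_mx 1%:M 0.
have eP n (v : 'rV[R]_(1 + n)) : v 0 (lshift n 0) = (v *m e n) 0 0.
  by rewrite -{2}[v]hsubmxK mul_row_col mulmx1 mulmx0 addr0 mxE.
have De : frame_at p *m e 3 = alpha *: e 2.
  rewrite mul_block_col !mulmx0 mul0mx !addr0 mulmx1.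
  by rewrite scale_col_mx scaler0 scalemx1.
have Ge : gbar_at S f alpha p *m e 2 = alpha ^+ 2 *: e 2.
  rewrite mul_block_col !mulmx0 mul0mx !addr0 mulmx1.
  by rewrite scale_col_mx scaler0 scalemx1.
have Ve : invmx (gbar_at S f alpha p) *m e 2 = alpha ^- 2 *: e 2.
  rewrite -[RHS](mulKmx (gbar_in_unit pb)) -/(gbar_at S f alpha p).
  by rewrite -scalemxAr Ge scalerA mulVf ?scale1r// expf_neq0// gt_eqF.
rewrite !eP -mulmxA /coframe_at /coframe trmx_mul trmxK trmx_inv tr_gbar_in.
rewrite -/(frame_at p) -(mulmxA _ _ (e 3)) De -scalemxAr Ve scalerA.
rewrite (_ : alpha / alpha ^+ 2 = alpha^-1); last first.
  by rewrite expr2 invfM mulrA divff ?gt_eqF// mul1r.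
by rewrite -scalemxAr; move: (w *m e 2) => c; rewrite mxE exprMn exprVn mulrC.
Qed.

Lemma gradE p w v : spacetime T p -> g S f p (grad S f p w) v = (w *m v^T) 0 0.
Proof.
move=> pT; have /g_in_unit := bimg_bmap (bdom_chart_at pT).
rewrite /bmap row_mxKl row_mxKr mxE /= => gU.
by rewrite /g /grad -(mulmxA w) mulVmx ?mulmx1.
Qed.

(** Covectors transform by the transpose of the inverse transition, so the pairing does not depend
    on the chart. *)
Lemma differential_vector p i w u : bdom T i p ->
  w p *m (u p)^T = covector_in i w p *m (vector_in i u p)^T.
Proof.
move=> pi; have pa := bdom_chart_at pi.1.
rewrite /covector_in /vector_in trmx_mul mulmxA -(mulmxA (w p)) -trmx_mul.
rewrite (transitionE pa pi) (transitionE pi pa) mulmxA frame_coframe_frame//.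
by rewrite frameK ?trmx1 ?mulmx1//; exact: bimg_bmap.
Qed.

Lemma covector_in_time i w p : bdom T i p ->
  covector_in i w p 0 (lshift 2 0) = w p 0 (lshift 2 0).
Proof.
move=> pi; rewrite /covector_in /transition tr_block_mx trmx1 !trmx0.
rewrite -{1}[w p]hsubmxK mul_row_block mulmx1 !mulmx0 addr0 row_mxEl.
by rewrite mxE.
Qed.

End surface_frames.

(** * Limits, bounds and differentials relative to a set *)

Section within_continuity.
Context {R : realType}.

Lemma eq_cvgmx {T : Type} {F : set_system T} {FF : Filter F} (m n : nat)
    (h k : T -> 'M[R]_(m, n)) A :
  (\forall x \near F, h x = k x) -> cvgmx F h A -> cvgmx F k A.
Proof.
move=> hk hA i j; apply: cvg_trans (hA i j); apply: near_eq_cvg.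
by apply: filterS hk => x ->.
Qed.

Lemma cvg_cvgmx {T : Type} {F : set_system T} {FF : Filter F} (m n : nat)
    (h : T -> 'M[R]_(m, n)) A : h x @[x --> F] --> A -> cvgmx F h A.
Proof.
move=> hA i j.
exact: (cvg_comp _ (fun B : 'M[R]_(m, n) => B i j) hA (@coord_continuous _ m n i j A)).
Qed.

Lemma within_interior_cvg {T U : topologicalType} (A : set T) (h : T -> U) (x : T) (l : U) :
  A° x -> h y @[y --> within A (nbhs x)] --> l -> h y @[y --> x] --> l.
Proof.
move=> Ax hl P Pl; have nP : nbhs x [set y | A y -> P (h y)] := hl _ Pl.
by apply: filterS2 Ax nP => y Ay; apply.
Qed.

Lemma compact_within_bounded {n : nat} (A K : set 'rV[R]_n) (h : 'rV[R]_n -> R) :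
  (forall x, A x -> h y @[y --> within A (nbhs x)] --> h x) ->
  compact K -> K `<=` A -> exists C : R, forall x, K x -> `|h x| <= C.
Proof.
move=> hc cK KA.
have ch : {within K, continuous h}.
  by apply: (continuous_subspaceW KA); apply/subspace_continuousP.
have [C [_ /(_ (C + 1))]] := compact_bounded (continuous_compact ch cK).
rewrite ltrDl ltr01 => /(_ isT) Cb; exists (C + 1) => x Kx.
by apply: Cb; exists x.
Qed.

Lemma within_preimage_open {n : nat} {U : topologicalType} (A : set 'rV[R]_n)
    (h : 'rV[R]_n -> U) (V : set U) :
  (forall x, A x -> h y @[y --> within A (nbhs x)] --> h x) -> open V ->
  exists2 W, open W & A `&` h @^-1` V = A `&` W.
Proof.
move=> /subspace_continuousP hc oV.
have := (continuousP _).1 hc V oV; move=> /open_subspaceP [W oW WA].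
by exists W => //; rewrite (setIC A W) WA setIC.
Qed.

(* The differential of [v |-> c + e * \sum_k v 0 (a k) * v 0 (b k)], the form of
   an entry of [gbar_in] as a function of the Jacobian of [f]. *)
Definition quadratic_diff (N : nat) (e : R) (a b : 'I_3 -> 'I_N)
    (v : 'rV[R]_N) : 'cV[R]_N :=
  e *: \sum_k (v 0 (b k) *: delta_mx (a k) 0 + v 0 (a k) *: delta_mx (b k) 0).

Lemma cvgmx_quadratic_diff {T : Type} {F : set_system T} {FF : Filter F}
    (N : nat) (e : R) (a b : 'I_3 -> 'I_N) (h : T -> 'rV[R]_N) v :
  cvgmx F h v ->
  cvgmx F (fun x => quadratic_diff e a b (h x)) (quadratic_diff e a b v).
Proof.
move=> hv m n.
have E (w : 'rV[R]_N) : quadratic_diff e a b w m n =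
    e * \sum_k (w 0 (b k) * (delta_mx (a k) 0 : 'cV[R]_N) m n +
              w 0 (a k) * (delta_mx (b k) 0 : 'cV[R]_N) m n).
  by rewrite mxE summxE; congr (_ * _); apply: eq_bigr => k _; rewrite !mxE.
rewrite E; under eq_fun do rewrite E.
apply: cvgM; first exact: cvg_cst.
apply: cvg_bigsum => k _; apply: cvgD; apply: cvgM; try exact: cvg_cst;
exact: hv.
Qed.

Lemma is_diff_quadratic (N : nat) (c e : R) (a b : 'I_3 -> 'I_N) (v : 'rV[R]_N) :
  is_diff_within setT
    (fun v : 'rV[R]_N => (c + e * \sum_k v 0 (a k) * v 0 (b k))%:M : 'rV[R]_1) v
    (quadratic_diff e a b v).
Proof.
(* The error is exactly [e] times a sum of three products of entries of [w - v], each at most the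
   squared norm of [w - v]; hence the factor 3. *)
move=> d d0; rewrite /quadratic_diff; pose C := `|e| * 3 + 1.
have C0 : 0 < C by rewrite ltr_wpDl// mulr_ge0.
have dC : 0 < d / C by rewrite divr_gt0.
have nv : \forall w \near nbhs v, `|w - v| < d / C.
  by apply/nbhs_ballP; exists (d / C) => //= y; rewrite -ball_normE /= distrC.
rewrite near_withinE; near=> w => _; set D := w - v.
have Dd : `|D| < d / C by exact: (near nv w).
apply/mx_norm_leP => [|i j]; first by rewrite mulr_ge0// ltW.
rewrite (ord1 i) (ord1 j) -scalemxAr mulmx_sumr.
rewrite [X in `|X| <= _](_ : _ = e * \sum_k D 0 (a k) * D 0 (b k)).
  rewrite normrM; apply: (@le_trans _ _ (`|e| * (3 * (`|D| * `|D|)))).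
    apply: ler_wpM2l => //; apply: le_trans (ler_norm_sum _ _ _) _.
    apply: (@le_trans _ _ (\sum_(k < 3) `|D| * `|D|)).
      apply: ler_sum => k _; rewrite normrM.
      by apply: ler_pM => //; exact: ler_mx_norm_coord.
    by rewrite sumr_const card_ord -[leLHS]mulr_natl.
  rewrite !mulrA; apply: ler_wpM2r => //.
  apply: (@le_trans _ _ (C * `|D|)); first by rewrite ler_wpM2r// lerDl.
  by rewrite mulrC -ler_pdivlMr// ltW.
have coef (m : 'I_N) : (D *m delta_mx m (0 : 'I_1)) 0 0 = w 0 m - v 0 m.
  by rewrite -colE !mxE.
have termE k : (D *m (v 0 (b k) *: delta_mx (a k) 0 +
    v 0 (a k) *: delta_mx (b k) (0 : 'I_1))) 0 0 =
    v 0 (b k) * (w 0 (a k) - v 0 (a k)) + v 0 (a k) * (w 0 (b k) - v 0 (b k)).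
  rewrite mulmxDr -!scalemxAr -!coef; move: (D *m _) (D *m _) => X Y.
  by rewrite !mxE.
have sumE : (\sum_k D *m (v 0 (b k) *: delta_mx (a k) 0 +
    v 0 (a k) *: delta_mx (b k) (0 : 'I_1))) 0 0 = \sum_k (v 0 (b k) *
    (w 0 (a k) - v 0 (a k)) + v 0 (a k) * (w 0 (b k) - v 0 (b k))).
  by rewrite summxE; apply: eq_bigr => k _; exact: termE.
move: sumE; move: (\sum_k D *m _) => X XE.
rewrite !mxE XE !mulr1n (_ : c + _ - _ - _ = e * (\sum_k w 0 (a k) * w 0 (b k) -
  \sum_k v 0 (a k) * v 0 (b k) - \sum_k (v 0 (b k) *
    (w 0 (a k) - v 0 (a k)) + v 0 (a k) * (w 0 (b k) - v 0 (b k))))); last by ring.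
congr (_ * _); rewrite -!sumrB; apply: eq_bigr => k _; rewrite !mxE; ring.
Unshelve. all: by end_near. Qed.

End within_continuity.

(** * Continuity of the metric, the density and the Christoffel symbols in charts *)

Section chart_continuity.
Context {R : realType} {M : ptopologicalType}.
Variables (S : surface R M) (T alpha : R) (f : R -> M -> 'rV[R]_3).
Hypothesis alpha0 : 0 < alpha.
Hypothesis mov : is_moving_surface S T f.
Implicit Types (i j : chart S) (p : R * M) (z : 'rV[R]_(1 + 2)).

Lemma time_slice_eta z : time_slice (lsubmx z 0 0) (rsubmx z) = z.
Proof.
rewrite /time_slice -[RHS]hsubmxK; congr row_mx; apply/rowP => k.
by rewrite (ord1 k) [LHS]mxE.
Qed.

Lemma within_bimg i z : \forall y \near within (bimg T i) (nbhs z), bimg T i y.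
Proof. exact: withinT. Qed.

Lemma tangent_map_jac i y : bimg T i y ->
  tangent_map f i (lsubmx y 0 0) (rsubmx y) =
  row_mx 0 1%:M *m jac (bimg T i) (st_map f i) y.
Proof. by move=> [yT yi]; rewrite (tangent_mapE mov)// time_slice_eta. Qed.

Lemma cvg_jac i z : bimg T i z ->
  cvgmx (within (bimg T i) (nbhs z)) (jac (bimg T i) (st_map f i))
    (jac (bimg T i) (st_map f i) z).
Proof.
move=> zi; apply: cvg_cvgmx; have [[_ cJ] _] := mov.1 i.
exact: ((subspace_continuousP _ _).1 cJ).
Qed.

Lemma cvg_frame i z : bimg T i z ->
  cvgmx (within (bimg T i) (nbhs z)) (frame alpha f i) (frame alpha f i z).
Proof.
move=> zi; rewrite /frame; apply: cvgmx_block; try exact: cvgmx_cst.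
rewrite tangent_map_jac//.
apply: eq_cvgmx; last first.
  by apply: cvgmx_mul; [exact: cvgmx_cst|exact: cvg_jac].
by apply: filterS (within_bimg i z) => y yi; rewrite tangent_map_jac.
Qed.

Lemma cvg_gbar_in i z : bimg T i z ->
  cvgmx (within (bimg T i) (nbhs z)) (gbar_in f alpha i) (gbar_in f alpha i z).
Proof.
move=> zi; rewrite gbar_inE; apply: eq_cvgmx; last first.
  by apply: cvgmx_mul; [exact: cvg_frame|apply: cvgmx_tr; exact: cvg_frame].
by apply: nearW => y; rewrite gbar_inE.
Qed.

Lemma cvg_coframe i z : bimg T i z ->
  cvgmx (within (bimg T i) (nbhs z)) (coframe alpha f i) (coframe alpha f i z).
Proof.
move=> zi; apply: cvgmx_mul; first by apply: cvgmx_tr; exact: cvg_frame.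
by apply: cvgmx_inv; [exact: (gbar_in_unit alpha0 mov)|exact: cvg_gbar_in].
Qed.

Definition density i z : R := Num.sqrt (\det (gbar_in f alpha i z)).

Lemma density_gt0 i z : bimg T i z -> 0 < density i z.
Proof. by move=> zi; rewrite sqrtr_gt0; exact: (det_gbar_in_gt0 alpha0 mov). Qed.

Lemma cvg_density i z : bimg T i z ->
  density i y @[y --> within (bimg T i) (nbhs z)] --> density i z.
Proof.
move=> zi; apply: (cvg_comp _ (@Num.sqrt R) (cvg_det (cvg_gbar_in zi))).
exact: sqrt_continuous.
Qed.

(** Makes the metric a polynomial in first derivatives of the motion, whose differential is
    explicit; the constant entries take [b = 0]. *)
Lemma gbar_in_quadratic i d e : exists c b (u v : 'I_3 -> 'I_((1 + 2) * 3)),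
  forall y, bimg T i y ->
    let J := mxvec (jac (bimg T i) (st_map f i) y) in
    gbar_in f alpha i y d e = c + b * \sum_k J 0 (u k) * J 0 (v k).
Proof.
have cstE c : (exists c' b (u v : 'I_3 -> 'I_((1 + 2) * 3)),
    forall y, bimg T i y ->
    let J := mxvec (jac (bimg T i) (st_map f i) y) in
    c = c' + b * \sum_k J 0 (u k) * J 0 (v k)).
  exists c, 0, (mxvec_index ord0), (mxvec_index ord0) => y _ /=.
  by rewrite mul0r addr0.
rewrite /gbar_in; case: (split_ordP d) => d' ->; case: (split_ordP e) => e' ->.
- have [c [b [u [v cP]]]] := cstE ((alpha ^+ 2)%:M d' e').
  by exists c, b, u, v => y yi; rewrite block_mxEul; exact: cP.
- have [c [b [u [v cP]]]] := cstE 0; exists c, b, u, v => y yi.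
  by rewrite block_mxEur mxE; exact: cP.
- have [c [b [u [v cP]]]] := cstE 0; exists c, b, u, v => y yi.
  by rewrite block_mxEdl mxE; exact: cP.
exists 0, 1, (mxvec_index (rshift 1 d')), (mxvec_index (rshift 1 e')) => y yi.
rewrite block_mxEdr add0r mul1r /= /g_in (tangent_map_jac yi) mxE.
apply: eq_bigr => k _; rewrite !mxvecE [X in _ * X]mxE.
set J := jac _ _ y.
have JE : row_mx 0 1%:M *m J = dsubmx J.
  by rewrite -{1}[J]vsubmxK mul_row_col mul0mx add0r mul1mx.
by rewrite JE !mxE.
Qed.

(** By the chain rule the derivative is a product of the second differential of the motion and
    [quadratic_diff] of the first, both continuous. Identifying [pd] with this product uses
    uniqueness of relative differentials, whence the restriction to the interior. *)
Lemma cvg_pd_gbar_in i d e c z : (bimg T i)° z ->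
  pd (bimg T i) (fun y => gbar_in f alpha i y d e) c y
    @[y --> within (bimg T i) (nbhs z)] -->
  pd (bimg T i) (fun y => gbar_in f alpha i y d e) c z.
Proof.
move=> zi; have zb := interior_subset zi.
have [k [b [u [v gE]]]] := gbar_in_quadratic i d e.
pose F y := mxvec (jac (bimg T i) (st_map f i) y).
pose L := quadratic_diff b u v.
have [_ [dF cF]] := mov.1 i.
have pdE y : (bimg T i)° y ->
    pd (bimg T i) (fun y => gbar_in f alpha i y d e) c y =
    (jac (bimg T i) F y *m L (F y)) c 0.
  move=> yi; have yb := interior_subset yi; rewrite /pd.
  rewrite (@jac_unique _ _ _ _ _ _ (jac (bimg T i) F y *m L (F y))) //.
    exact: fat_interior.
  have := is_diff_within_comp (fun _ _ => Logic.I) (dF _ yb)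
    (is_diff_quadratic k b u v (F y)).
  by apply: eq_is_diff_within => // w wi /=; rewrite gE.
have cvF : cvgmx (within (bimg T i) (nbhs z)) F (F z).
  apply: eq_cvgmx (nearW _ (fun y => erefl (F y))) _ => a m.
  case/mxvec_indexP: m => m1 m2; rewrite /F (ord1 a) mxvecE.
  by under eq_fun do rewrite mxvecE; exact: cvg_jac.
rewrite pdE//.
apply: cvg_trans (_ : (jac (bimg T i) F y *m L (F y)) c 0
    @[y --> within (bimg T i) (nbhs z)] --> _).
  apply: near_eq_cvg; rewrite near_withinE.
  have : \forall y \near nbhs z, (bimg T i)° y.
    by apply: open_nbhs_nbhs; split => //; exact: open_interior.
  by apply: filterS => y yi _; rewrite pdE.
apply: cvgmx_mul; last exact: cvgmx_quadratic_diff.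
apply: cvg_cvgmx.
exact: ((subspace_continuousP _ _).1 cF).
Qed.

Lemma cvg_christoffel i k a b z : (bimg T i)° z ->
  christoffel T f alpha i y k a b @[y --> z] --> christoffel T f alpha i z k a b.
Proof.
move=> zi; have zb := interior_subset zi; apply: (within_interior_cvg zi).
rewrite /christoffel; apply: cvgM; first exact: cvg_cst.
apply: cvg_bigsum => l _; apply: cvgM.
  by apply: cvgmx_inv; [exact: (gbar_in_unit alpha0 mov)|exact: cvg_gbar_in].
by apply: cvgB; [apply: cvgD|]; exact: cvg_pd_gbar_in.
Qed.

Lemma continuous_time : continuous (fun z : 'rV[R]_(1 + 2) => lsubmx z 0 0 : R).
Proof.
move=> z; have -> : (fun z : 'rV[R]_(1 + 2) => lsubmx z 0 0) = (fun z => z 0 (lshift 2 0)).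
  by apply/funext => y; rewrite mxE.
exact: coord_continuous.
Qed.

Lemma cvg_binv i z : bimg T i z ->
  binv i y @[y --> within (bimg T i) (nbhs z)] --> binv i z.
Proof.
move=> zi; have [_ zi2] := zi.
have c1 : lsubmx y 0 0 @[y --> within (bimg T i) (nbhs z)] --> lsubmx z 0 0.
  by apply: cvg_within_filter; exact: continuous_time.
have ci := (subspace_continuousP _ _).1 (@cinv_continuous _ _ S i) _ zi2.
have c2 : cinv i (rsubmx y) @[y --> within (bimg T i) (nbhs z)] -->
    cinv i (rsubmx z).
  move=> P nP; have nP' : nbhs (rsubmx z) [set x | cimg i x -> P (cinv i x)] := ci _ nP.
  have nP2 : nbhs z [set y | cimg i (rsubmx y) -> P (cinv i (rsubmx y))].
    exact: (@continuous_rsubmx R 1 1 2 z _ nP').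
  suff : nbhs z [set y | bimg T i y -> P (cinv i (rsubmx y))] by [].
  by apply: filterS nP2 => y Py [_ yi]; exact: Py.
exact: cvg_pair c1 c2.
Qed.

End chart_continuity.

(** * The volume in charts *)

Section boundary_and_compacts.
Context {R : realType}.
Local Notation R3 :=
  (measurableTypeR R * measurableTypeR R * measurableTypeR R)%type.
Local Notation leb := (leb3 R).

Lemma leb3_box (A B C : set (measurableTypeR R)) :
  measurable A -> measurable B -> measurable C ->
  (leb ((A `*` B) `*` C) =
   lebesgue_measure A * lebesgue_measure B * lebesgue_measure C)%E.
Proof.
move=> mA mB mC; apply: etrans (product_measure1E _ _ _ mC) _.
  exact: measurableX.
by congr (_ * _)%E; exact: product_measure1E.
Qed.

Lemma leb3_compact_fin (K : set 'rV[R]_(1 + 2)) :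
  compact K -> (leb (vec3 @^-1` K : set R3) < +oo)%E.
Proof.
move=> cK; have [m [_ /(_ (m + 1))]] := compact_bounded cK.
rewrite ltrDl ltr01 => /(_ isT) Kb.
pose I : set (measurableTypeR R) := `[- (m + 1), m + 1]%classic.
have mI : measurable I by exact: measurable_itv.
have Ifin : (lebesgue_measure I < +oo)%E.
  by rewrite /I lebesgue_measure_itv/=; case: ifP => _; rewrite ltry.
apply: (@le_lt_trans _ _ (leb ((I `*` I) `*` I))).
  apply: le_measure; rewrite ?inE.
  - exact: compact_measurable_vec3.
  - by apply: measurableX => //; exact: measurableX.
  move=> q /Kb /=; set z := vec3 q => zm.
  have co i : `|z 0 i| <= m + 1 by apply: le_trans zm; exact: ler_mx_norm_coord.
  have qE : q = unvec3 z by rewrite /z vec3K.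
  rewrite qE /I /unvec3 /=; rewrite !in_itv /= -!ler_norml.
  by split; [split|]; exact: co.
rewrite leb3_box//; apply: lte_mul_pinfty => //.
- by apply: mule_ge0.
- by rewrite ge0_fin_numE ?mule_ge0//; apply: lte_mul_pinfty => //; rewrite ge0_fin_numE.
Qed.

(** The two coordinates are time and the one that [half_plane] constrains: the faces of chart images
    lie in such planes. *)
Lemma leb3_plane (c : R) :
  leb [set q : R3 | q.1.1 = c] = 0%E /\ leb [set q : R3 | q.1.2 = c] = 0%E.
Proof.
split.
  rewrite (_ : [set q : R3 | _] = ([set c] `*` setT) `*` setT).
    by rewrite leb3_box// lebesgue_measure_set1 !mul0e.
  by apply/seteqP; split => [[[a b] d]/= ->|[[a b] d] /= [[-> _] _]].
rewrite (_ : [set q : R3 | _] = (setT `*` [set c]) `*` setT).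
  by rewrite leb3_box// lebesgue_measure_set1 mule0 mul0e.
by apply/seteqP; split => [[[a b] d]/= ->|[[a b] d] /= [[_ ->] _]].
Qed.

End boundary_and_compacts.

Lemma measurable_fun_pair_in {d d1 d2 : measure_display}
    {T : measurableType d} {T1 : measurableType d1} {T2 : measurableType d2}
    (D : set T) (h : T -> T1) (k : T -> T2) :
  measurable D -> measurable_fun D h -> measurable_fun D k ->
  measurable_fun D (fun x => (h x, k x)).
Proof.
move=> mD mh mk.
have mhk := measurable_fun_pair ((measurable_restrictT _ mD).1 mh)
  ((measurable_restrictT _ mD).1 mk).
apply: (eq_measurable_fun _ _ (measurable_funTS mhk)) => x xD.
by rewrite !patchE xD.
Qed.

Section volume_in_charts.
Context {R : realType} {M : ptopologicalType}.
Variables (S : surface R M) (T alpha : R) (f : R -> M -> 'rV[R]_3).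
Hypothesis alpha0 : 0 < alpha.
Hypothesis mov : is_moving_surface S T f.
Hypothesis cM : compact [set: M].
Variable vol : {measure set (spacetime_type (R := R) (M := M)) -> \bar R}.
Hypothesis volP : is_volume S T f alpha vol.
Local Notation R3 :=
  (measurableTypeR R * measurableTypeR R * measurableTypeR R)%type.
Local Notation leb := (leb3 R).
Local Notation X := (spacetime_type (R := R) (M := M)).
Implicit Types (i j : chart S) (p : R * M) (z : 'rV[R]_(1 + 2)).

Lemma measurable_bimg i : measurable (vec3 @^-1` bimg T i : set R3).
Proof.
have [U oU iU] := cimg_open i.
have mt : measurable (vec3 @^-1` [set z : 'rV[R]_(1 + 2) | 0 <= lsubmx z 0 0 <= T] : set R3).
  rewrite (_ : _ @^-1` _ = (fun q : R3 => lsubmx (vec3 q) 0 0 : R) @^-1` `[0, T]).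
    rewrite -[X in measurable X]setTI.
    by apply: (measurable_vec3_comp continuous_time).
  by apply/seteqP; split => q /=; rewrite in_itv.
have mU : measurable (vec3 @^-1` [set z : 'rV[R]_(1 + 2) | U (rsubmx z)] : set R3).
  apply: measurable_vec3_open.
  by move/continuousP: (@continuous_rsubmx R 1 1 2); exact.
have mh : measurable (vec3 @^-1` [set z : 'rV[R]_(1 + 2) | 0 <= rsubmx z 0 0] : set R3).
  rewrite (_ : _ @^-1` _ = (fun q : R3 => rsubmx (vec3 q) 0 0 : R) @^-1` `[0, +oo[).
    rewrite -[X in measurable X]setTI.
    apply: (@measurable_vec3_comp _ (fun z => rsubmx z 0 0)) => // z.
    apply: (@continuous_comp _ _ _ (fun y : 'rV[R]_(1 + 2) => rsubmx y)
      (fun y : 'rV[R]_2 => y 0 0)); first exact: continuous_rsubmx.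
    exact: coord_continuous.
  by apply/seteqP; split => q /=; rewrite in_itv /= andbT.
rewrite (_ : _ @^-1` _ = vec3 @^-1` [set z : 'rV[R]_(1 + 2) | 0 <= lsubmx z 0 0 <= T] `&`
  (vec3 @^-1` [set z : 'rV[R]_(1 + 2) | U (rsubmx z)] `&`
   vec3 @^-1` [set z : 'rV[R]_(1 + 2) | 0 <= rsubmx z 0 0]) :> set R3).
  by apply: measurableI => //; exact: measurableI.
by apply/seteqP; split => q; rewrite /bimg /= iU.
Qed.

Lemma measurable_within_bimg i (h : 'rV[R]_(1 + 2) -> R) :
  (forall z, bimg T i z -> h y @[y --> within (bimg T i) (nbhs z)] --> h z) ->
  measurable_fun (vec3 @^-1` bimg T i : set R3) (fun q => h (vec3 q)).
Proof.
move=> hc; apply: (measurability _ (RGenOInfty.measurableE R)).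
move=> _ [_ [a ->] <-].
have oa : open (`]a, +oo[%classic : set R) by exact: interval_open.
have [W oW WE] := within_preimage_open hc oa.
rewrite (_ : _ `&` _ = vec3 @^-1` (bimg T i `&` W) :> set R3); last by rewrite -WE.
rewrite preimage_setI; apply: measurableI; first exact: measurable_bimg.
exact: measurable_vec3_open.
Qed.

Lemma open_measurable_spacetime (U : set (R * M)) :
  open U -> measurable (U : set X).
Proof. by move=> oU; exact: sub_sigma_algebra. Qed.

Lemma measurable_time : measurable_fun setT (fun p : X => p.1 : measurableTypeR R).
Proof.
apply: (measurability _ (RGenOInfty.measurableE R)) => _ [_ [a ->] <-].
rewrite setTI; apply: open_measurable_spacetime.
have oa : open (`]a, +oo[%classic : set R) by exact: interval_open.
by apply: (continuousP _).1 oa => p; exact: cvg_fst.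
Qed.

Lemma measurable_spacetime : measurable (spacetime T : set X).
Proof.
rewrite (_ : spacetime T = (fun p : X => p.1 : measurableTypeR R) @^-1` `[0, T]).
  by rewrite -[X in measurable X]setTI; exact: measurable_time.
by apply/seteqP; split => q /=; rewrite in_itv.
Qed.

Lemma measurable_cylinder (U : set M) : open U ->
  measurable ([set p | U p.2] : set X).
Proof.
move=> oU; apply: open_measurable_spacetime.
by apply: (continuousP _).1 oU => p; exact: cvg_snd.
Qed.

Lemma measurable_bdom i : measurable (bdom T i : set X).
Proof.
rewrite (_ : bdom T i = spacetime T `&` [set p | cdom i p.2]) //.
apply: measurableI; first exact: measurable_spacetime.
by apply: measurable_cylinder; exact: cdom_open.
Qed.

Lemma open_cdom_preimage i (W : set 'rV[R]_2) : open W ->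
  open [set x | cdom i x /\ W (cmap i x)].
Proof.
move=> oW; rewrite openE => x [xi Wx].
have cx := (subspace_continuousP _ _).1 (@cmap_continuous _ _ S i) _ xi.
have : nbhs x [set y | cdom i y -> W (cmap i y)].
  by apply: cx; exact: open_nbhs_nbhs.
have : nbhs x (cdom i) by apply: open_nbhs_nbhs; split => //; exact: cdom_open.
by apply: filterS2 => y yi /(_ yi) Wy; split.
Qed.

Lemma measurable_bmap_coord i k :
  measurable_fun (bdom T i : set X) (fun p : X => bmap i p 0 k : measurableTypeR R).
Proof.
rewrite /bmap; case: (split_ordP k) => k' ->.
  apply: (eq_measurable_fun (fun p : X => p.1 : measurableTypeR R)).
    by move=> p _; rewrite row_mxEl mxE (ord1 k').
  exact: measurable_funTS measurable_time.
apply: (eq_measurable_fun (fun p : X => cmap i p.2 0 k' : measurableTypeR R)).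
  by move=> p _; rewrite row_mxEr.
move=> _; apply: (measurability _ (RGenOInfty.measurableE R)) => //; last exact: measurable_bdom.
move=> _ [_ [a ->] <-].
pose U := [set x | cdom i x /\ a < cmap i x 0 k'].
rewrite (_ : _ `&` _ = spacetime T `&` [set p | U p.2]); last first.
  apply/seteqP; split => p; rewrite /= in_itv/= andbT.
    by move=> [[pT pi] ap].
  by move=> [pT [pi ap]].
apply: measurableI; first exact: measurable_spacetime.
apply: measurable_cylinder; apply: (@open_cdom_preimage i [set v | a < v 0 k']).
have oa : open (`]a, +oo[%classic : set R) by exact: interval_open.
have := (continuousP _).1 (@coord_continuous R 1 2 0 k') _ oa.
congr open; apply/seteqP; split => v /=; by rewrite in_itv/= andbT.
Qed.

(* Off the chart domain the value has a time outside [0, T], hence lies outside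
   [bimg T i]. *)
Definition chart_coord i (p : X) : R3 :=
  if p \in bdom T i then unvec3 (bmap i p) else (T + 1, 0, 0).

Lemma vec3_chart_coord i p : bdom T i p -> vec3 (chart_coord i p) = bmap i p.
Proof. by move=> pi; rewrite /chart_coord mem_set// unvec3K. Qed.

Lemma chart_coord_bdom i p : bimg T i (vec3 (chart_coord i p)) -> bdom T i p.
Proof.
rewrite /chart_coord; case: ifPn => [|_]; first by rewrite inE.
move=> [+ _]; rewrite /vec3 row_mxKl mxE /= => /andP[_].
by rewrite gerDl leNgt ltr01.
Qed.

Lemma measurable_chart_coord i : measurable_fun setT (chart_coord i).
Proof.
have mB := measurable_bdom i.
rewrite -(setUv (bdom T i)); apply/measurable_funU => //; first exact: measurableC.
split.
  apply: (eq_measurable_fun (fun p : X => unvec3 (bmap i p))).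
    by move=> p pi; rewrite /chart_coord pi.
  by apply: measurable_fun_pair_in => //; [apply: measurable_fun_pair_in => //|];
    exact: measurable_bmap_coord.
apply: (eq_measurable_fun (cst ((T + 1, 0, 0) : R3) : X -> R3)).
  by move=> p; rewrite inE /chart_coord => /= pi; rewrite memNset.
exact: measurable_cst.
Qed.

(** Compactness gives finitely many charts; they are indexed by a sequence to fit the countable
    unions under which measurability and null sets are stable. *)
Lemma chart_sequence : exists c : nat -> chart S, exists N : nat,
  forall x, exists2 n, (n < N)%N & cdom (c n) x.
Proof.
move: cM; rewrite compact_cover.
move=> /(_ M setT (fun x => cdom (chart_at S x))) [].
- by move=> x _; exact: cdom_open.
- by move=> x _; exists x => //; exact: cdom_at.
move=> D _ cov; pose s := finmap.enum_fset D.
exists (fun n => chart_at S (nth point s n)), (size s).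
move=> x; have [y yD xy] := cov x Logic.I.
exists (index y s); first by rewrite index_mem.
by rewrite nth_index.
Qed.

(** On a chart domain [binv] after [chart_coord] is the identity, so the function factors through
    measurable coordinates. *)
Lemma measurable_on_spacetime (h : R * M -> R) :
  (forall i, measurable_in T i h) -> measurable_fun (spacetime T : set X) h.
Proof.
move=> mh; have [c [N cN]] := chart_sequence.
have -> : spacetime T = \bigcup_n (bdom T (c n) : set X).
  apply/seteqP; split => [p pT|p [n _ [pT _]]//].
  by have [n _ pn] := cN p.2; exists n.
apply/measurable_fun_bigcup => [n|n]; first exact: measurable_bdom.
apply: (eq_measurable_fun
  ((fun q => h (binv (c n) (vec3 q))) \o chart_coord (c n))).
  move=> p; rewrite inE => pi.
  by rewrite /= vec3_chart_coord// (bmapK pi).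
apply: (measurable_comp (F := vec3 @^-1` bimg T (c n))).
- exact: measurable_bimg.
- by move=> _ [p pi <-] /=; rewrite vec3_chart_coord//; exact: bimg_bmap.
- exact: mh.
- exact: measurable_funTS (measurable_chart_coord _).
Qed.

Lemma vol_chart i (E : set R3) : measurable E -> E `<=` vec3 @^-1` bimg T i ->
  vol (chart_coord i @^-1` E) =
  (\int[leb]_(q in E) (density alpha f i (vec3 q))%:E)%E.
Proof.
move=> mE Ei; have mB : measurable (chart_coord i @^-1` E : set X).
  by rewrite -[X in measurable X]setTI; exact: measurable_chart_coord.
have sB : chart_coord i @^-1` E `<=` bdom T i.
  by move=> p pE; apply: (@chart_coord_bdom i); exact: Ei.
rewrite (@volP i _ mB sB); congr (integral _ _ _).
apply/seteqP; split => [q [p pE pq]|q qE].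
  by rewrite -(vec3K q) -pq -(vec3_chart_coord (sB _ pE)) vec3K.
exists (binv i (vec3 q)); last by rewrite (binvK (Ei _ qE)).
have bd := bdom_binv (Ei _ qE).
by rewrite /= /chart_coord mem_set// (binvK (Ei _ qE)) vec3K.
Qed.

Lemma measurable_density i :
  measurable_fun (vec3 @^-1` bimg T i : set R3)
    (fun q => density alpha f i (vec3 q)).
Proof. by apply: measurable_within_bimg => z; exact: cvg_density. Qed.

(** The density is positive throughout the chart image, so its integral vanishes only over null
    sets. *)
Lemma vol_null_chart i (E : set R3) : measurable E ->
  E `<=` vec3 @^-1` bimg T i ->
  vol (chart_coord i @^-1` E) = 0%E <-> leb E = 0%E.
Proof.
move=> mE Ei; rewrite vol_chart//.
have md : measurable_fun E (fun q => (density alpha f i (vec3 q))%:E).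
  apply/measurable_EFinP.
  exact: (measurable_funS (measurable_bimg i) Ei (@measurable_density i)).
split=> [int0|E0]; last exact: null_set_integral.
have : ae_eq leb E (fun q => (density alpha f i (vec3 q))%:E) (cst 0%E).
  apply/ae_eq_integral_abs => //; rewrite -[RHS]int0.
  by apply: eq_integral => q _; rewrite gee0_abs// lee_fin sqrtr_ge0.
move=> [Z [mZ Z0 subZ]]; apply: (subset_measure0 mE mZ _ Z0) => q qE.
apply: subZ => /= /(_ qE) [] d0.
by have := density_gt0 alpha0 mov (Ei _ qE); rewrite d0 ltxx.
Qed.

End volume_in_charts.

(** * Null boundaries, finite volume and comparison with Lebesgue measure *)

Section volume_estimates.
Context {R : realType} {M : ptopologicalType}.
Variables (S : surface R M) (T alpha : R) (f : R -> M -> 'rV[R]_3).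
Hypothesis alpha0 : 0 < alpha.
Hypothesis mov : is_moving_surface S T f.
Hypothesis cM : compact [set: M].
Variable vol : {measure set (spacetime_type (R := R) (M := M)) -> \bar R}.
Hypothesis volP : is_volume S T f alpha vol.
Local Notation R3 :=
  (measurableTypeR R * measurableTypeR R * measurableTypeR R)%type.
Local Notation leb := (leb3 R).
Local Notation X := (spacetime_type (R := R) (M := M)).
Implicit Types (i j : chart S) (p : R * M) (z : 'rV[R]_(1 + 2)).

(** Off the planes of initial time, final time and the edge of the half-plane, the conditions that
    define a chart image are open. *)
Lemma boundary_null i : leb.-negligible (vec3 @^-1` (bimg T i `\` (bimg T i)°)).
Proof.
have [U oU iU] := cimg_open i.
have [p0 _] := leb3_plane (0 : R); have [pT _] := leb3_plane T.
have [_ p1] := leb3_plane (0 : R).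
have neg (A : set R3) : measurable A -> leb A = 0%E -> leb.-negligible A.
  by move=> mA A0; exists A; split.
have m1 (c : R) : measurable [set q : R3 | q.1.1 = c].
  rewrite (_ : [set q : R3 | _] = (fun q : R3 => q.1.1) @^-1` [set c]) //.
  rewrite -[X in measurable X]setTI.
  exact: (measurableT_comp measurable_fst measurable_fst).
have m2 (c : R) : measurable [set q : R3 | q.1.2 = c].
  rewrite (_ : [set q : R3 | _] = (fun q : R3 => q.1.2) @^-1` [set c]) //.
  rewrite -[X in measurable X]setTI.
  exact: (measurableT_comp measurable_snd measurable_fst).
have nU := negligibleU (negligibleU (neg _ (m1 0) p0) (neg _ (m1 T) pT))
  (neg _ (m2 0) p1).
apply: negligibleS nU => q [[]]; rewrite /bimg /= iU => qT [Uq hq] nint.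
have tE : lsubmx (vec3 q) 0 0 = q.1.1 by rewrite /vec3 row_mxKl mxE.
have xE : rsubmx (vec3 q) 0 0 = q.1.2.
  rewrite /vec3 row_mxKr (_ : 0 = lshift 1 0 :> 'I_(1 + 1)); last exact: val_inj.
  by apply: etrans (@row_mxEl _ 1 1 1 _ _ 0 0) _; rewrite mxE.
apply: contrapT => nq; apply: nint.
have [n0 nT n1] : [/\ q.1.1 <> 0, q.1.1 <> T & q.1.2 <> 0].
  by split => e; apply: nq; [left; left|left; right|right].
have pos x : 0 <= x -> x <> 0 -> 0 < x :> R.
  by move=> x0 /eqP xn; rewrite lt_neqAle eq_sym xn.
have [h0 hT] := andP qT.
pose V := [set z : 'rV[R]_(1 + 2) | 0 < lsubmx z 0 0] `&`
  [set z : 'rV[R]_(1 + 2) | lsubmx z 0 0 < T] `&`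
  ([set z : 'rV[R]_(1 + 2) | U (rsubmx z)] `&`
   [set z : 'rV[R]_(1 + 2) | 0 < rsubmx z 0 0]).
have oV : open V.
  have ct := @continuous_time R; have cr := @continuous_rsubmx R 1 1 2.
  have cr0 : continuous (fun z : 'rV[R]_(1 + 2) => rsubmx z 0 0 : R).
    move=> z; apply: (@continuous_comp _ _ _ (fun y : 'rV[R]_(1 + 2) => rsubmx y)
      (fun y : 'rV[R]_2 => y 0 0)); first exact: cr.
    exact: coord_continuous.
  apply: openI; apply: openI.
  - exact: (open_comp (fun z _ => ct z) (@open_gt R 0)).
  - exact: (open_comp (fun z _ => ct z) (@open_lt R T)).
  - exact: (open_comp (fun z _ => cr z) oU).
  - exact: (open_comp (fun z _ => cr0 z) (@open_gt R 0)).
have nV : nbhs (vec3 q) V.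
  apply: open_nbhs_nbhs; split => //; split; split => //=.
  - by apply: pos => //; rewrite tE.
  - by rewrite lt_neqAle hT andbT; apply/eqP; rewrite tE.
  - by rewrite xE; apply: pos => //; rewrite -xE.
apply: filterS nV => z [[/= z0 zT] [zU zh]].
split; first by rewrite (ltW z0) (ltW zT).
by split => //; exact: ltW.
Qed.

(** Chart images need not be compact, but a closed half-ball around a point, taken over the whole of
    [0, T], is. *)
Lemma compact_chart_ball i x : cdom i x ->
  exists (r : R) (K : set 'rV[R]_(1 + 2)), [/\ 0 < r, compact K, K `<=` bimg T i &
    forall p, bdom T i p -> `|cmap i p.2 - cmap i x| <= r -> K (bmap i p)].
Proof.
move=> xi; have [U oU iU] := cimg_open i.
have Ux : U (cmap i x) by have := cmap_cimg xi; rewrite iU => -[].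
have /nbhs_normP[e /= e0 eU] : nbhs (cmap i x) U by exact: open_nbhs_nbhs.
have r0 : 0 < e / 2 by rewrite divr_gt0.
set c := cmap i x in eU *.
pose K := [set z : 'rV[R]_(1 + 2) | [/\ 0 <= lsubmx z 0 0 <= T,
   0 <= rsubmx z 0 0 & `|rsubmx z - c| <= e / 2]].
exists (e / 2), K; split => //.
- apply: bounded_closed_compact.
    exists (T + (e / 2 + `|c|)); split; first exact: num_real.
    move=> m ltm z [/andP[t0 tT] _ zc] /=; apply: ltW; apply: le_lt_trans ltm.
    rewrite -[z]hsubmxK; apply/mx_norm_leP.
      by rewrite !addr_ge0// ?(ltW r0)//; exact: le_trans t0 tT.
    move=> a k; have zc' : `|rsubmx z| <= e / 2 + `|c|.
      by rewrite -[rsubmx z](subrK c); apply: le_trans (ler_normD _ _) _; rewrite lerD2r.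
    rewrite (ord1 a); case: (split_ordP k) => k' ->.
      rewrite row_mxEl (ord1 k') ger0_norm//; apply: le_trans tT _.
      by rewrite lerDl addr_ge0// ltW.
    rewrite row_mxEr; apply: le_trans (ler_mx_norm_coord _ _ _) _.
    by apply: le_trans zc' _; rewrite lerDr; exact: le_trans t0 tT.
  have ct := @continuous_time R; have cr := @continuous_rsubmx R 1 1 2.
  have cr0 : continuous (fun z : 'rV[R]_(1 + 2) => rsubmx z 0 0 : R).
    move=> z; apply: (@continuous_comp _ _ _ (fun y : 'rV[R]_(1 + 2) => rsubmx y)
      (fun y : 'rV[R]_2 => y 0 0)); first exact: cr.
    exact: coord_continuous.
  rewrite (_ : K = (fun z : 'rV[R]_(1 + 2) => lsubmx z 0 0 : R) @^-1` `[0, T] `&`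
    ((fun z : 'rV[R]_(1 + 2) => rsubmx z 0 0 : R) @^-1` [set x | 0 <= x] `&`
     (fun z : 'rV[R]_(1 + 2) => rsubmx z) @^-1` closed_ball_ (fun x => `|x|) c (e / 2))).
    apply: closedI; [|apply: closedI].
    + by apply: closed_comp; [move=> z _; exact: ct|exact: interval_closed].
    + by apply: closed_comp; [move=> z _; exact: cr0|exact: closed_ge].
    + by apply: closed_comp; [move=> z _; exact: cr|exact: closed_closed_ball_].
  by apply/seteqP; split => z; rewrite /K /closed_ball_ /= in_itv /= distrC;
    [move=> [? ? ?]|move=> [? [? ?]]].
- move=> z [zT zh zc]; split => //; rewrite iU; split => //; apply: eU => /=.
  by rewrite distrC; apply: le_lt_trans zc _; rewrite ltr_pdivrMr// ltr_pMr// ltr1n.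
move=> p [pT pi] pc; have := bimg_bmap (conj pT pi : bdom T i p).
move=> [tb]; rewrite iU => -[_ hb]; split => //.
by rewrite /bmap row_mxKr.
Qed.

Lemma measurable_densityE i (E : set R3) : E `<=` vec3 @^-1` bimg T i ->
  measurable_fun E (fun q => (density alpha f i (vec3 q))%:E).
Proof.
move=> Ei; apply/measurable_EFinP; apply: (measurable_funS _ Ei).
  exact: measurable_bimg.
by apply: measurable_density.
Qed.

Lemma vol_compact_chart_fin i K : compact K -> K `<=` bimg T i ->
  (vol (chart_coord T i @^-1` (vec3 @^-1` K)) < +oo)%E.
Proof.
move=> cK Ki; have mK := compact_measurable_vec3 cK.
have Kv : vec3 @^-1` K `<=` (vec3 @^-1` bimg T i : set R3) by move=> q /Ki.
have [C Cb] := compact_within_bounded (@cvg_density _ _ S T alpha f mov i) cK Ki.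
rewrite (vol_chart volP mK Kv).
apply: (@le_lt_trans _ _ (\int[leb]_(q in vec3 @^-1` K) (`|C|)%:E)%E).
  apply: ge0_le_integral => //.
  - by move=> q _; rewrite lee_fin sqrtr_ge0.
  - exact: measurable_densityE.
  - move=> q Kq; rewrite lee_fin; apply: le_trans (ler_norm _) _.
    by apply: le_trans (Cb _ Kq) _; exact: ler_norm.
rewrite integral_cst//; apply: lte_mul_pinfty => //.
exact: leb3_compact_fin.
Qed.

(** The density may be unbounded on a chart image, so the finite cover consists of the
    neighbourhoods of [compact_chart_ball] and not of whole chart domains. *)
Lemma vol_spacetime_fin : (vol (spacetime T) < +oo)%E.
Proof.
have /choice[r rP] : forall x : M, exists r : R, exists K : set 'rV[R]_(1 + 2),
    [/\ 0 < r, compact K, K `<=` bimg T (chart_at S x) &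
    forall p, bdom T (chart_at S x) p ->
      `|cmap (chart_at S x) p.2 - cmap (chart_at S x) x| <= r ->
      K (bmap (chart_at S x) p)].
  by move=> x; exact: compact_chart_ball (cdom_at _ _).
have {rP} /choice[K KP] := rP.
move: cM; rewrite compact_cover.
move=> /(_ M setT (fun x => [set y | cdom (chart_at S x) y /\
  `|cmap (chart_at S x) y - cmap (chart_at S x) x| < r x])) [].
- move=> x _; apply: (@open_cdom_preimage _ _ _ _
    [set v | `|v - cmap (chart_at S x) x| < r x]).
  rewrite (_ : [set v | _] = ball (cmap (chart_at S x) x) (r x)).
    by have [r0 _ _ _] := KP x; exact: ball_open.
  by apply/seteqP; split => v; rewrite -ball_normE /= distrC.
- move=> x _; exists x => //; split; first exact: cdom_at.
  by rewrite subrr normr0; case: (KP x).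
move=> D _ cov.
pose B x : set X := chart_coord T (chart_at S x) @^-1` (vec3 @^-1` K x).
have mB x : measurable (B x).
  have [_ cK _ _] := KP x; rewrite -[X in measurable X]setTI.
  by apply: measurable_chart_coord => //; exact: compact_measurable_vec3.
have Bfin (s : seq M) : (vol (\big[setU/set0]_(x <- s) B x) < +oo)%E.
  elim: s => [|x s IH]; first by rewrite big_nil measure0.
  rewrite big_cons; apply: le_lt_trans (measureU2 _ _ _) _ => //.
    by apply: bigsetU_measurable.
  by rewrite lte_add_pinfty//; have [_ cK Ki _] := KP x; exact: vol_compact_chart_fin.
apply: le_lt_trans (Bfin (finmap.enum_fset D)); apply: le_measure; rewrite ?inE.
- exact: measurable_spacetime.
- exact: bigsetU_measurable.
move=> p pT; have [x xD [xi xr]] := cov p.2 Logic.I.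
rewrite -bigcup_seq; exists x => //.
have pb : bdom T (chart_at S x) p by split.
by rewrite /B /= vec3_chart_coord//; case: (KP x) => _ _ _; apply => //; exact: ltW.
Qed.

(** The reciprocal of the density is bounded on [K], so there Lebesgue measure is at most a multiple
    of the image of the volume, and integrals of nonnegative functions compare as the measures
    do. *)
Lemma chart_integral_le i K : compact K -> K `<=` bimg T i ->
  exists C : R, 0 <= C /\ forall Q : R * M -> R, (forall p, 0 <= Q p) ->
    measurable_in T i Q -> measurable_fun (spacetime T : set X) Q ->
    (\int[leb]_(q in vec3 @^-1` K) (Q (binv i (vec3 q)))%:E <=
     C%:E * \int[vol]_(p in spacetime T) (Q p)%:E)%E.
Proof.
move=> cK Ki; have mK := compact_measurable_vec3 cK.
have Kv : vec3 @^-1` K `<=` (vec3 @^-1` bimg T i : set R3) by move=> q /Ki.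
have [C Cb] : exists C : R, forall z, K z -> `|(density alpha f i z)^-1| <= C.
  apply: (compact_within_bounded (A := bimg T i)) => // z zi.
  apply: cvgV; last exact: (@cvg_density _ _ S T alpha f mov).
  by rewrite gt_eqF// (density_gt0 alpha0 mov).
pose C' := NngNum (normr_ge0 C).
exists `|C|; split => // Q Q0 mQi mQ.
pose K' : set R3 := vec3 @^-1` K.
have mcc := @measurable_chart_coord _ _ S T i.
pose nu : {measure set R3 -> \bar R} :=
  measure_function_pushforward__canonical__measure_function_Measure vol mcc.
(* Adding Lebesgue measure off [K] makes the comparison hold for all measurable sets; the extra term
   has no mass on [K]. *)
pose m2 := measure_add (mscale C' nu) (mrestr leb (measurableC mK)).
have leb_le (A : set R3) : measurable A -> (leb A <= m2 A)%E.
  move=> mA; rewrite /m2 measure_addE.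
  have mAK : measurable (A `&` K') by exact: measurableI.
  have -> : leb A = (leb (A `&` K') + leb (A `&` ~` K'))%E.
    rewrite -measureU//.
    - by rewrite -setIUr setUv setIT.
    - by apply: measurableI => //; exact: measurableC.
    - by rewrite setIACA setICr setI0.
  apply: leeD => //.
  apply: (@le_trans _ _ ((`|C|)%:E * vol (chart_coord T i @^-1` (A `&` K')))%E); last first.
    rewrite /mscale /=; apply: lee_wpmul2l; first by rewrite lee_fin.
    apply: le_measure; rewrite ?inE.
    - by rewrite -[X in measurable X]setTI; exact: measurable_chart_coord.
    - by rewrite -[X in measurable X]setTI; exact: measurable_chart_coord.
    by apply: preimage_subset; exact: subIsetl.
  have AKi : A `&` K' `<=` vec3 @^-1` bimg T i by move=> q [_ /Ki].
  rewrite (vol_chart volP mAK AKi) -ge0_integralZl//; last 2 first.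
  - exact: measurable_densityE.
  - by move=> q _; rewrite lee_fin sqrtr_ge0.
  have -> : leb (A `&` K') = (\int[leb]_(q in A `&` K') 1%:E)%E.
    by rewrite integral_cst// mul1e.
  apply: ge0_le_integral => //.
  - apply: measurable_funeM; exact: measurable_densityE.
  move=> q [_ Kq]; have d0 := density_gt0 alpha0 mov (Ki _ Kq).
  rewrite -EFinM lee_fin -ler_pdivrMr// div1r.
  apply: le_trans (ler_norm _) _; apply: le_trans (Cb _ Kq) _; exact: ler_norm.
pose h : R3 -> \bar R := (fun q => (Q (binv i (vec3 q)))%:E) \_ K'.
have mhK : measurable_fun K' (fun q => (Q (binv i (vec3 q)))%:E).
  apply/measurable_EFinP; exact: (measurable_funS (measurable_bimg T i) Kv mQi).
have mh : measurable_fun setT h by exact: (measurable_restrictT _ mK).1.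
have h0 q : (0 <= h q)%E.
  by rewrite /h patchE; case: ifP => // _; rewrite lee_fin.
have -> : (\int[leb]_(q in vec3 @^-1` K) (Q (binv i (vec3 q)))%:E =
    \int[leb]_(q in K') h q)%E.
  by apply: eq_integral => q qK; rewrite /h patchE qK.
apply: le_trans (ge0_le_measure_integral leb_le mK h0 mh) _.
have mhK' : measurable_fun K' h by exact: measurable_funTS.
rewrite /m2 ge0_integral_measure_add// [X in (_ + X)%E](_ : _ = 0%E); last first.
  apply: null_set_integral => //.
  by rewrite -[RHS](measure0 leb) -(setICr K').
rewrite adde0 ge0_integral_mscale//; apply: lee_wpmul2l; first by rewrite lee_fin.
rewrite (_ : integral _ _ _ = \int[pushforward vol (chart_coord T i)]_(q in K') h q)%E//.
rewrite (ge0_integral_pushforward mcc)//.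
have sub : chart_coord T i @^-1` K' `<=` bdom T i.
  by move=> p pK; apply: (@chart_coord_bdom _ _ S T i); exact: Ki.
rewrite (eq_integral (fun p : X => (Q p)%:E)); last first.
  move=> p; rewrite inE => pK; rewrite /h /= patchE mem_set//.
  by rewrite (vec3_chart_coord (sub _ pK)) (bmapK (sub _ pK)).
apply: ge0_subset_integral => //.
- by rewrite -[X in measurable X]setTI; exact: measurable_chart_coord.
- exact: measurable_spacetime.
- by apply/measurable_EFinP.
- by move=> p _; rewrite lee_fin.
- by move=> p /sub [].
Qed.

End volume_estimates.

(** * Weak partial derivatives *)

Lemma ae_imply {d : measure_display} {X : measurableType d} {R : realType}
    (mu : {measure set X -> \bar R}) (P Q : X -> Prop) :
  (forall x, P x -> Q x) -> {ae mu, forall x, P x} -> {ae mu, forall x, Q x}.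
Proof. by move=> PQ; apply: negligibleS => x /= nQ Px; apply: nQ; exact: PQ. Qed.

Lemma ae_imply2 {d : measure_display} {X : measurableType d} {R : realType}
    (mu : {measure set X -> \bar R}) (P P' Q : X -> Prop) :
  (forall x, P x -> P' x -> Q x) ->
  {ae mu, forall x, P x} -> {ae mu, forall x, P' x} -> {ae mu, forall x, Q x}.
Proof.
move=> PQ aP aP'; have := negligibleU aP aP'; apply: negligibleS => x /= nQ.
by apply: contra_notP nQ => /not_orP[/contrapT Px /contrapT P'x]; exact: PQ.
Qed.

Section weak_partial_derivatives.
Context {R : realType}.
Local Notation R3 :=
  (measurableTypeR R * measurableTypeR R * measurableTypeR R)%type.
Local Notation leb := (leb3 R).
Variable O : set 'rV[R]_(1 + 2).
Implicit Types (h w phi psi : 'rV[R]_(1 + 2) -> R) (K : set 'rV[R]_(1 + 2)).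

Definition supported_in K psi : Prop :=
  [/\ continuous psi, compact K, K `<=` O & forall z, ~ K z -> psi z = 0].

(** Off the closed set [K] the function is locally zero, so one [K] supports its derivatives too. *)
Lemma test_function_supported phi : test_function O phi ->
  exists K, supported_in K phi /\ forall v, supported_in K (fun z => 'D_v phi z).
Proof.
move=> [dphi cphi [K [cK KO phi0]]]; exists K; split.
  by split => // z; exact: differentiable_continuous.
move=> v; split => // z Kz.
rewrite -[RHS](@derive_cst _ _ _ (0 : R) z v); apply: near_eq_derive.
have : nbhs z (~` K).
  apply: open_nbhs_nbhs; split => //; apply: closed_openC.
  by apply: compact_closed => //; exact: norm_hausdorff.
by apply: filterS => y Ky; exact: phi0.
Qed.

Lemma supported_bounded K psi : supported_in K psi ->
  exists2 C : R, 0 <= C & forall z, `|psi z| <= C.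
Proof.
move=> [cpsi cK _ psi0].
have cw z : setT z -> psi y @[y --> within setT (nbhs z)] --> psi z.
  by move=> _; apply: cvg_within_filter; exact: cpsi.
have [C CK] := compact_within_bounded cw cK (@subsetT _ _).
exists `|C| => // z; have [Kz|Kz] := pselect (K z).
  by apply: le_trans (CK _ Kz) _; exact: ler_norm.
by rewrite psi0// normr0.
Qed.

Lemma integrable_mul_supported K h psi : supported_in K psi ->
  loc_integrable O h ->
  leb.-integrable setT (fun q => (h (vec3 q) * psi (vec3 q))%:E).
Proof.
move=> sK ih; have [C C0 Cpsi] := supported_bounded sK.
have [cpsi cK KO psi0] := sK.
have mK := compact_measurable_vec3 cK.
pose hK : R3 -> \bar R := (fun q => (h (vec3 q))%:E) \_ (vec3 @^-1` K).
have ihK : leb.-integrable setT hK by apply/(integrable_mkcond _ mK); exact: ih.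
have mhK : measurable_fun setT hK by case/integrableP : ihK.
have hE q : (h (vec3 q) * psi (vec3 q))%:E = (hK q * (psi (vec3 q))%:E)%E.
  rewrite /hK patchE; case: ifPn => [_|]; first by rewrite EFinM.
  by rewrite notin_setE /= => Kq; rewrite psi0// mulr0 mule0.
under eq_fun do rewrite hE.
apply: (@le_integrable _ _ _ _ _ measurableT _ (fun q => C%:E * hK q)%E).
- apply: emeasurable_funM => //; apply/measurable_EFinP.
  exact: measurable_vec3_comp.
- move=> q _; rewrite !abseM muleC [X in (_ <= X)%E](_ : _ = (C%:E * `|hK q|)%E).
    by apply: lee_wpmul2r => //=; rewrite lee_fin.
  by rewrite gee0_abs.
exact: integrableZl.
Qed.

Lemma eq_weak_pd h h' a w w' : (forall z, O z -> h z = h' z) ->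
  (forall z, O z -> w z = w' z) -> weak_pd O h a w -> weak_pd O h' a w'.
Proof.
move=> hh ww [ih iw E].
have loc k k' : (forall z, O z -> k z = k' z) -> loc_integrable O k -> loc_integrable O k'.
  move=> kk ik K cK KO; apply: eq_integrable (ik K cK KO).
    exact: compact_measurable_vec3.
  by move=> q; rewrite inE /= => Kq; rewrite kk//; exact: KO.
split; [exact: loc ih|exact: loc iw|].
move=> phi tphi; have [K [[_ cK KO phi0] sD]] := test_function_supported tphi.
have [_ _ _ D0] := sD (delta_mx 0 a).
have eqI k k' psi : (forall z, O z -> k z = k' z) -> (forall z, ~ K z -> psi z = 0) ->
    \int[leb]_q (k (vec3 q) * psi (vec3 q)) = \int[leb]_q (k' (vec3 q) * psi (vec3 q)).
  move=> kk psi0; apply: eq_Rintegral => q _.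
  have [Kq|Kq] := pselect (K (vec3 q)); first by rewrite kk//; exact: KO.
  by rewrite psi0// !mulr0.
by rewrite -(eqI h h' _ hh D0) -(eqI w w' _ ww phi0); exact: E.
Qed.

Lemma loc_integrableD h h' : loc_integrable O h -> loc_integrable O h' ->
  loc_integrable O (fun z => h z + h' z).
Proof.
move=> ih ih' K cK KO; have mK := compact_measurable_vec3 cK.
by under eq_fun do rewrite EFinD; apply: integrableD => //; [exact: ih|exact: ih'].
Qed.

Lemma loc_integrableZ (c : R) h : loc_integrable O h ->
  loc_integrable O (fun z => c * h z).
Proof.
move=> ih K cK KO; have mK := compact_measurable_vec3 cK.
by under eq_fun do rewrite EFinM; apply: integrableZl => //; exact: ih.
Qed.

Lemma weak_pd_lin (c : R) h h' a w w' : weak_pd O h a w -> weak_pd O h' a w' ->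
  weak_pd O (fun z => h z + c * h' z) a (fun z => w z + c * w' z).
Proof.
move=> [ih iw E] [ih' iw' E'].
split; try by apply: loc_integrableD => //; exact: loc_integrableZ.
move=> phi tphi; have [K [sK sD]] := test_function_supported tphi.
have linI k k' psi : loc_integrable O k -> loc_integrable O k' -> supported_in K psi ->
    \int[leb]_q ((k (vec3 q) + c * k' (vec3 q)) * psi (vec3 q)) =
    \int[leb]_q (k (vec3 q) * psi (vec3 q)) + c * \int[leb]_q (k' (vec3 q) * psi (vec3 q)).
  move=> ik ik' spsi; have i1 := integrable_mul_supported spsi ik.
  have i2 := integrable_mul_supported spsi ik'.
  rewrite -RintegralZl// -RintegralD//; first by apply: eq_Rintegral => q _; ring.
  exact: (integrableZl measurableT c i2).
rewrite (linI h h' _ ih ih' (sD _)) (linI w w' _ iw iw' sK) E// E'//; ring.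
Qed.

Lemma weak_pd0 a : weak_pd O (fun=> 0) a (fun=> 0).
Proof.
split; try by move=> K cK KO; exact: integrable0.
have I0 (psi : 'rV[R]_(1 + 2) -> R) : \int[leb]_q (0 * psi (vec3 q)) = 0.
  by under eq_Rintegral do rewrite mul0r; rewrite /Rintegral integral0.
by move=> phi _; rewrite (I0 phi) (I0 ('D_(delta_mx 0 a) phi)) oppr0.
Qed.

(** The difference of two candidates is a weak derivative of 0, hence orthogonal to every test
    function. *)
Lemma weak_pd_unique h a w w' : open O -> weak_pd O h a w -> weak_pd O h a w' ->
  {ae leb, forall q, O (vec3 q) -> w (vec3 q) = w' (vec3 q)}.
Proof.
move=> oO d d'; have [_ iw E] := weak_pd_lin (-1) d d'.
have orth phi : test_function O phi ->
    \int[leb]_q ((w (vec3 q) + -1 * w' (vec3 q)) * phi (vec3 q)) = 0.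
  move=> tphi; have := E _ tphi; under eq_Rintegral do rewrite mulN1r subrr mul0r.
  by rewrite {1}/Rintegral integral0 => /esym/eqP; rewrite oppr_eq0 => /eqP.
apply: ae_imply (fundamental_lemma oO iw orth) => q h0 Oq.
by apply/eqP; rewrite -subr_eq0 -mulN1r; apply/eqP; exact: h0.
Qed.

Definition L1_small (K : set 'rV[R]_(1 + 2)) (d_ : nat -> 'rV[R]_(1 + 2) -> R) : Prop :=
  forall e : R, 0 < e -> \forall n \near \oo,
    (\int[leb]_(q in vec3 @^-1` K) (`|d_ n (vec3 q)|)%:E <= e%:E)%E.

Lemma L1_small_mul K psi h (h_ : nat -> 'rV[R]_(1 + 2) -> R) : supported_in K psi ->
  loc_integrable O h -> (forall n, loc_integrable O (h_ n)) ->
  L1_small K (fun n z => h_ n z - h z) ->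
  \int[leb]_q (h_ n (vec3 q) * psi (vec3 q)) @[n --> \oo] -->
  \int[leb]_q (h (vec3 q) * psi (vec3 q)).
Proof.
move=> sK ih ih_ small; have [C C0 Cpsi] := supported_bounded sK.
have [cpsi cK KO psi0] := sK; have mK := compact_measurable_vec3 cK.
apply/cvgrPdist_le => e e0.
have e1 : 0 < e / (C + 1) by rewrite divr_gt0// ltr_wpDl.
apply: filterS (small _ e1) => n hn.
have i1 := integrable_mul_supported sK ih.
have i2 := integrable_mul_supported sK (ih_ n).
rewrite distrC -RintegralB//.
have iB : leb.-integrable setT (fun q => (h_ n (vec3 q) * psi (vec3 q) -
    h (vec3 q) * psi (vec3 q))%:E).
  by under eq_fun do rewrite EFinB; exact: integrableB.
apply: le_trans (le_normr_Rintegral measurableT iB) _.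
rewrite -lee_fin /Rintegral fineK; last first.
  by apply: integrable_fin_num => //; exact: integrable_norm.
have idiff : leb.-integrable (vec3 @^-1` K) (fun q => (h_ n (vec3 q) - h (vec3 q))%:E).
  by under eq_fun do rewrite EFinB; apply: integrableB => //; [exact: ih_|exact: ih].
have mdiff : measurable_fun (vec3 @^-1` K) (fun q : R3 => (`|h_ n (vec3 q) - h (vec3 q)|)%:E).
  by apply/measurable_EFinP; apply: measurableT_comp => //;
     apply/measurable_EFinP; case/integrableP : idiff.
apply: (@le_trans _ _ (\int[leb]_(q in vec3 @^-1` K)
    (C%:E * (`|h_ n (vec3 q) - h (vec3 q)|)%:E))%E).
  rewrite [leRHS]integral_mkcond; apply: ge0_le_integral => //.
  - by case/integrableP : iB => mB _; apply/measurable_EFinP;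
      apply: measurableT_comp => //; apply/measurable_EFinP.
  - by apply: (measurable_restrictT _ mK).1; exact: measurable_funeM.
  move=> q _; rewrite patchE; case: ifPn => [_|].
    by rewrite -EFinM lee_fin -mulrBl normrM mulrC ler_wpM2r.
  by rewrite notin_setE /= => Kq; rewrite psi0// !mulr0 subrr normr0.
rewrite ge0_integralZl//.
apply: (@le_trans _ _ (C%:E * (e / (C + 1))%:E)%E); first exact: lee_wpmul2l.
rewrite -EFinM lee_fin mulrA ler_pdivrMr ?ltr_wpDl//.
by rewrite mulrC ler_wpM2l ?(ltW e0)// lerDl.
Qed.

Lemma loc_integrable_L1_small h (h_ : nat -> 'rV[R]_(1 + 2) -> R) :
  (forall n, loc_integrable O (h_ n)) ->
  (forall K, compact K -> K `<=` O ->
     measurable_fun (vec3 @^-1` K : set R3) (fun q => h (vec3 q))) ->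
  (forall K, compact K -> K `<=` O -> L1_small K (fun n z => h_ n z - h z)) ->
  loc_integrable O h.
Proof.
move=> ih_ mh small K cK KO; have mK := compact_measurable_vec3 cK.
have [n _ /(_ n (leqnn n)) hn] := small K cK KO 1 ltr01.
have i1 := ih_ n K cK KO.
have mdiff : measurable_fun (vec3 @^-1` K : set R3)
    (fun q => (h_ n (vec3 q) - h (vec3 q))%:E).
  apply/measurable_EFinP; apply: measurable_funB; last exact: mh.
  by apply/measurable_EFinP; case/integrableP : i1.
have i2 : leb.-integrable (vec3 @^-1` K) (fun q => (h_ n (vec3 q) - h (vec3 q))%:E).
  by apply/integrableP; split => //; apply: le_lt_trans hn _; rewrite ltry.
apply: eq_integrable (integrableB mK i1 i2) => // q _.
by rewrite -EFinB opprB addrCA subrr addr0.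
Qed.

(** Both sides of the defining identity pass to the limit, because test functions and their
    derivatives are bounded with compact support; this is why L^1 convergence on compact sets
    suffices. *)
Lemma weak_pd_closed h (h_ : nat -> 'rV[R]_(1 + 2) -> R) a w
    (w_ : nat -> 'rV[R]_(1 + 2) -> R) :
  (forall n, weak_pd O (h_ n) a (w_ n)) ->
  (forall K, compact K -> K `<=` O ->
     measurable_fun (vec3 @^-1` K : set R3) (fun q => h (vec3 q))) ->
  (forall K, compact K -> K `<=` O ->
     measurable_fun (vec3 @^-1` K : set R3) (fun q => w (vec3 q))) ->
  (forall K, compact K -> K `<=` O -> L1_small K (fun n z => h_ n z - h z)) ->
  (forall K, compact K -> K `<=` O -> L1_small K (fun n z => w_ n z - w z)) ->
  weak_pd O h a w.
Proof.
move=> d_ mh mw smallh smallw.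
have ih_ n : loc_integrable O (h_ n) by case: (d_ n).
have iw_ n : loc_integrable O (w_ n) by case: (d_ n).
have ih := loc_integrable_L1_small ih_ mh smallh.
have iw := loc_integrable_L1_small iw_ mw smallw.
split => // phi tphi; have [K [sK sD]] := test_function_supported tphi.
have [_ cK KO _] := sK.
have c1 := L1_small_mul (sD (delta_mx 0 a)) ih ih_ (smallh K cK KO).
have c2 : \int[leb]_q (h_ n (vec3 q) * 'D_(delta_mx 0 a) phi (vec3 q)) @[n --> \oo] -->
    - \int[leb]_q (w (vec3 q) * phi (vec3 q)).
  apply: cvg_trans (cvgN (L1_small_mul sK iw iw_ (smallw K cK KO))).
  apply: near_eq_cvg; apply: nearW => n /=.
  by case: (d_ n) => _ _ E; rewrite E.
by rewrite -(cvg_lim _ c1)// -(cvg_lim _ c2).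
Qed.

(** In place of Cauchy-Schwarz, Young's inequality in the form [x <= s + x ^+ 2 / s] is integrated
    over a set of finite measure [m]. *)
Lemma L1_small_of_sq K (d_ : nat -> 'rV[R]_(1 + 2) -> R) : compact K ->
  (forall n, measurable_fun (vec3 @^-1` K : set R3) (fun q => d_ n (vec3 q))) ->
  (forall e : R, 0 < e -> \forall n \near \oo,
    (\int[leb]_(q in vec3 @^-1` K) (d_ n (vec3 q) ^+ 2)%:E <= e%:E)%E) ->
  L1_small K d_.
Proof.
move=> cK md sq e e0; have mK := compact_measurable_vec3 cK.
have [m mE] : exists m : R, leb (vec3 @^-1` K) = m%:E.
  exists (fine (leb (vec3 @^-1` K))); rewrite fineK// ge0_fin_numE//.
  exact: leb3_compact_fin.
have m0 : 0 <= m by rewrite -lee_fin -mE.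
(* With this [s] the constant term contributes [s * m <= e / 2], and the quadratic one at most
   [e / 2] once the integral of the squares is below [s * (e / 2)]. *)
pose s := e / 2 / (m + 1).
have m1 : 0 < m + 1 by rewrite ltr_wpDl.
have s0 : 0 < s by rewrite !divr_gt0.
have es : 0 < s * (e / 2) by rewrite mulr_gt0// divr_gt0.
apply: filterS (sq _ es) => n hn.
have md2 : measurable_fun (vec3 @^-1` K : set R3) (fun q => (d_ n (vec3 q) ^+ 2)%:E).
  by apply/measurable_EFinP; apply: measurable_funX; exact: md.
apply: (@le_trans _ _ (\int[leb]_(q in vec3 @^-1` K)
    (s%:E + (s^-1)%:E * (d_ n (vec3 q) ^+ 2)%:E))%E).
  apply: ge0_le_integral => //.
  - by apply/measurable_EFinP; apply: measurableT_comp => //; exact: md.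
  - by apply: emeasurable_funD => //; exact: measurable_funeM.
  move=> q _; rewrite -EFinM -EFinD lee_fin; set x := d_ n (vec3 q).
  rewrite -(@real_normK _ x) ?num_real//; set y := `|x|; have y0 : 0 <= y by exact: normr_ge0.
  rewrite -(ler_pM2l s0) mulrDr mulrA divff ?gt_eqF// mul1r.
  have := sqr_ge0 (s - y); nra.
rewrite ge0_integralD//; last 3 first.
- by move=> q _; rewrite lee_fin ltW.
- by move=> q _; rewrite -EFinM lee_fin mulr_ge0 ?invr_ge0 ?sqr_ge0// ltW.
- exact: measurable_funeM.
rewrite integral_cst// [X in (_ * X)%E]mE ge0_integralZl//; last 2 first.
- by move=> q _; rewrite lee_fin sqr_ge0.
- by rewrite lee_fin invr_ge0 ltW.
apply: (@le_trans _ _ ((s * m)%:E + (s^-1)%:E * (s * (e / 2))%:E)%E).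
  by rewrite EFinM leeD2l// lee_wpmul2l// lee_fin invr_ge0 ltW.
rewrite -EFinM -EFinD lee_fin mulKf ?gt_eqF// [leRHS]splitr lerD2r.
rewrite /s mulrAC ler_pdivrMr// ler_wpM2l//; first by rewrite ltW// divr_gt0.
by rewrite lerDl.
Qed.

End weak_partial_derivatives.

(** * Weak covariant derivatives *)

Lemma ae_forall_fin {d : measure_display} {X : measurableType d} {R : realType}
    (mu : {measure set X -> \bar R}) (K : finType) (P : K -> X -> Prop) :
  (forall k, {ae mu, forall x, P k x}) -> {ae mu, forall x, forall k, P k x}.
Proof.
move=> aP.
suff H (s : seq K) : {ae mu, forall x, forall k, k \in s -> P k x}.
  by apply: ae_imply (H (enum K)) => x Px k; apply: Px; rewrite mem_enum.
elim: s => [|k s IH]; first by apply: (@ae_imply _ _ _ _ (fun=> True)) => //; exact: aeW.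
apply: ae_imply2 (aP k) IH => x Pk Ps l; rewrite inE => /orP[/eqP->//|]; exact: Ps.
Qed.

Section covariant_derivative.
Context {R : realType} {M : ptopologicalType}.
Variables (S : surface R M) (T alpha : R) (f : R -> M -> 'rV[R]_3).
Hypothesis alpha0 : 0 < alpha.
Hypothesis mov : is_moving_surface S T f.
Local Notation R3 :=
  (measurableTypeR R * measurableTypeR R * measurableTypeR R)%type.
Local Notation leb := (leb3 R).
Local Notation X := (spacetime_type (R := R) (M := M)).
Implicit Types (i j : chart S) (p : R * M) (z : 'rV[R]_(1 + 2)).
Local Notation is_wcd := (is_weak_covariant_derivative S T f alpha).

Lemma measurable_binv i :
  measurable_fun (vec3 @^-1` bimg T i : set R3) (fun q => binv i (vec3 q) : X).
Proof.
have mX : @measurable _ X = <<s @open (R * M)%type >> by [].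
apply: (measurability _ mX) => _ [V oV <-].
have [W oW WE] := within_preimage_open (@cvg_binv _ _ S T i) oV.
rewrite (_ : _ `&` _ = vec3 @^-1` (bimg T i `&` W) :> set R3); last by rewrite -WE.
rewrite preimage_setI; apply: measurableI; first exact: measurable_bimg.
exact: measurable_vec3_open.
Qed.

Lemma measurable_in_of_spacetime i (h : R * M -> R) :
  measurable_fun (spacetime T : set X) h -> measurable_in T i h.
Proof.
move=> mh; apply: (measurable_comp (F := spacetime T : set X) (f := h)
  (g := fun q : R3 => binv i (vec3 q) : X)) => //.
- exact: measurable_spacetime.
- by move=> _ [q qi <-]; have [] := bdom_binv qi.
- exact: measurable_binv.
Qed.

Lemma measurable_continuous_on (O : set 'rV[R]_(1 + 2)) (h : 'rV[R]_(1 + 2) -> R) :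
  open O -> (forall z, O z -> h y @[y --> z] --> h z) ->
  measurable_fun (vec3 @^-1` O : set R3) (fun q => h (vec3 q)).
Proof.
move=> oO hc; apply: (measurability _ (RGenOInfty.measurableE R)).
move=> _ [_ [a ->] <-].
have oa : open (`]a, +oo[%classic : set R) by exact: interval_open.
have hcw z : O z -> h y @[y --> within O (nbhs z)] --> h z.
  by move=> Oz; apply: cvg_within_filter; exact: hc.
have [W oW WE] := within_preimage_open hcw oa.
rewrite (_ : _ `&` _ = vec3 @^-1` (O `&` W) :> set R3); last by rewrite -WE.
by apply: measurable_vec3_open; exact: openI.
Qed.

Section null_sets.
Variable vol : {measure set X -> \bar R}.
Hypothesis volP : is_volume S T f alpha vol.

Lemma ae_chart i (P : R * M -> Prop) : {ae vol, forall p, spacetime T p -> P p} ->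
  {ae leb, forall q, bimg T i (vec3 q) -> P (binv i (vec3 q))}.
Proof.
move=> [N [mN N0 NP]].
pose E : set R3 := vec3 @^-1` bimg T i `&` (fun q => binv i (vec3 q) : X) @^-1` N.
have mE : measurable E by apply: measurable_binv => //; exact: measurable_bimg.
have Ei : E `<=` vec3 @^-1` bimg T i by move=> q [].
exists E; split => //.
  apply/(vol_null_chart alpha0 mov volP mE Ei).
  apply: (subset_measure0 _ mN _ N0).
    by rewrite -[X in measurable X]setTI; exact: measurable_chart_coord.
  move=> p [pi pN]; move: pN; have pb := chart_coord_bdom pi.
  by rewrite /= (vec3_chart_coord pb) (bmapK pb).
move=> q /= /not_implyP[qi nP]; split => //; apply: NP => /=.
by apply/not_implyP; split => //; have [] := bdom_binv qi.
Qed.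

(** Interiors suffice, since the boundaries of chart images are null; countably many charts then
    cover spacetime. *)
Lemma chart_ae (P : R * M -> Prop) : compact [set: M] ->
  (forall i, {ae leb, forall q, (bimg T i)° (vec3 q) -> P (binv i (vec3 q))}) ->
  {ae vol, forall p, spacetime T p -> P p}.
Proof.
move=> cM aP; have [c [N cN]] := chart_sequence S cM.
have neg i : vol.-negligible ([set p : X | bdom T i p /\ ~ P p]).
  have [Z [mZ Z0 ZP]] := negligibleU (aP i) (boundary_null T i).
  pose E : set R3 := Z `&` vec3 @^-1` bimg T i.
  have mE : measurable E by apply: measurableI => //; exact: measurable_bimg.
  have Ei : E `<=` vec3 @^-1` bimg T i by move=> q [].
  exists (chart_coord T i @^-1` E); split.
  - by rewrite -[X in measurable X]setTI; exact: measurable_chart_coord.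
  - apply/(vol_null_chart alpha0 mov volP mE Ei).
    by apply: (subset_measure0 mE mZ _ Z0) => q [].
  move=> p [pi nP]; split; last by rewrite /= (vec3_chart_coord pi); exact: bimg_bmap.
  apply: ZP; rewrite /setU /= (vec3_chart_coord pi).
  have [int|nint] := pselect ((bimg T i)° (bmap i p)); [left|right].
    by move=> /(_ int); rewrite (bmapK pi).
  by split => //; exact: bimg_bmap.
apply: negligibleS (negligible_bigcup (fun n => neg (c n))) => p /= /not_implyP[pT nP].
by have [n _ pn] := cN p.2; exists n.
Qed.

End null_sets.

Lemma vector_in_lin i (c : R) (u v : R * M -> 'rV[R]_(1 + 2)) p b :
  vector_in i (fun p => u p + c *: v p) p 0 b =
  vector_in i u p 0 b + c * vector_in i v p 0 b.
Proof. by rewrite /vector_in mulmxDl -scalemxAl mxE [X in _ + X]mxE. Qed.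

Lemma tensor_in_lin i (c : R) (A B : R * M -> 'M[R]_(1 + 2)) p a b :
  tensor_in i (fun p => A p + c *: B p) p a b =
  tensor_in i A p a b + c * tensor_in i B p a b.
Proof.
by rewrite /tensor_in mulmxDr mulmxDl -scalemxAr -scalemxAl mxE [X in _ + X]mxE.
Qed.

Lemma weak_covariant_derivative_lin (c : R) u v A B : is_wcd u A -> is_wcd v B ->
  is_wcd (fun p => u p + c *: v p : 'rV[R]_(1 + 2))
    (fun p => A p + c *: B p : 'M[R]_(1 + 2)).
Proof.
move=> uA vB i a b; have [mA dA] := uA i a b; have [mB dB] := vB i a b; split.
  rewrite /measurable_in; under eq_fun do rewrite tensor_in_lin.
  by apply: measurable_funD => //; exact: measurable_funM.
apply: eq_weak_pd (weak_pd_lin c dA dB) => z _.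
  by rewrite vector_in_lin.
rewrite tensor_in_lin.
under [in RHS]eq_bigr do rewrite vector_in_lin mulrDr mulrCA.
rewrite big_split /= -mulr_sumr; ring.
Qed.

Lemma weak_covariant_derivative0 : is_wcd (fun=> 0) (fun=> 0).
Proof.
move=> i a b; have t0 p : tensor_in i (fun=> 0) p a b = 0.
  by rewrite /tensor_in mulmx0 mul0mx mxE.
have v0 p c : vector_in i (fun=> 0) p 0 c = 0 by rewrite /vector_in mul0mx mxE.
split; first by rewrite /measurable_in; under eq_fun do rewrite t0; exact: measurable_cst.
apply: eq_weak_pd (weak_pd0 _ a) => z _; first by rewrite v0.
by rewrite t0 big1 ?subr0// => c _; rewrite v0 mulr0.
Qed.

Section uniqueness.
Variable vol : {measure set X -> \bar R}.
Hypothesis volP : is_volume S T f alpha vol.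
Hypothesis cM : compact [set: M].

(** Makes the energy independent of the choice hidden in [nablabar]. The Christoffel terms involve
    only [u], so they cancel and uniqueness of weak partial derivatives applies. *)
Lemma weak_covariant_derivative_unique u A B : is_wcd u A -> is_wcd u B ->
  {ae vol, forall p, spacetime T p -> A p = B p}.
Proof.
move=> uA uB; apply: chart_ae => // i.
have oO : open (bimg T i)° by exact: open_interior.
have H (k : 'I_(1 + 2) * 'I_(1 + 2)) := weak_pd_unique oO (uA i k.1 k.2).2 (uB i k.1 k.2).2.
apply: ae_imply (ae_forall_fin H) => q Hq qO.
have qi : bdom T i (binv i (vec3 q)) by apply: bdom_binv; exact: interior_subset.
have tE : tensor_in i A (binv i (vec3 q)) = tensor_in i B (binv i (vec3 q)).
  by apply/matrixP => a b; have /addIr := Hq (a, b) qO.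
have [qT _] := qi.
rewrite (tensor_of_ambient alpha0 mov A qT) (tensor_of_ambient alpha0 mov B qT).
by rewrite (ambient_tensorE alpha0 mov A qi) (ambient_tensorE alpha0 mov B qi) tE.
Qed.

Lemma weak_differential_unique (h : R * M -> R) w w' :
  is_weak_differential S T h w -> is_weak_differential S T h w' ->
  {ae vol, forall p, spacetime T p -> w p = w' p}.
Proof.
move=> hw hw'; apply: chart_ae => // i.
have oO : open (bimg T i)° by exact: open_interior.
have H a := weak_pd_unique oO (hw i a).2 (hw' i a).2.
apply: ae_imply (ae_forall_fin H) => q Hq qO.
have qi : bdom T i (binv i (vec3 q)) by apply: bdom_binv; exact: interior_subset.
have cE : covector_in i w (binv i (vec3 q)) = covector_in i w' (binv i (vec3 q)).
  by apply/rowP => a; exact: Hq.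
(* Entries in the preferred chart are read off by pairing with constant basis vectors, as the
   pairing can be computed in the chart [i]. *)
apply/rowP => k; pose e : R * M -> 'rV[R]_(1 + 2) := fun=> delta_mx 0 k.
have /matrixP/(_ 0 0) : w (binv i (vec3 q)) *m (e (binv i (vec3 q)))^T =
    w' (binv i (vec3 q)) *m (e (binv i (vec3 q)))^T.
  apply: etrans (differential_vector alpha0 mov w e qi) _.
  by rewrite cE; exact/esym/(differential_vector alpha0 mov w' e qi).
by rewrite /e trmx_delta -!colE !mxE.
Qed.

End uniqueness.

End covariant_derivative.

(** * The components of the energy *)

Lemma submxE {V : zmodType} {m n : nat} (A B : 'M[V]_(m, n)) a b :
  (A - B) a b = A a b - B a b.
Proof. by rewrite !mxE. Qed.

Lemma measurable_mulmx {d : measure_display} {X : measurableType d} {R : realType}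
    (D : set X) (m n p : nat) (F : X -> 'M[R]_(m, n)) (G : X -> 'M[R]_(n, p)) :
  (forall a b, measurable_fun D (fun x => F x a b)) ->
  (forall a b, measurable_fun D (fun x => G x a b)) ->
  forall a b, measurable_fun D (fun x => (F x *m G x) a b).
Proof.
move=> mF mG a b; under eq_fun do rewrite mxE.
by apply: measurable_sum => k; apply: measurable_funM.
Qed.

Lemma compact_mx_bounded {R : realType} {n p q : nat} (A K : set 'rV[R]_n)
    (F : 'rV[R]_n -> 'M[R]_(p, q)) :
  (forall x, A x -> cvgmx (within A (nbhs x)) F (F x)) ->
  compact K -> K `<=` A -> exists2 C : R, 0 <= C & forall x, K x -> `|F x| <= C.
Proof.
move=> cF cK KA.
have H (ab : 'I_p * 'I_q) : exists C : R, forall x, K x -> `|F x ab.1 ab.2| <= C.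
  by apply: (compact_within_bounded (A := A)) => // x Ax; exact: cF.
have [C CP] := choice H.
exists (\sum_ab `|C ab|) => [|x Kx]; first exact: sumr_ge0.
apply/mx_norm_leP => [|a b]; first exact: sumr_ge0.
rewrite (bigD1 (a, b))//=; apply: le_trans (CP (a, b) x Kx) _.
by apply: le_trans (ler_norm _) _; rewrite lerDl sumr_ge0.
Qed.

Section flow_components.
Context {R : realType} {M : ptopologicalType}.
Variables (S : surface R M) (T alpha : R) (f : R -> M -> 'rV[R]_3).
Hypothesis alpha0 : 0 < alpha.
Hypothesis mov : is_moving_surface S T f.
Hypothesis cM : compact [set: M].
Local Notation R3 :=
  (measurableTypeR R * measurableTypeR R * measurableTypeR R)%type.
Local Notation leb := (leb3 R).
Local Notation X := (spacetime_type (R := R) (M := M)).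
Implicit Types (i j : chart S) (p : R * M) (z : 'rV[R]_(1 + 2)).
Local Notation is_wcd := (is_weak_covariant_derivative S T f alpha).
Local Notation vec_amb := (ambient_vector S alpha f).
Local Notation ten_amb := (ambient_tensor S alpha f).
Variables (beta gamma : R).
Hypotheses (beta0 : 0 < beta) (gamma0 : 0 < gamma).
Variables (I : R * M -> R) (dI : R * M -> 'rV[R]_(1 + 2)).
Hypothesis dIP : is_weak_differential S T I dI.

Definition flow_index : finType :=
  ('I_1 + ('I_(1 + 3) + 'I_(1 + 3) * 'I_(1 + 3)))%type.
Implicit Types (k : flow_index).

(* The energy of [u] is the sum of the squared L^2 norms of these functions,
   when [A] is the weak covariant derivative of [u]. *)
Definition flow_comp (u : R * M -> 'rV[R]_(1 + 2)) (A : R * M -> 'M[R]_(1 + 2))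
    k (p : X) : R :=
  match k with
  | inl _ => dI p 0 (lshift 2 0) + (dI p *m (u p)^T) 0 0
  | inr (inl l) => Num.sqrt beta * vec_amb u p 0 l
  | inr (inr lm) => Num.sqrt gamma * ten_amb A p lm.1 lm.2
  end.

Lemma eq_measurable_in i (h h' : R * M -> R) :
  (forall p, bdom T i p -> h p = h' p) -> measurable_in T i h -> measurable_in T i h'.
Proof.
move=> hh; apply: eq_measurable_fun => q; rewrite inE => qi.
by apply: hh; exact: bdom_binv.
Qed.

Lemma measurable_in_frame i a b :
  measurable_in T i (fun p => frame alpha f i (bmap i p) a b).
Proof.
apply: (eq_measurable_fun (fun q => frame alpha f i (vec3 q) a b)).
  by move=> q; rewrite inE => qi; rewrite (binvK qi).
apply: (@measurable_within_bimg _ _ S T i (fun z => frame alpha f i z a b)) => z zi.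
exact: cvg_frame.
Qed.

Lemma measurable_in_coframe i a b :
  measurable_in T i (fun p => coframe alpha f i (bmap i p) a b).
Proof.
apply: (eq_measurable_fun (fun q => coframe alpha f i (vec3 q) a b)).
  by move=> q; rewrite inE => qi; rewrite (binvK qi).
apply: (@measurable_within_bimg _ _ S T i (fun z => coframe alpha f i z a b)) => z zi.
exact: cvg_coframe.
Qed.

Lemma measurable_ambient_vector u :
  (forall i b, measurable_in T i (fun p => vector_in i u p 0 b)) ->
  forall l, measurable_fun (spacetime T : set X) (fun p : X => vec_amb u p 0 l).
Proof.
move=> mu l; apply: (measurable_on_spacetime (S := S)) => // i.
apply: (@eq_measurable_in i
  (fun p => (vector_in i u p *m frame alpha f i (bmap i p)) 0 l)).
  by move=> p pi; rewrite (ambient_vectorE alpha mov u pi).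
apply: (measurable_mulmx (F := fun q : R3 => vector_in i u (binv i (vec3 q)))) => a b.
  by rewrite (ord1 a); exact: mu.
exact: measurable_in_frame.
Qed.

Lemma measurable_ambient_tensor A :
  (forall i a b, measurable_in T i (fun p => tensor_in i A p a b)) ->
  forall l m, measurable_fun (spacetime T : set X) (fun p : X => ten_amb A p l m).
Proof.
move=> mA l m; apply: (measurable_on_spacetime (S := S)) => // i.
apply: (@eq_measurable_in i (fun p => (coframe alpha f i (bmap i p) *m tensor_in i A p
    *m frame alpha f i (bmap i p)) l m)).
  by move=> p pi; rewrite (ambient_tensorE alpha0 mov A pi).
apply: (measurable_mulmx (F := fun q : R3 =>
   coframe alpha f i (bmap i (binv i (vec3 q))) *m tensor_in i A (binv i (vec3 q)))).
  apply: (measurable_mulmx (F := fun q : R3 => coframe alpha f i (bmap i (binv i (vec3 q)))))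
    => a b; [exact: measurable_in_coframe|exact: mA].
by move=> a b; exact: measurable_in_frame.
Qed.

Lemma measurable_differential_time :
  measurable_fun (spacetime T : set X) (fun p : X => dI p 0 (lshift 2 0)).
Proof.
apply: (measurable_on_spacetime (S := S)) => // i.
apply: (@eq_measurable_in i (fun p => covector_in i dI p 0 (lshift 2 0))).
  by move=> p pi; rewrite (covector_in_time _ pi).
by case: (dIP i (lshift 2 0)).
Qed.

Lemma measurable_flow_comp u A : is_wcd u A ->
  (forall i b, measurable_in T i (fun p => vector_in i u p 0 b)) ->
  forall k, measurable_fun (spacetime T : set X) (flow_comp u A k).
Proof.
move=> uA mu [a0|[l|[l m]]] /=; last 2 first.
- by apply: measurable_funM => //; exact: measurable_ambient_vector.
- apply: measurable_funM => //; apply: measurable_ambient_tensor => i a b.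
  by case: (uA i a b).
apply: measurable_funD; first exact: measurable_differential_time.
apply: (measurable_on_spacetime (S := S)) => // i.
apply: (@eq_measurable_in i
  (fun p => (covector_in i dI p *m (vector_in i u p)^T) 0 0)).
  by move=> p pi; rewrite (differential_vector alpha0 mov dI u pi).
apply: (measurable_mulmx (F := fun q : R3 => covector_in i dI (binv i (vec3 q)))) => a b.
  by rewrite (ord1 a); case: (dIP i b).
by rewrite (ord1 b); under eq_fun do rewrite mxE; exact: mu.
Qed.

Lemma cvg_flow_comp {F : set_system nat} {FF : Filter F}
    (u_ : nat -> R * M -> 'rV[R]_(1 + 2)) (A_ : nat -> R * M -> 'M[R]_(1 + 2)) u A p k :
  cvgmx F (u_ ^~ p) (u p) -> cvgmx F (A_ ^~ p) (A p) ->
  flow_comp (u_ n) (A_ n) k p @[n --> F] --> flow_comp u A k p.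
Proof.
move=> cu cA; case: k => [a0|[l|[l m]]] /=; last 2 first.
- apply: cvgM; first exact: cvg_cst.
  by apply: (cvgmx_mul cu); exact: cvgmx_cst.
- apply: cvgM; first exact: cvg_cst.
  apply: (cvgmx_mul (h := fun=> frame_at S alpha f p)
    (f := fun n => coframe_at S alpha f p *m A_ n p)); last exact: cvgmx_cst.
  by apply: cvgmx_mul cA; exact: cvgmx_cst.
apply: cvgD; first exact: cvg_cst.
apply: (cvgmx_mul (f := fun=> dI p) (h := fun n => (u_ n p)^T)); first exact: cvgmx_cst.
exact: cvgmx_tr.
Qed.

(** * Limits of sequences of vector fields with weak covariant derivatives *)

Section limit.
Variable vol : {measure set X -> \bar R}.
Hypothesis volP : is_volume S T f alpha vol.
Variables (u_ : nat -> R * M -> 'rV[R]_(1 + 2)) (A_ : nat -> R * M -> 'M[R]_(1 + 2)).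
Variables (w : flow_index -> X -> R) (N : set X).
Hypothesis uA_ : forall n, is_wcd (u_ n) (A_ n).
Hypothesis mu_ : forall n i b, measurable_in T i (fun p => vector_in i (u_ n) p 0 b).
Hypothesis mw : forall k, measurable_fun (spacetime T : set X) (w k).
Hypothesis mN : measurable N.
Hypothesis N0 : vol N = 0%E.
Hypothesis cvg_w : forall p k, spacetime T p -> ~ N p ->
  flow_comp (u_ n) (A_ n) k p @[n --> \oo] --> w k p.
Local Notation gap n := (subf (flow_comp (u_ n) (A_ n)) w).
Hypothesis cvg_gap : sqnorm2 vol (spacetime T : set X) (gap n) @[n --> \oo] --> 0%E.

Let sb0 : Num.sqrt beta != 0. Proof. by rewrite gt_eqF// sqrtr_gt0. Qed.
Let sg0 : Num.sqrt gamma != 0. Proof. by rewrite gt_eqF// sqrtr_gt0. Qed.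

(** Undoes the scaling by [Num.sqrt beta]. The indicator discards the values on [N], about which
    nothing is known: they need not even be tangent to the surface. *)
Definition limit_vector_amb (p : X) : 'rV[R]_(1 + 3) :=
  \row_l (\1_(~` N) p * ((Num.sqrt beta)^-1 * w (inr (inl l)) p)).

Definition limit_tensor_amb (p : X) : 'M[R]_(1 + 3) :=
  \matrix_(l, m) (\1_(~` N) p * ((Num.sqrt gamma)^-1 * w (inr (inr (l, m))) p)).

(* The fields in [energy_dom] have no time component even outside the spacetime. *)
Definition limit_vector (p : R * M) : 'rV[R]_(1 + 2) :=
  (\1_(spacetime T) p : R) *: (limit_vector_amb p *m coframe_at S alpha f p).

Definition limit_tensor (p : R * M) : 'M[R]_(1 + 2) :=
  frame_at S alpha f p *m limit_tensor_amb p *m coframe_at S alpha f p.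

Lemma indic1 (A : set X) (p : X) : A p -> \1_A p = 1 :> R.
Proof. by move=> Ap; rewrite indicE mem_set. Qed.

Lemma cvg_vector_amb p : spacetime T p -> ~ N p ->
  cvgmx \oo (fun n => vec_amb (u_ n) p) (limit_vector_amb p).
Proof.
move=> pT pN a l; rewrite (ord1 a) mxE indic1// mul1r.
have : (Num.sqrt beta)^-1 * flow_comp (u_ n) (A_ n) (inr (inl l)) p @[n --> \oo] -->
    (Num.sqrt beta)^-1 * w (inr (inl l)) p.
  by apply: cvgM; [exact: cvg_cst|exact: cvg_w].
by under eq_fun do rewrite /= mulKf//.
Qed.

Lemma cvg_tensor_amb p : spacetime T p -> ~ N p ->
  cvgmx \oo (fun n => ten_amb (A_ n) p) (limit_tensor_amb p).
Proof.
move=> pT pN l m; rewrite mxE indic1// mul1r.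
have : (Num.sqrt gamma)^-1 * flow_comp (u_ n) (A_ n) (inr (inr (l, m))) p @[n --> \oo] -->
    (Num.sqrt gamma)^-1 * w (inr (inr (l, m))) p.
  by apply: cvgM; [exact: cvg_cst|exact: cvg_w].
by under eq_fun do rewrite /= mulKf//.
Qed.

Lemma cvg_vector p : spacetime T p -> ~ N p -> cvgmx \oo (u_ ^~ p) (limit_vector p).
Proof.
move=> pT pN; rewrite /limit_vector indic1// scale1r.
have -> : u_ ^~ p = fun n => vec_amb (u_ n) p *m coframe_at S alpha f p.
  by apply/funext => n; exact: (vector_of_ambient alpha0 mov _ pT).
by apply: cvgmx_mul; [exact: cvg_vector_amb|exact: cvgmx_cst].
Qed.

Lemma cvg_tensor p : spacetime T p -> ~ N p -> cvgmx \oo (A_ ^~ p) (limit_tensor p).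
Proof.
move=> pT pN; rewrite /limit_tensor.
have -> : A_ ^~ p = fun n => frame_at S alpha f p *m ten_amb (A_ n) p *m
    coframe_at S alpha f p.
  by apply/funext => n; exact: (tensor_of_ambient alpha0 mov _ pT).
apply: cvgmx_mul; last exact: cvgmx_cst.
by apply: cvgmx_mul; [exact: cvgmx_cst|exact: cvg_tensor_amb].
Qed.

Lemma cvgmx_unique m n (h : nat -> 'M[R]_(m, n)) A B :
  cvgmx \oo h A -> cvgmx \oo h B -> A = B.
Proof.
move=> hA hB; apply/matrixP => a b.
by rewrite -(cvg_lim _ (hA a b))// -(cvg_lim _ (hB a b)).
Qed.

(** Passing to coordinates and back projects onto the tangent space, so the equality says that
    [limit_vector_amb] is tangent: off [N] as a limit of tangent vectors, on [N] because it is
    zero. *)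
Lemma limit_vectorE p : spacetime T p -> vec_amb limit_vector p = limit_vector_amb p.
Proof.
move=> pT; have [pN|pN] := pselect (N p).
  have z : limit_vector_amb p = 0.
    by apply/rowP => l; rewrite !mxE indicE memNset ?mul0r//; apply; exact.
  by rewrite /ambient_vector /limit_vector z mul0mx scaler0 mul0mx.
apply: cvgmx_unique (cvg_vector_amb pT pN).
by apply: cvgmx_mul; [exact: cvg_vector|exact: cvgmx_cst].
Qed.

Lemma limit_tensorE p : spacetime T p -> ten_amb limit_tensor p = limit_tensor_amb p.
Proof.
move=> pT; have [pN|pN] := pselect (N p).
  have z : limit_tensor_amb p = 0.
    by apply/matrixP => l m; rewrite !mxE indicE memNset ?mul0r//; apply; exact.
  by rewrite /ambient_tensor /limit_tensor z mulmx0 mul0mx mulmx0 mul0mx.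
apply: cvgmx_unique (cvg_tensor_amb pT pN).
apply: (cvgmx_mul (f := fun n => coframe_at S alpha f p *m A_ n p)); last exact: cvgmx_cst.
by apply: cvgmx_mul; [exact: cvgmx_cst|exact: cvg_tensor].
Qed.

Lemma flow_comp_limit p k : spacetime T p -> ~ N p ->
  flow_comp limit_vector limit_tensor k p = w k p.
Proof.
move=> pT pN; have cw := @cvg_w p k pT pN; rewrite -(cvg_lim _ cw)//; apply/esym/cvg_lim => //.
by apply: cvg_flow_comp; [exact: cvg_vector|exact: cvg_tensor].
Qed.

Lemma limit_vector_time : (forall n p, lsubmx (u_ n p) = 0) ->
  forall p, lsubmx (limit_vector p) = 0.
Proof.
move=> u0 p; have [pT|pT] := pselect (spacetime T p); last first.
  by rewrite /limit_vector indicE memNset// scale0r; apply/matrixP => a b; rewrite !mxE.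
have [pN|pN] := pselect (N p).
  have -> : limit_vector p = 0.
    rewrite /limit_vector; have -> : limit_vector_amb p = 0; last by rewrite mul0mx scaler0.
    by apply/rowP => l; rewrite !mxE indicE memNset ?mul0r//; apply; exact.
  by apply/matrixP => a b; rewrite !mxE.
apply/matrixP => a b; rewrite [LHS]mxE [RHS]mxE.
have cu : cvgmx \oo (u_ ^~ p) (limit_vector p) := cvg_vector pT pN.
have c := cu a (lshift 2 b); rewrite -(cvg_lim _ c)//; apply: cvg_lim => //.
rewrite (_ : (fun n => _) = fun=> 0); first exact: cvg_cst.
by apply/funext => n; have /matrixP/(_ a b) := u0 n p; rewrite [LHS]mxE [RHS]mxE.
Qed.

Lemma measurable_off : measurable_fun (spacetime T : set X) (\1_(~` N) : X -> R).
Proof. by apply: measurable_indic; exact: measurableC. Qed.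

Lemma measurable_limit_vector i b :
  measurable_in T i (fun p => vector_in i limit_vector p 0 b).
Proof.
apply: (@eq_measurable_in i
  (fun p => (limit_vector_amb p *m coframe alpha f i (bmap i p)) 0 b)).
  by move=> p pi; rewrite (vector_inE alpha0 mov _ pi) limit_vectorE//; case: pi.
apply: (measurable_mulmx (F := fun q : R3 => limit_vector_amb (binv i (vec3 q)))) => a c.
  apply: (@measurable_in_of_spacetime _ _ S T i (fun p => limit_vector_amb p a c)).
  under eq_fun do rewrite mxE; apply: measurable_funM; last exact: measurable_funM.
  exact: measurable_off.
exact: measurable_in_coframe.
Qed.

Lemma measurable_limit_tensor i a b :
  measurable_in T i (fun p => tensor_in i limit_tensor p a b).
Proof.
apply: (@eq_measurable_in i (fun p => (frame alpha f i (bmap i p) *m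
    limit_tensor_amb p *m coframe alpha f i (bmap i p)) a b)).
  by move=> p pi; rewrite (tensor_inE alpha0 mov _ pi) limit_tensorE//; case: pi.
apply: (measurable_mulmx (F := fun q : R3 =>
   frame alpha f i (bmap i (binv i (vec3 q))) *m limit_tensor_amb (binv i (vec3 q)))).
  apply: (measurable_mulmx (F := fun q : R3 => frame alpha f i (bmap i (binv i (vec3 q)))))
    => c e; first exact: measurable_in_frame.
  apply: (@measurable_in_of_spacetime _ _ S T i (fun p => limit_tensor_amb p c e)).
  under eq_fun do rewrite mxE; apply: measurable_funM; last exact: measurable_funM.
  exact: measurable_off.
by move=> c e; exact: measurable_in_coframe.
Qed.

Local Notation err n p := (Num.sqrt (sqsum (gap n) p)).

Lemma gap_le n k p : `|gap n k p| <= err n p.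
Proof. by rewrite -sqrtr_sqr; apply: ler_wsqrtr; exact: sqr_le_sqsum. Qed.

Lemma vector_amb_error n p : spacetime T p -> ~ N p ->
  `|vec_amb (u_ n) p - vec_amb limit_vector p| <= (Num.sqrt beta)^-1 * err n p.
Proof.
move=> pT pN; rewrite (limit_vectorE pT).
apply/mx_norm_leP => [|a l]; first by rewrite mulr_ge0 ?invr_ge0 ?sqrtr_ge0.
rewrite (ord1 a) submxE [X in _ - X]mxE indic1// mul1r.
rewrite -[X in X - _](mulKf sb0) -mulrBr normrM ger0_norm ?invr_ge0 ?sqrtr_ge0//.
by apply: ler_wpM2l; [rewrite invr_ge0 sqrtr_ge0|exact: (gap_le n (inr (inl l)) p)].
Qed.

Lemma tensor_amb_error n p : spacetime T p -> ~ N p ->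
  `|ten_amb (A_ n) p - ten_amb limit_tensor p| <= (Num.sqrt gamma)^-1 * err n p.
Proof.
move=> pT pN; rewrite (limit_tensorE pT).
apply/mx_norm_leP => [|l m]; first by rewrite mulr_ge0 ?invr_ge0 ?sqrtr_ge0.
rewrite submxE [X in _ - X]mxE indic1// mul1r.
rewrite -[X in X - _](mulKf sg0) -mulrBr normrM ger0_norm ?invr_ge0 ?sqrtr_ge0//.
by apply: ler_wpM2l; [rewrite invr_ge0 sqrtr_ge0|exact: (gap_le n (inr (inr (l, m))) p)].
Qed.

(** The coframe carries the ambient error into chart coordinates and is bounded on [K]; the factor
    [(1 + 3)%:R] comes from the matrix norm being the maximum of the entries. *)
Lemma vector_error i K : compact K -> K `<=` bimg T i -> exists2 C : R, 0 <= C &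
  forall n z, K z -> ~ N (binv i z) -> forall b,
    `|vector_in i (u_ n) (binv i z) 0 b - vector_in i limit_vector (binv i z) 0 b| <=
    C * err n (binv i z).
Proof.
move=> cK Ki.
have [c c0 cP] := compact_mx_bounded (@cvg_coframe _ _ S T alpha f alpha0 mov i) cK Ki.
exists ((1 + 3)%:R * c * (Num.sqrt beta)^-1).
  by rewrite !mulr_ge0// invr_ge0 sqrtr_ge0.
move=> n z Kz zN b; have zi := bdom_binv (Ki z Kz); have [zT _] := zi.
have -> : vector_in i (u_ n) (binv i z) 0 b - vector_in i limit_vector (binv i z) 0 b =
    (vector_in i (u_ n) (binv i z) - vector_in i limit_vector (binv i z)) 0 b.
  by rewrite submxE.
apply: le_trans (ler_mx_norm_coord _ _ _) _.
rewrite !(vector_inE alpha0 mov _ zi) (binvK (Ki z Kz)) -mulmxBl.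
apply: le_trans (ler_norm_mulmx _ _) _; rewrite -[X in _ <= X]mulrA.
apply: ler_pM; rewrite ?mulr_ge0//.
  by apply: ler_wpM2l => //; exact: cP.
exact: vector_amb_error.
Qed.

Lemma tensor_error i K : compact K -> K `<=` bimg T i -> exists2 C : R, 0 <= C &
  forall n z, K z -> ~ N (binv i z) -> forall a b,
    `|tensor_in i (A_ n) (binv i z) a b - tensor_in i limit_tensor (binv i z) a b| <=
    C * err n (binv i z).
Proof.
move=> cK Ki.
have [c c0 cP] := compact_mx_bounded (@cvg_coframe _ _ S T alpha f alpha0 mov i) cK Ki.
have [c' c'0 c'P] := compact_mx_bounded (@cvg_frame _ _ S T alpha f mov i) cK Ki.
exists ((1 + 3)%:R * c * ((1 + 3)%:R * (Num.sqrt gamma)^-1 * c')).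
  by rewrite !mulr_ge0// invr_ge0 sqrtr_ge0.
move=> n z Kz zN a b; have zi := bdom_binv (Ki z Kz); have [zT _] := zi.
have -> : tensor_in i (A_ n) (binv i z) a b - tensor_in i limit_tensor (binv i z) a b =
    (tensor_in i (A_ n) (binv i z) - tensor_in i limit_tensor (binv i z)) a b.
  by rewrite submxE.
apply: le_trans (ler_mx_norm_coord _ _ _) _.
rewrite !(tensor_inE alpha0 mov _ zi) (binvK (Ki z Kz)) -mulmxBl -mulmxBr.
apply: le_trans (ler_norm_mulmx _ _) _; rewrite -[X in _ <= X]mulrA.
apply: ler_pM; rewrite ?mulr_ge0//.
  by apply: ler_wpM2l => //; exact: cP.
apply: le_trans (ler_norm_mulmx _ _) _.
rewrite [X in _ <= X](_ : _ =
  (1 + 3)%:R * ((Num.sqrt gamma)^-1 * err n (binv i z)) * c'); last by ring.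
apply: ler_pM; rewrite ?mulr_ge0//; last exact: c'P.
by apply: ler_wpM2l => //; exact: tensor_amb_error.
Qed.

Lemma near_gap_small (e : R) : 0 < e ->
  \forall n \near \oo, (sqnorm2 vol (spacetime T : set X) (gap n) <= e%:E)%E.
Proof.
move=> e0; have /fine_cvgP[fin /cvgrPdist_le/(_ _ e0) small] := cvg_gap.
apply: filterS2 fin small => n fn; rewrite sub0r normrN => le.
by rewrite -(fineK fn) lee_fin; apply: le_trans le; exact: ler_norm.
Qed.

(** Carries convergence with respect to the volume into the chart: [chart_integral_le] bounds the
    integral of the squares over [K] by a constant times the squared norm of the gap. The null set
    [N] remains null in coordinates. *)
Lemma L1_small_error i K (d_ : nat -> 'rV[R]_(1 + 2) -> R) (C : R) :
  compact K -> K `<=` bimg T i ->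
  (forall n, measurable_fun (vec3 @^-1` K : set R3) (fun q => d_ n (vec3 q))) ->
  0 <= C ->
  (forall n z, K z -> ~ N (binv i z) -> `|d_ n z| <= C * err n (binv i z)) ->
  L1_small K d_.
Proof.
move=> cK Ki md C0 dC; have mK := compact_measurable_vec3 cK.
have [C1 [C10 C1P]] := chart_integral_le alpha0 mov volP cK Ki.
apply: L1_small_of_sq => // e e0.
(* The summand 1 keeps the denominator positive even when [C] or [C1] is zero. *)
have D0 : 0 < C ^+ 2 * C1 + 1 by rewrite ltr_wpDl// mulr_ge0// sqr_ge0.
have e1 : 0 < e / (C ^+ 2 * C1 + 1) by rewrite divr_gt0.
apply: filterS (near_gap_small e1) => n small.
have mgap k : measurable_fun (spacetime T : set X) (gap n k).
  by apply: measurable_funB => //; exact: measurable_flow_comp.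
have mQ : measurable_fun (spacetime T : set X) (sqsum (gap n)) by exact: measurable_sqsum.
have mQi := @measurable_in_of_spacetime _ _ S T i (sqsum (gap n)) mQ.
have Kv : vec3 @^-1` K `<=` (vec3 @^-1` bimg T i : set R3) by move=> q /Ki.
have mQK : measurable_fun (vec3 @^-1` K : set R3)
    (fun q => (sqsum (gap n) (binv i (vec3 q)))%:E).
  by apply/measurable_EFinP; exact: (measurable_funS (measurable_bimg T i) Kv mQi).
have NC : {ae vol, forall p, spacetime T p -> ~ N p}.
  by exists N; split => // p /= /not_implyP[_ /contrapT].
apply: (@le_trans _ _ (\int[leb]_(q in vec3 @^-1` K)
   ((C ^+ 2)%:E * (sqsum (gap n) (binv i (vec3 q)))%:E))%E).
  apply: ae_ge0_le_integral => //.
  - by move=> q _; rewrite lee_fin sqr_ge0.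
  - by apply/measurable_EFinP; apply: measurable_funX; exact: md.
  - by move=> q _; rewrite -EFinM lee_fin mulr_ge0 ?sqr_ge0// sqsum_ge0.
  - exact: measurable_funeM.
  apply: ae_imply (ae_chart alpha0 mov volP i NC) => q qN Kq.
  rewrite -EFinM lee_fin -(@real_normK _ (d_ n _)) ?num_real//.
  rewrite -[sqsum _ _]sqr_sqrtr ?sqsum_ge0// -exprMn ler_sqr ?nnegrE//.
    by apply: dC => //; exact/qN/Ki.
  by rewrite mulr_ge0// sqrtr_ge0.
rewrite ge0_integralZl//; last 2 first.
- by move=> q _; rewrite lee_fin sqsum_ge0.
- by rewrite lee_fin sqr_ge0.
apply: (@le_trans _ _ ((C ^+ 2)%:E * (C1%:E * (e / (C ^+ 2 * C1 + 1))%:E))%E).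
  apply: lee_wpmul2l; first by rewrite lee_fin sqr_ge0.
  apply: (le_trans (C1P _ _ mQi mQ)) => [p|]; first exact: sqsum_ge0.
  by apply: lee_wpmul2l.
rewrite -!EFinM lee_fin mulrA mulrA ler_pdivrMr// mulrC.
by rewrite ler_wpM2l ?(ltW e0)// lerDl.
Qed.

(** The partial derivatives contain the Christoffel symbols times [u]. As the symbols are bounded on
    compact subsets of the interior, the errors of the vector and of the tensor control those of the
    partial derivatives. *)
Lemma weak_covariant_derivative_limit : is_wcd limit_vector limit_tensor.
Proof.
move=> i a b; split; first exact: measurable_limit_tensor.
have sO : (bimg T i)° `<=` bimg T i by exact: interior_subset.
have Kv K : K `<=` (bimg T i)° -> vec3 @^-1` K `<=` (vec3 @^-1` bimg T i : set R3).
  by move=> KO q /KO /sO.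
have mv_ n c K : K `<=` (bimg T i)° -> measurable_fun (vec3 @^-1` K : set R3)
    (fun q => vector_in i (u_ n) (binv i (vec3 q)) 0 c).
  by move=> KO; exact: (measurable_funS (measurable_bimg T i) (Kv K KO) (@mu_ n i c)).
have mv c K : K `<=` (bimg T i)° -> measurable_fun (vec3 @^-1` K : set R3)
    (fun q => vector_in i limit_vector (binv i (vec3 q)) 0 c).
  move=> KO.
  exact: (measurable_funS (measurable_bimg T i) (Kv K KO) (@measurable_limit_vector i c)).
have mt_ n K : K `<=` (bimg T i)° -> measurable_fun (vec3 @^-1` K : set R3)
    (fun q => tensor_in i (A_ n) (binv i (vec3 q)) a b).
  move=> KO; have [mA _] := @uA_ n i a b.
  exact: (measurable_funS (measurable_bimg T i) (Kv K KO) mA).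
have mt K : K `<=` (bimg T i)° -> measurable_fun (vec3 @^-1` K : set R3)
    (fun q => tensor_in i limit_tensor (binv i (vec3 q)) a b).
  move=> KO.
  exact: (measurable_funS (measurable_bimg T i) (Kv K KO) (@measurable_limit_tensor i a b)).
have oO : open (bimg T i)° by exact: open_interior.
have cG c z : (bimg T i)° z -> christoffel T f alpha i y b a c @[y --> z] -->
    christoffel T f alpha i z b a c by exact: cvg_christoffel.
have mG c K : K `<=` (bimg T i)° -> measurable_fun (vec3 @^-1` K : set R3)
    (fun q => christoffel T f alpha i (vec3 q) b a c).
  move=> KO; apply: (measurable_funS _ _ (measurable_continuous_on oO (cG c))).
    exact: measurable_vec3_open.
  by move=> q /KO.
apply: (@weak_pd_closed _ _ _
  (fun n z => vector_in i (u_ n) (binv i z) 0 b) a _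
  (fun n z => tensor_in i (A_ n) (binv i z) a b -
     \sum_c christoffel T f alpha i z b a c * vector_in i (u_ n) (binv i z) 0 c)).
- by move=> n; case: (@uA_ n i a b).
- by move=> K _ KO; exact: mv.
- move=> K _ KO; apply: measurable_funB; first exact: mt.
  by apply: measurable_sum => c; apply: measurable_funM; [exact: mG|exact: mv].
- move=> K cK KO; have Ki := subset_trans KO sO.
  have [C C0 CP] := vector_error cK Ki.
  apply: (L1_small_error cK Ki _ C0) => [n|n z Kz zN]; last exact: CP.
  by apply: measurable_funB; [exact: mv_|exact: mv].
move=> K cK KO; have Ki := subset_trans KO sO.
have [C C0 CP] := vector_error cK Ki.
have [D D0 DP] := tensor_error cK Ki.
have /choice[G GP] : forall c, exists G : R, forall z, K z ->
    `|christoffel T f alpha i z b a c| <= G.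
  move=> c; apply: (compact_within_bounded (A := (bimg T i)°)) => // z zO.
  by apply: cvg_within_filter; exact: cG.
apply: (L1_small_error (i := i) (C := D + \sum_c `|G c| * C) cK Ki).
- move=> n; apply: measurable_funB.
    apply: measurable_funB; first exact: mt_.
    by apply: measurable_sum => c; apply: measurable_funM; [exact: mG|exact: mv_].
  apply: measurable_funB; first exact: mt.
  by apply: measurable_sum => c; apply: measurable_funM; [exact: mG|exact: mv].
- by rewrite addr_ge0// sumr_ge0// => c _; rewrite mulr_ge0.
move=> n z Kz zN; rewrite [X in `|X|](_ : _ = (tensor_in i (A_ n) (binv i z) a b -
    tensor_in i limit_tensor (binv i z) a b) -
  \sum_c christoffel T f alpha i z b a c * (vector_in i (u_ n) (binv i z) 0 c -
    vector_in i limit_vector (binv i z) 0 c)); last first.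
  by under [in RHS]eq_bigr do rewrite mulrBr; rewrite sumrB; ring.
apply: le_trans (ler_normB _ _) _; rewrite mulrDl; apply: lerD; first exact: DP.
apply: le_trans (ler_norm_sum _ _ _) _; rewrite mulr_suml; apply: ler_sum => c _.
rewrite normrM -mulrA; apply: ler_pM => //; last exact: CP.
by apply: le_trans (GP c z Kz) _; exact: ler_norm.
Qed.

End limit.

End flow_components.

(** * Minimisation *)

Section minimisation.
Context {R : realType} {M : ptopologicalType}.
Variables (S : surface R M) (T alpha : R) (f : R -> M -> 'rV[R]_3).
Hypothesis alpha0 : 0 < alpha.
Hypothesis mov : is_moving_surface S T f.
Hypothesis cM : compact [set: M].
Local Notation X := (spacetime_type (R := R) (M := M)).
Variable vol : {measure set X -> \bar R}.
Hypothesis volP : is_volume S T f alpha vol.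
Variables (beta gamma : R).
Hypotheses (beta0 : 0 < beta) (gamma0 : 0 < gamma).
Variable I : R * M -> R.
Hypothesis WI : in_W1oo S T f alpha vol I.
Implicit Types (i j : chart S) (p : R * M) (k : flow_index).
Local Notation is_wcd := (is_weak_covariant_derivative S T f alpha).
Local Notation dI := (weak_differential S T I).
Local Notation comp := (flow_comp S alpha f beta gamma dI).
Local Notation space := (spacetime T : set X).
Local Notation nabla := (nablabar S T f alpha).
Let mspace : measurable space := @measurable_spacetime R M T.

Definition spatial (u : R * M -> 'rV[R]_(1 + 2)) : Prop :=
  exists v : R * M -> 'rV[R]_2, forall p, u p = row_mx 0 (v p).

Lemma weak_differentialP : is_weak_differential S T I dI.
Proof.
have [_ _ [w [wP _]]] := WI.
exact: (@xgetPex _ (fun=> 0) [set w | is_weak_differential S T I w] (ex_intro _ w wP)).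
Qed.

Lemma nablabarP u A : is_wcd u A -> is_wcd u (nabla u).
Proof.
by move=> uA; exact: (@xgetPex _ (fun=> 0) [set A | is_wcd u A] (ex_intro _ A uA)).
Qed.

(** The residual in [flow_comp] pairs the whole differential with the whole vector; for a field
    without time component this is the spatial pairing, which the gradient represents. *)
Lemma flow_comp_data u A p : spacetime T p -> spatial u ->
  (lsubmx (dI p) 0 0 + g S f p (grad S f p (rsubmx (dI p))) (rsubmx (u p))) ^+ 2 =
  comp u A (inl 0) p ^+ 2.
Proof.
move=> pT [v uv]; rewrite (gradE mov _ _ pT) /= uv row_mxKr.
move: (dI p) => d; congr (_ ^+ 2); congr (_ + _); first by rewrite mxE.
by rewrite -{2}[d]hsubmxK tr_row_mx mul_row_col trmx0 mulmx0 add0r.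
Qed.

Lemma flow_comp_mass u A p :
  beta * gbar S f alpha p (u p) (u p) = \sum_l comp u A (inr (inl l)) p ^+ 2.
Proof.
rewrite gbarE mulr_sumr; apply: eq_bigr => l _.
by rewrite /= exprMn sqr_sqrtr// ltW.
Qed.

Lemma flow_comp_gradient u A p : spacetime T p ->
  gamma * gbar11 S f alpha p (A p) (A p) = \sum_l comp u A (inr (inr l)) p ^+ 2.
Proof.
move=> pT; rewrite (gbar11E alpha0 mov _ pT) pair_bigA /= mulr_sumr.
by apply: eq_bigr => l _; rewrite /= exprMn sqr_sqrtr// ltW.
Qed.

Lemma sqsum_comp u A p : sqsum (comp u A) p = comp u A (inl 0) p ^+ 2 +
  (\sum_l comp u A (inr (inl l)) p ^+ 2 + \sum_l comp u A (inr (inr l)) p ^+ 2).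
Proof. by rewrite /sqsum big_sumType big_ord1 big_sumType. Qed.

Lemma energy_sqnorm2 u A : is_wcd u A -> spatial u ->
  (forall i b, measurable_in T i (fun p => vector_in i u p 0 b)) ->
  energy S T f alpha vol beta gamma I u = sqnorm2 vol space (comp u (nabla u)).
Proof.
move=> uA su mu; have uN := nablabarP uA.
have mc := measurable_flow_comp alpha0 mov cM beta gamma weak_differentialP uN mu.
transitivity (\int[vol]_(p in space) (comp u (nabla u) (inl 0) p ^+ 2)%:E +
  \int[vol]_(p in space) (\sum_l comp u (nabla u) (inr (inl l)) p ^+ 2 +
     \sum_l comp u (nabla u) (inr (inr l)) p ^+ 2)%:E)%E.
  congr (_ + _)%E; apply: eq_integral => p; rewrite inE => pT.
    by rewrite (flow_comp_data (nabla u) pT su).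
  by rewrite (flow_comp_mass _ (nabla u)) (flow_comp_gradient u _ pT).
rewrite -ge0_integralD//.
- by apply: eq_integral => p _; rewrite -EFinD sqsum_comp.
- by move=> p _; rewrite lee_fin sqr_ge0.
- by apply/measurable_EFinP; apply: measurable_funX; exact: mc.
- by move=> p _; rewrite lee_fin addr_ge0// sumr_ge0// => l _; exact: sqr_ge0.
- apply/measurable_EFinP; apply: measurable_funD; apply: measurable_sum => l;
  apply: measurable_funX; exact: mc.
Qed.

Lemma sqnorm2_unique u A B : is_wcd u A -> is_wcd u B ->
  (forall i b, measurable_in T i (fun p => vector_in i u p 0 b)) ->
  sqnorm2 vol space (comp u A) = sqnorm2 vol space (comp u B).
Proof.
move=> uA uB mu.
have m D (uD : is_wcd u D) : measurable_fun space (fun p : X => (sqsum (comp u D) p)%:E).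
  apply/measurable_EFinP; apply: measurable_sqsum.
  exact: (measurable_flow_comp alpha0 mov cM beta gamma weak_differentialP uD mu).
apply: ae_eq_integral => //; [exact: m|exact: m|].
apply: ae_imply (weak_covariant_derivative_unique alpha0 mov volP cM uA uB) => p AB pT.
congr EFin; apply: eq_bigr => k _; congr (_ ^+ 2).
by case: k => [a0|[l|lm]] //=; rewrite /ambient_tensor (AB pT).
Qed.

Definition flow_class : set (flow_index -> X -> R) :=
  [set w | exists u A, [/\ is_wcd u A,
    forall i b, measurable_in T i (fun p => vector_in i u p 0 b),
    spatial u & forall k p, spacetime T p -> w k p = comp u A k p]].

Lemma measurable_flow_class w : flow_class w -> forall k, measurable_fun space (w k).
Proof.
move=> [u [A [uA mu _ wE]]] k; apply: (eq_measurable_fun (comp u A k)).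
  by move=> p; rewrite inE => pT; rewrite wE.
exact: (measurable_flow_comp alpha0 mov cM beta gamma weak_differentialP uA mu).
Qed.

(** The leading [0] is the zero field from which the half-sum is built by two uses of
    [weak_covariant_derivative_lin]. *)
Lemma mulmx_half (m n q r : nat) (B : 'M[R]_(m, n)) (C D : 'M[R]_(n, q))
    (E : 'M[R]_(q, r)) a b :
  (B *m (0 + 2^-1 *: C + 2^-1 *: D) *m E) a b =
  ((B *m C *m E) a b + (B *m D *m E) a b) / 2.
Proof.
rewrite add0r mulmxDr mulmxDl -!scalemxAr -!scalemxAl.
by move: (B *m C *m E) (B *m D *m E) => F G; rewrite !mxE; ring.
Qed.

Lemma flow_class_midpoint v w : flow_class v -> flow_class w -> flow_class (midpoint v w).
Proof.
move=> [u [A [uA mu [u' uE] vE]]] [t [B [tB mt [t' tE] wE]]].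
have uA2 := weak_covariant_derivative_lin 2^-1 (weak_covariant_derivative0 T alpha f) uA.
have mid := weak_covariant_derivative_lin 2^-1 uA2 tB.
eexists; eexists; split; [exact: mid| | |].
- move=> i b; rewrite /measurable_in; under eq_fun do rewrite vector_in_lin vector_in_lin.
  apply: measurable_funD; last by apply: measurable_funM => //; exact: mt.
  apply: measurable_funD; last by apply: measurable_funM => //; exact: mu.
  rewrite /vector_in; under eq_fun do rewrite mul0mx mxE; exact: measurable_cst.
- exists (fun p => 2^-1 *: u' p + 2^-1 *: t' p) => p.
  by rewrite uE tE add0r !scale_row_mx add_row_mx !scaler0 addr0.
(* The residual is affine with a constant term, which the two weights 1/2 preserve; the other
   components are linear. *)
move=> k p pT; rewrite /midpoint vE// wE//; case: k => [a0|[l|lm]] /=.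
- have -> (x y z : 'rV[R]_(1 + 2)) : (x *m (0 + 2^-1 *: y + 2^-1 *: z)^T) 0 0 =
      ((x *m y^T) 0 0 + (x *m z^T) 0 0) / 2.
    have := mulmx_half x y^T z^T 1%:M 0 0.
    by rewrite !mulmx1 => <-; rewrite !linearD !linearZ /= trmx0.
  by field.
- have := mulmx_half 1%:M (u p) (t p) (frame_at S alpha f p) 0 l.
  by rewrite !mul1mx /ambient_vector => ->; field.
have := mulmx_half (coframe_at S alpha f p) (A p) (B p) (frame_at S alpha f p) lm.1 lm.2.
by rewrite /ambient_tensor => ->; field.
Qed.

Lemma flow_class_closed (w_ : nat -> flow_index -> X -> R) (w : flow_index -> X -> R)
    (N : set X) :
  (forall n, flow_class (w_ n)) -> (forall k, measurable_fun space (w k)) ->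
  measurable N -> vol N = 0%E ->
  (forall p k, space p -> ~ N p -> w_ n k p @[n --> \oo] --> w k p) ->
  sqnorm2 vol space (subf (w_ n) w) @[n --> \oo] --> 0%E ->
  exists2 w', flow_class w' & forall p k, space p -> ~ N p -> w' k p = w k p.
Proof.
move=> /choice[u_ /choice[A_ uA]] mw mN N0 cw gap0.
have uA_ n : is_wcd (u_ n) (A_ n) by case: (uA n).
have mu_ n i b : measurable_in T i (fun p => vector_in i (u_ n) p 0 b).
  by case: (uA n) => _ + _ _; apply.
have wE n k p : spacetime T p -> w_ n k p = comp (u_ n) (A_ n) k p.
  by case: (uA n) => _ _ _; apply.
have cw' p k : spacetime T p -> ~ N p ->
    comp (u_ n) (A_ n) k p @[n --> \oo] --> w k p.
  by move=> pT pN; under eq_fun do rewrite -wE//; exact: cw.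
have gap : sqnorm2 vol space (subf (comp (u_ n) (A_ n)) w) @[n --> \oo] --> 0%E.
  rewrite (_ : (fun n => _) = fun n => sqnorm2 vol space (subf (w_ n) w))//.
  apply/funext => n; apply: eq_integral => p; rewrite inE => pT.
  by congr EFin; apply: eq_bigr => k _; rewrite /subf wE.
exists (comp (limit_vector S T alpha f beta w N) (limit_tensor S alpha f gamma w N)).
  exists (limit_vector S T alpha f beta w N), (limit_tensor S alpha f gamma w N).
  split => //.
  - exact: (weak_covariant_derivative_limit alpha0 mov cM beta0 gamma0
      weak_differentialP volP uA_ mu_ mw mN N0 cw' gap).
  - move=> i b; exact: (@measurable_limit_vector _ _ S T alpha f alpha0 mov beta gamma
      beta0 dI u_ A_ w N mw mN cw' i b).
  - exists (fun p => rsubmx (limit_vector S T alpha f beta w N p)) => p.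
    rewrite -[LHS]hsubmxK (limit_vector_time alpha0 mov beta0 cw')// => n q.
    by case: (uA n) => _ _ [v vE] _; rewrite vE row_mxKl.
by move=> p k pT pN; exact: (flow_comp_limit alpha0 mov beta0 gamma0 cw').
Qed.

(** Only the squared time derivative of [I] remains. The bounded weak differential provided by the
    hypothesis agrees almost everywhere with the chosen one, and the volume is finite. *)
Lemma sqnorm2_zero_fin : (sqnorm2 vol space (comp (fun=> 0%R) (fun=> 0%R)) < +oo)%E.
Proof.
have zE p : sqsum (comp (fun=> 0) (fun=> 0)) p = dI p 0 (lshift 2 0) ^+ 2.
  rewrite sqsum_comp big1 => [|l _]; last by rewrite /= /ambient_vector mul0mx mxE mulr0 expr0n.
  rewrite big1 => [|l _]; last first.
    by rewrite /= /ambient_tensor mulmx0 mul0mx mxE mulr0 expr0n.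
  by rewrite !addr0 /= trmx0 mulmx0 [X in _ + X]mxE addr0.
have [_ _ [w [wP [C wC]]]] := WI.
have mt := measurable_differential_time cM weak_differentialP.
(* The factor [alpha ^+ 2] is that of [gbar_dual_ge]; the absolute value of [C] makes the constant
   nonnegative. *)
apply: (@le_lt_trans _ _ (\int[vol]_(p in space) (alpha ^+ 2 * `|C|)%:E)%E); last first.
  rewrite integral_cst//; apply: lte_mul_pinfty => //.
    by rewrite lee_fin mulr_ge0// sqr_ge0.
  exact: vol_spacetime_fin volP.
apply: ae_ge0_le_integral => //.
- by move=> p _; rewrite lee_fin sqsum_ge0.
- apply/measurable_EFinP; apply: measurable_sqsum.
  apply: (measurable_flow_comp alpha0 mov cM beta gamma weak_differentialP
    (weak_covariant_derivative0 T alpha f)) => i b.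
  rewrite /measurable_in /vector_in; under eq_fun do rewrite mul0mx mxE.
  exact: measurable_cst.
- by move=> p _; rewrite lee_fin mulr_ge0// sqr_ge0.
apply: ae_imply2 (weak_differential_unique alpha0 mov volP cM weak_differentialP wP) wC.
move=> p dw pC pT; rewrite lee_fin zE (dw pT).
rewrite mulrC -ler_pdivrMr ?exprn_gt0//; apply: le_trans (gbar_dual_ge alpha0 mov _ pT) _.
by apply: le_trans (pC pT) _; exact: ler_norm.
Qed.

Lemma minimizer_exists : exists ubar : R * M -> 'rV[R]_(1 + 2),
  [/\ energy_dom S T f alpha vol ubar,
      (forall vbar, energy_dom S T f alpha vol vbar ->
        (energy S T f alpha vol beta gamma I ubar <=
         energy S T f alpha vol beta gamma I vbar)%E)
    & (forall vbar, energy_dom S T f alpha vol vbar ->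
        (energy S T f alpha vol beta gamma I vbar <=
         energy S T f alpha vol beta gamma I ubar)%E ->
        {ae vol, forall p, spacetime T p -> vbar p = ubar p})].
Proof.
have zero_class : flow_class (comp (fun=> 0) (fun=> 0)).
  exists (fun=> 0), (fun=> 0); split => //.
  - exact: weak_covariant_derivative0.
  - move=> i b; rewrite /measurable_in /vector_in; under eq_fun do rewrite mul0mx mxE.
    exact: measurable_cst.
  - by exists (fun=> 0) => p; rewrite row_mx0.
have [w [[u [A [uA mu su wE]]] wfin wmin wuniq]] :=
  least_energy_exists mspace measurable_flow_class flow_class_midpoint
    flow_class_closed (ex_intro2 _ _ _ zero_class sqnorm2_zero_fin).
have wcomp : sqnorm2 vol space w = sqnorm2 vol space (comp u A).
  apply: eq_integral => p; rewrite inE => pT; congr EFin.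
  by apply: eq_bigr => k _; rewrite wE.
(* [A] comes from membership in the class and need not be [nablabar u]; the two agree almost
   everywhere. *)
have eu : energy S T f alpha vol beta gamma I u = sqnorm2 vol space w.
  by rewrite (energy_sqnorm2 uA su mu) wcomp; apply: sqnorm2_unique => //; exact: nablabarP uA.
have dom_class v : energy_dom S T f alpha vol v -> flow_class (comp v (nabla v)) /\
    energy S T f alpha vol beta gamma I v = sqnorm2 vol space (comp v (nabla v)).
  move=> [[mv _ [B [vB _]]] sv]; split; last exact: energy_sqnorm2 vB sv mv.
  by exists v, (nabla v); split => //; exact: nablabarP vB.
(* The terms weighted by [beta] and [gamma] are both summands of [sqsum], so finiteness of the least
   energy places the minimiser in H^1. *)
have fin (h : R * M -> R) (c : R) : 0 < c -> (forall p, spacetime T p ->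
    0 <= c * h p <= sqsum (comp u A) p) -> measurable_fun space h ->
    (\int[vol]_(p in space) (h p)%:E < +oo)%E.
  move=> c0 hc mh.
  have ms : measurable_fun space (fun p : X => (sqsum (comp u A) p)%:E).
    apply/measurable_EFinP; apply: measurable_sqsum.
    exact: (measurable_flow_comp alpha0 mov cM beta gamma weak_differentialP uA mu).
  apply: (@le_lt_trans _ _ (\int[vol]_(p in space) (c^-1%:E * (sqsum (comp u A) p)%:E))%E).
    apply: ge0_le_integral => //.
    - by move=> p pT; have /andP[] := hc p pT; rewrite lee_fin pmulr_rge0.
    - exact/measurable_EFinP.
    - exact: measurable_funeM.
    move=> p pT; have /andP[_ hp] := hc p pT.
    by rewrite -EFinM lee_fin mulrC ler_pdivlMr// mulrC.
  rewrite ge0_integralZl//; last 2 first.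
  - by move=> p _; rewrite lee_fin sqsum_ge0.
  - by rewrite lee_fin invr_ge0 ltW.
  apply: lte_mul_pinfty => //; first by rewrite lee_fin invr_ge0 ltW.
  by move: wfin; rewrite wcomp.
have sum_ge0 (J : finType) (h : J -> R) : 0 <= \sum_l h l ^+ 2.
  by apply: sumr_ge0 => l _; exact: sqr_ge0.
have udom : energy_dom S T f alpha vol u.
  split => //; split => //.
    apply: (fin _ beta) => // [p pT|].
      rewrite (flow_comp_mass _ A) sum_ge0 sqsum_comp addrCA lerDl.
      by rewrite addr_ge0 ?sqr_ge0.
    under eq_fun do rewrite gbarE.
    apply: measurable_sum => l; apply: measurable_funX.
    exact: measurable_ambient_vector.
  exists A; split => //; apply: (fin _ gamma) => // [p pT|].
    rewrite (flow_comp_gradient u _ pT) sum_ge0 sqsum_comp addrA lerDr.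
    by rewrite addr_ge0 ?sqr_ge0.
  apply: (eq_measurable_fun (fun p : X => \sum_l \sum_m
      ambient_tensor S alpha f A p l m ^+ 2)).
    by move=> p; rewrite inE => pT; rewrite (gbar11E alpha0 mov _ pT).
  apply: measurable_sum => l; apply: measurable_sum => m; apply: measurable_funX.
  by apply: measurable_ambient_tensor => // i a b; case: (uA i a b).
exists u; split; [exact: udom| |] => v vdom; have [vc ev] := dom_class v vdom.
  by rewrite ev eu; exact: wmin.
rewrite ev eu => vmin.
apply: ae_imply (wuniq _ vc vmin) => p vw pT.
(* Of all components only those of the vector are needed: [Num.sqrt beta] is nonzero, and the frame
   has a right inverse. *)
have vu : ambient_vector S alpha f v p = ambient_vector S alpha f u p.
  apply/rowP => l; have := vw pT (inr (inl l)); rewrite wE//=.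
  by move=> /mulfI; apply; rewrite gt_eqF// sqrtr_gt0.
rewrite (vector_of_ambient alpha0 mov v pT) vu.
exact/esym/(vector_of_ambient alpha0 mov u pT).
Qed.

End minimisation.

Theorem theorem1 (R : realType) (M : ptopologicalType) (S : surface R M)
    (T alpha : R) (f : R -> M -> 'rV[R]_3)
    (vol : {measure set (spacetime_type (R := R) (M := M)) -> \bar R})
    (beta gamma : R) (I : R * M -> R) :
  hausdorff_space M -> compact [set: M] ->
  0 < T -> 0 < alpha ->
  is_moving_surface S T f ->
  is_volume S T f alpha vol ->
  0 < beta -> 0 < gamma ->
  in_W1oo S T f alpha vol I ->
  exists ubar : R * M -> 'rV[R]_(1 + 2),
    [/\ energy_dom S T f alpha vol ubar,
        (forall vbar, energy_dom S T f alpha vol vbar ->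
          (energy S T f alpha vol beta gamma I ubar <=
           energy S T f alpha vol beta gamma I vbar)%E)
      & (forall vbar, energy_dom S T f alpha vol vbar ->
          (forall wbar, energy_dom S T f alpha vol wbar ->
            (energy S T f alpha vol beta gamma I vbar <=
             energy S T f alpha vol beta gamma I wbar)%E) ->
          {ae vol, forall p, spacetime T p -> vbar p = ubar p})].
Proof.
move=> _ cM _ alpha0 mov volP beta0 gamma0 WI.
have [u [udom umin uuniq]] := minimizer_exists alpha0 mov cM volP beta0 gamma0 WI.
exists u; split; [exact: udom|exact: umin|] => v vdom vmin.
exact: uuniq v vdom (vmin u udom).
Qed.
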